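(* Let $F$ be a centered and square-integrable random vector with density $f:\mathbb R^d\to[0,\infty)$, let $C>0$ (positive definite) be its covariance matrix, and assume that $\tau_F$ is a Stein matrix for $F$. Let $Z\sim\mathscr N_d(0,C)$ be a Gaussian random vector independent of $F$, and write $\widetilde Z=C^{-1}Z$. If, for some $\kappa,\eta>0$ and $\alpha\in(0,\frac12]$, one has $$E\big[|\tau_F^{j,k}(F)|^{\eta+2}\big]<\infty,\qquad j,k=1,\dots,d,$$ as well as $$\mathbf{TV}\big(\sqrt t\,F+\sqrt{1-t}\,\mathbf x,\,F\big)\le\kappa(1+\|\mathbf x\|_1)(1-t)^\alpha,\qquad\mathbf x\in\mathbb R^d,\ t\in[1/2,1],$$ then, provided $$\Delta:=E\big[\|C-\tau_F(F)\|_{H.S.}^2\big]=\sum_{j,k=1}^dE\Big[\big(C(j,k)-\tau_F^{j,k}(F)\big)^2\Big]\le2^{-\frac{\eta+1}{\alpha\eta}},$$ one has $$D(F\|Z)\le\frac{d(\eta+1)\lambda_{\max}(C^{-1})}{2\alpha\eta}\max_{1\le l\le d}E[(\widetilde Z_l)^2]\times\Delta\,|\log\Delta|+\frac{C_{d,\eta,\tau}(\eta+1)\lambda_{\max}(C^{-1})}{2\alpha\eta}\,\Delta,$$ where $$C_{d,\eta,\tau}:=2d^2\Big(2\kappa\,E[\|Z\|_1(1+\|Z\|_1)]+\sqrt{\max_jC(j,j)}\Big)\max_{1\le l\le d}E\big[|\widetilde Z_l|^{\eta+2}\big]^{\frac1{\eta+1}}\times\sum_{j,k=1}^d\Big(|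C(j,k)|^{\eta+2}+E\big[|\tau_F^{j,k}(F)|^{\eta+2}\big]\Big)^{\frac1{\eta+1}}.$$
   Context: A Stein matrix for $F=(F_1,\dots,F_d)$ is a matrix-valued map $\tau_F=\{\tau_F^{i,j}\}:\mathbb R^d\to M(d,\mathbb R)$ (the space of $d\times d$ real matrices) such that $\tau_F^{i,j}(F)\in L^1$ for all $i,j$ and $E[F_ig(F)]=\sum_{j=1}^dE[\tau_F^{i,j}(F)\,\partial_jg(F)]$, $i=1,\dots,d$, for every differentiable $g:\mathbb R^d\to\mathbb R$ such that both sides are well defined. The relative entropy is $D(F\|Z)=\int_{\mathbb R^d}f(\mathbf x)\log(f(\mathbf x)/\phi(\mathbf x))\,d\mathbf x$, where $\phi$ is the density of $Z$; $0\log0:=0$. $\mathbf{TV}(X,Y)=\sup_{A\in\mathscr B(\mathbb R^d)}|P[X\in A]-P[Y\in A]|$. $\|\cdot\|_{H.S.}$ is the Hilbert–Schmidt norm, $\|\mathbf x\|_1=\sum_i|x_i|$, and $\lambda_{\max}$ is the largest eigenvalue. *)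

(* Defs.v *)
From HB Require Import structures.
From mathcomp Require Import all_boot all_order all_algebra.
From mathcomp Require Import all_classical all_reals all_analysis.
From mathcomp Require Import measurable_realfun.

Set Implicit Arguments.
Unset Strict Implicit.
Unset Printing Implicit Defensive.

Import Order.TTheory GRing.Theory Num.Theory.
Import numFieldNormedType.Exports.

Local Open Scope classical_set_scope.
Local Open Scope ring_scope.

(* Matrices (in particular row vectors, which model R^d) carry the Borel
   sigma-algebra, generated by the open sets. *)
HB.instance Definition _ (R : realType) (m n : nat) :=
  @isMeasurable.Build (sigma_display (@open 'M[R]_(m, n))) 'M[R]_(m, n)
    <<s @open 'M[R]_(m, n) >> (@sigma_algebra0 _ setT _)
    (@sigma_algebraC 'M[R]_(m, n) _) (@sigma_algebra_bigcup _ setT _).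

Lemma open_measurable_mx (R : realType) m n (U : set 'M[R]_(m, n)) :
  open U -> measurable U.
Proof. by move=> oU; exact: sub_sigma_algebra. Qed.

Lemma measurable_mx_coord (R : realType) m n (i : 'I_m) (j : 'I_n) :
  measurable_fun [set: 'M[R]_(m, n)] (fun M : 'M[R]_(m, n) => M i j).
Proof.
apply: (measurability _ (RGenOpens.measurableE R)).
move=> _ [_ [a [b ->] <-]]; rewrite setTI; apply: open_measurable_mx.
apply: open_comp; last exact: interval_open.
by move=> M _; exact: coord_continuous.
Qed.

Lemma measurable_fun_mxP d (T : measurableType d) (R : realType) m n
    (f : T -> 'M[R]_(m, n)) :
  measurable_fun [set: T] f <->
  forall i j, measurable_fun [set: T] (fun x => f x i j).
Proof.
split=> [mf i j|mf].
  exact: measurableT_comp (measurable_mx_coord i j) mf.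
apply: (measurability (@open 'M[R]_(m, n)) erefl) => _ [U oU <-].
rewrite setTI.
pose e (k : nat) : R := k.+1%:R^-1.
pose q (p : 'M[rat]_(m, n) * nat) : 'M[R]_(m, n) := map_mx ratr p.1.
pose G p := [set x | ball (q p) (e p.2) `<=` U /\ ball (q p) (e p.2) (f x)].
have -> : f @^-1` U = \bigcup_p G p.
  apply/seteqP; split=> [x /= Ufx|x [p _ [pU] /pU//]].
  have /nbhs_ballP[r r0 rU] := open_nbhs_nbhs (conj oU Ufx).
  have [k ek] : exists k, e k < r / 2.
    have /ltr_add_invr[k] : 0 < r / 2 by rewrite divr_gt0.
    by rewrite add0r; exists k.
  have ek0 : 0 < e k by rewrite invr_gt0.
  have qP i j : exists a : rat, ball (f x i j) (e k) (ratr a : R).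
    have : f x i j - e k < f x i j + e k.
      by rewrite ltrD2l (lt_trans _ ek0)// oppr_lt0.
    move=> /rat_in_itvoo[a]; rewrite in_itv/= => /andP[h1 h2]; exists a.
    by rewrite /ball/= ltr_distlC h1 h2.
  pose A := \matrix_(i, j) xget 0 [set a : rat | ball (f x i j) (e k) (ratr a)].
  have qfx : ball (f x) (e k) (q (A, k)).
    split=> // i j; rewrite !mxE.
    have [a ha] := qP i j.
    exact: (@xgetPex _ 0 [set a : rat | ball (f x i j) (e k) (ratr a)]
              (ex_intro _ a ha)).
  exists (A, k) => //; split; last exact: ball_sym.
  move=> y qy; apply: rU; apply: le_ball (ball_triangle qfx qy) => /=.
  by rewrite (splitr r) lerD// ltW.
apply: countable_bigcupT_measurable => // p.
have [pU|pU] := pselect (ball (q p) (e p.2) `<=` U); last first.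
  suff -> : G p = set0 by exact: measurable0.
  by apply/seteqP; split => // x [].
suff -> : G p = \bigcap_(ij in [set: 'I_m * 'I_n])
    ((fun x => f x ij.1 ij.2) @^-1` ball (q p ij.1 ij.2) (e p.2)).
  apply: fin_bigcap_measurable => // ij _.
  rewrite -[X in measurable X]setTI; apply: mf => //.
  by apply: open_measurable; exact: ball_open.
apply/seteqP; split=> [x [_ [_ h]] [i j] _//=|x h].
by split => //; split=> [|i j]; [rewrite invr_gt0|exact: (h (i, j) I)].
Qed.

Definition rV_cons (R : realType) (n : nat)
    (p : measurableTypeR R * 'rV[R]_n) : 'rV[R]_n.+1 :=
  row_mx (p.1)%:M p.2 : 'rV[R]_(1 + n).

Lemma rV_consEl (R : realType) n (p : measurableTypeR R * 'rV[R]_n) :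
  rV_cons p 0 (lshift n (0 : 'I_1)) = p.1.
Proof.
by rewrite [LHS](row_mxEl (p.1)%:M p.2 0 0) mxE eqxx mulr1n.
Qed.

Lemma rV_consEr (R : realType) n (p : measurableTypeR R * 'rV[R]_n) k :
  rV_cons p 0 (rshift 1 k) = p.2 0 k.
Proof. exact: row_mxEr. Qed.

Lemma measurable_rV_cons (R : realType) n :
  measurable_fun setT (@rV_cons R n).
Proof.
apply/measurable_fun_mxP => i j; rewrite ord1.
have [k ->|k ->] := split_ordP (j : 'I_(1 + n)).
  rewrite ord1 [X in measurable_fun _ X](_ : _ = fst)//.
  by apply/funext => p; exact: rV_consEl.
rewrite [X in measurable_fun _ X](_ : _ = (fun v : 'rV[R]_n => v 0 k) \o snd).
  apply: measurableT_comp => //; exact: measurable_mx_coord.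
by apply/funext => p; exact: rV_consEr.
Qed.

Section lebesgue_rV_step.
Context (R : realType) (n : nat).
Variable mu : {sigma_finite_measure set 'rV[R]_n -> \bar R}.

Definition lebesgue_rV_step : set 'rV[R]_n.+1 -> \bar R :=
  pushforward (lebesgue_measure \x mu)%E (@rV_cons R n).

Let step0 : lebesgue_rV_step set0 = 0%E.
Proof. by rewrite /lebesgue_rV_step /pushforward preimage_set0 (measure0 (lebesgue_measure \x mu)%E). Qed.

Let step_ge0 A : (0 <= lebesgue_rV_step A)%E.
Proof. exact: (measure_ge0 (lebesgue_measure \x mu)%E). Qed.

Let step_sigma_additive : semi_sigma_additive lebesgue_rV_step.
Proof.
move=> F mF tF mUF; rewrite /lebesgue_rV_step /pushforward preimage_bigcup.
have mc A : measurable A -> measurable (@rV_cons R n @^-1` A).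
  by move=> mA; rewrite -[X in measurable X]setTI; exact: measurable_rV_cons.
apply: (@measure_semi_sigma_additive _ _ _ (lebesgue_measure \x mu)%E).
- by move=> k; exact: mc.
- apply/trivIsetP => /= i j _ _ ij; rewrite -preimage_setI.
  by move/trivIsetP : tF => /(_ _ _ _ _ ij) ->//; rewrite preimage_set0.
- by rewrite -preimage_bigcup; exact: mc.
Qed.

HB.instance Definition _ := isMeasure.Build _ _ _
  lebesgue_rV_step step0 step_ge0 step_sigma_additive.

Let step_sigma_finite : sigma_finite setT lebesgue_rV_step.
Proof.
have /sigma_finiteP[F [TF ndF Foo]] := sigma_finiteT (@lebesgue_measure R).
have /sigma_finiteP[G [TG ndG Goo]] := sigma_finiteT mu.
pose psi (x : 'rV[R]_n.+1) : measurableTypeR R * 'rV[R]_n :=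
  (x 0 0, rsubmx (x : 'rV[R]_(1 + n))).
have mpsi : measurable_fun setT psi.
  apply: measurable_fun_pair; first exact: measurable_mx_coord.
  apply/measurable_fun_mxP => i j.
  rewrite [X in measurable_fun _ X](_ : _ =
    fun x : 'rV[R]_n.+1 => x i (rshift 1 j : 'I_n.+1)).
    exact: measurable_mx_coord.
  by apply/funext => x; rewrite mxE.
have consK p : psi (rV_cons p) = p.
  case: p => a v; congr pair; last exact: row_mxKr.
  rewrite -[RHS](rV_consEl (a, v)); congr (rV_cons _ _ _); exact/val_inj.
exists (fun k => psi @^-1` (F k `*` G k)).
  rewrite -preimage_bigcup -[LHS](preimage_setT psi); congr (_ @^-1` _).
  rewrite -setXTT TF TG predeqE => -[x y]; split.
    move=> [/= [k _ Fkx] [l _ Gly]]; exists (maxn k l) => //; split.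
    - by move: x Fkx; exact/subsetPset/ndF/leq_maxl.
    - by move: y Gly; exact/subsetPset/ndG/leq_maxr.
  by move=> [k _ []/= ? ?]; split; exists k.
move=> k; have [mF Fy] := Foo k; have [mG Gy] := Goo k; split.
  by rewrite -[X in measurable X]setTI; apply: mpsi => //; exact: measurableX.
rewrite /lebesgue_rV_step /pushforward -comp_preimage.
have -> : psi \o @rV_cons R n = id by apply/funext => p; exact: consK.
rewrite preimage_id.
by rewrite product_measure1E// lte_mul_pinfty// ge0_fin_numE.
Qed.

HB.instance Definition _ :=
  @Measure_isSigmaFinite.Build _ _ _ lebesgue_rV_step step_sigma_finite.

End lebesgue_rV_step.

(* Lebesgue measure on R^d, as the d-fold product of Lebesgue measure on R. *)
Fixpoint lebesgue_rV (R : realType) (d : nat) :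
    {sigma_finite_measure set 'rV[R]_d -> \bar R} :=
  match d with
  | 0 => \d_(0 : 'rV[R]_0)
  | n.+1 => lebesgue_rV_step (lebesgue_rV R n)
  end.
Arguments lebesgue_rV {R} d.

Section linear_algebra.
Context {R : realType} {d : nat}.

Definition posdefmx (C : 'M[R]_d) :=
  C^T = C /\ forall x : 'rV[R]_d, x != 0 -> 0 < (x *m C *m x^T) 0 0.

Definition lambda_max (A : 'M[R]_d) : R := sup [set a : R | eigenvalue A a].

Definition hs_norm (A : 'M[R]_d) : R := Num.sqrt (\sum_j \sum_k A j k ^+ 2).

Definition l1_norm (x : 'rV[R]_d) : R := \sum_i `|x 0 i|.

End linear_algebra.

Section random_vectors.
Context {dO : measure_display} {Omega : measurableType dO} {R : realType}
  (P : probability Omega R) {d : nat}.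

Definition has_density (X : {RV P >-> 'rV[R]_d}) (f : 'rV[R]_d -> R) :=
  [/\ measurable_fun setT f, (forall x, 0 <= f x) &
      forall A, measurable A ->
        distribution P X A = (\int[lebesgue_rV d]_(x in A) (f x)%:E)%E].

Definition centered (X : {RV P >-> 'rV[R]_d}) :=
  forall i, 'E_P[fun w => X w ord0 i]%E = 0%E.

Definition square_integrable (X : {RV P >-> 'rV[R]_d}) :=
  forall i, (fun w => X w ord0 i) \in Lfun P 2%:E.

Definition covariance_matrix (X : {RV P >-> 'rV[R]_d}) (C : 'M[R]_d) :=
  forall i j,
    covariance P (fun w => X w ord0 i) (fun w => X w ord0 j) = (C i j)%:E.

Definition independent_rV (X Y : {RV P >-> 'rV[R]_d}) :=
  forall A B : set 'rV[R]_d, measurable A -> measurable B ->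
    P (X @^-1` A `&` Y @^-1` B) = (P (X @^-1` A) * P (Y @^-1` B))%E.

(* Density of N_d(0, C), for C positive definite. *)
Definition gaussian_pdf (C : 'M[R]_d) (x : 'rV[R]_d) : R :=
  expR (- (x *m invmx C *m x^T) 0 0 / 2) / Num.sqrt ((2 * pi) ^+ d * \det C).

Definition gaussian_rV (Z : {RV P >-> 'rV[R]_d}) (C : 'M[R]_d) :=
  has_density Z (gaussian_pdf C).

(* 'D_(delta_mx 0 j) g is the j-th partial derivative of g; membership in
   Lfun P 1 says that each expectation of the identity is well defined. *)
Definition stein_matrix (F : {RV P >-> 'rV[R]_d})
    (tau : 'rV[R]_d -> 'M[R]_d) :=
  [/\ measurable_fun setT tau,
      (forall i j, (fun w => tau (F w) i j) \in Lfun P 1) &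
      forall (i : 'I_d) (g : 'rV[R]_d -> R),
        (forall x, differentiable g x) ->
        (fun w => F w ord0 i * g (F w)) \in Lfun P 1 ->
        (forall j, (fun w => tau (F w) i j * 'D_(delta_mx 0 j) g (F w))
           \in Lfun P 1) ->
        ('E_P[fun w => (F w ord0 i * g (F w))%R] =
         \sum_j 'E_P[fun w => (tau (F w) i j * 'D_(delta_mx 0 j) g (F w))%R])%E].

Definition tv_distance (X Y : Omega -> 'rV[R]_d) : \bar R :=
  ereal_sup [set `|P (X @^-1` A) - P (Y @^-1` A)|%E | A in measurable].

(* Relative entropy of two random vectors with densities f and g; the
   convention 0 log 0 = 0 holds because 0 * ln 0 = 0. *)
Definition relative_entropy (f g : 'rV[R]_d -> R) : \bar R :=
  (\int[lebesgue_rV d]_x (f x * ln (f x / g x))%:E)%E.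

Definition stein_discrepancy (F : {RV P >-> 'rV[R]_d}) (C : 'M[R]_d)
    (tau : 'rV[R]_d -> 'M[R]_d) : \bar R :=
  'E_P[fun w => (hs_norm (C - tau (F w)) ^+ 2)%R]%E.

Lemma stein_discrepancyE (F : {RV P >-> 'rV[R]_d}) C tau :
  measurable_fun setT tau ->
  (stein_discrepancy F C tau =
   \sum_j \sum_k 'E_P[fun w => ((C j k - tau (F w) j k) ^+ 2)%R])%E.
Proof.
move=> mtau.
have m j k : measurable_fun setT (fun w => ((C j k - tau (F w) j k) ^+ 2)%:E).
  apply/measurable_EFinP; apply: measurable_funX; apply: measurable_funB => //.
  have mc : measurable_fun setT (fun M : 'M[R]_d => M j k).
    exact: measurable_mx_coord.
  exact: measurableT_comp mc (measurableT_comp mtau (measurable_funPT F)).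
have p j k w : (0 <= ((C j k - tau (F w) j k) ^+ 2)%:E)%E.
  by rewrite lee_fin sqr_ge0.
rewrite /stein_discrepancy unlock.
under eq_integral => w _.
  rewrite /hs_norm sqr_sqrtr; last first.
    by apply: sumr_ge0 => j _; apply: sumr_ge0 => k _; exact: sqr_ge0.
  rewrite -sumEFin; under eq_bigr => j _.
    rewrite -sumEFin; under eq_bigr => k _ do rewrite !mxE.
    over.
  over.
rewrite ge0_integral_sum//=; last 2 first.
- by move=> j; apply: emeasurable_sum => k; exact: m.
- by move=> j w _; apply: sume_ge0 => k _; exact: p.
by apply: eq_bigr => j _; rewrite ge0_integral_sum.
Qed.

(* The l-th coordinate of C^-1 Z, with Z seen as a column vector. *)
Definition Ztilde (C : 'M[R]_d) (Z : {RV P >-> 'rV[R]_d}) (l : 'I_d) :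
    Omega -> R :=
  fun w => (invmx C *m (Z w)^T) l 0.

(* All expectations below are finite under the hypotheses of the theorem, so
   that fine loses no information; the maxima are over nonnegative
   quantities. *)
Definition entropy_const (eta kappa : R) (C : 'M[R]_d)
    (F Z : {RV P >-> 'rV[R]_d}) (tau : 'rV[R]_d -> 'M[R]_d) : R :=
  2 * d%:R ^+ 2
  * (2 * kappa * fine 'E_P[fun w => (l1_norm (Z w) * (1 + l1_norm (Z w)))%R]%E
     + Num.sqrt (\big[Num.max/0]_(j < d) C j j))
  * (\big[Num.max/0]_(l < d)
       (fine 'E_P[fun w => (`|Ztilde C Z l w| `^ (eta + 2))%R]%E `^ (eta + 1)^-1))
  * \sum_(j < d) \sum_(k < d)
      (`|C j k| `^ (eta + 2) + fine 'E_P[fun w => (`|tau (F w) j k| `^ (eta + 2))%R]%E)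
        `^ (eta + 1)^-1.

End random_vectors.
Arguments tv_distance {dO Omega R} P {d} X Y.

(* Main.v *)
(** The observation [Y_b = Z + b F] of [F] through a Gaussian channel, rescaled by
    [1 / sqrt (1 + b^2)], interpolates between [Z] at [b = 0] and [F] at
    [b = oo], and the growth of its relative entropy is governed by the energy
    [J b] of the conditional expectation of [F] given [Y_b].  No derivative of
    the entropy is taken: Gibbs' variational principle and the convexity of the
    log-likelihood bound its increments, and Riemann sums add them up.

    Write [w = 1 + b^2] and [beta = alpha eta / (eta + 1)].  The Stein identity,
    applied to functions smoothed by the noise, bounds the entropy increment by
    a multiple of [Delta dw / w].  The total variation hypothesis shows that
    the conditional expectation of [Z] given [Y_b] is small in [L^1], and, by
    interpolation with the moments of order [eta + 2] of [Z], bounds the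
    increment by a multiple of [w^(- beta - 1) dw].  Switching from the first
    bound to the second when [w^(- beta)] is comparable to [Delta] gives
    [Delta |log Delta|].

    The entropy of [F] itself is reached by duality: for bounded [g] the
    Donsker-Varadhan inequality passes to the limit [b = oo], because the
    rescaled [Y_b] tends to [F] in total variation. *)
From HB Require Import structures.
Require Import Defs.
From mathcomp Require Import all_boot all_order all_algebra.
From mathcomp Require Import all_classical all_reals all_analysis.
From mathcomp Require Import measurable_realfun.
From mathcomp Require Import ring lra.

Set Implicit Arguments.
Unset Strict Implicit.
Unset Printing Implicit Defensive.

Import Order.TTheory GRing.Theory Num.Theory.
Import numFieldNormedType.Exports.

Local Open Scope classical_set_scope.
Local Open Scope ring_scope.

(** * Lebesgue measure on row vectors *)

(** The benchmark is a Gaussian signal: if [F] had law N(0, C), its conditional expectation given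
    [Y_b] would be [(b / w) Y_b], of energy [d (1 - 1 / w)]. Once the rescaling is accounted for,
    the entropy formally grows, per unit of [w], by half the excess of [J] over this value; both
    regimes bound that excess. The obstacle is regularity. Since [F] has only a measurable density,
    every derivative is put on the Gaussian weight of the Cameron-Martin formula. Its remainder,
    quadratic in the shift, yields the differentiable test functions of the Stein identity and also
    the Gaussian moments. With [t = b^2 / w], the rescaled [Y_b] is [sqrt t F + sqrt (1 - t) Z]. The
    range [t >= 1/2] of the hypothesis is [w >= 2], and the smallness of [Delta] makes the switch
    fall there. Interpolation produces the power [eta / (eta + 1)] of the noise weight, whereas the
    stated constant is linear in it. For a tiny weight the linear one may be too small; moving the
    switching time by a factor then gains a term of order [Delta] that compensates. *)

Section density.
Local Open Scope ereal_scope.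
Context d (T : measurableType d) (R : realType)
  (nu m : {measure set T -> \bar R}) (g : T -> R).
Hypotheses (mg : measurable_fun setT g) (g0 : forall x, (0 <= g x)%R).
Hypothesis nuE : forall A, measurable A -> nu A = \int[m]_(x in A) (g x)%:E.

Import HBNNSimple.

(** The density is given through measures of sets only; simple functions and monotone convergence on
    both sides extend it to integrals. *)
Lemma ge0_integral_density (f : T -> \bar R) :
  measurable_fun setT f -> (forall x, 0 <= f x) ->
  \int[nu]_x f x = \int[m]_x (f x * (g x)%:E).
Proof.
move=> mf f0; pose h := nnsfun_approx measurableT mf.
have -> : \int[nu]_x f x = limn (fun n => \int[nu]_x (h n x)%:E).
  rewrite -monotone_convergence//.
  - by apply: eq_integral => x _; apply/esym/cvg_lim => //; exact: cvg_nnsfun_approx.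
  - by move=> n; exact/measurable_EFinP.
  - by move=> n x _; rewrite lee_fin.
  - by move=> x _ a b ab; rewrite lee_fin; exact/lefP/nd_nnsfun_approx.
have -> : \int[m]_x (f x * (g x)%:E) =
    limn (fun n => \int[m]_x ((h n x)%:E * (g x)%:E)).
  rewrite -monotone_convergence//.
  - apply: eq_integral => x _; apply/esym/cvg_lim => //; apply: cvgeZr => //.
    exact: cvg_nnsfun_approx.
  - by move=> n; apply/measurable_EFinP; exact: measurable_funM.
  - by move=> n x _; rewrite lee_fin mulr_ge0.
  - move=> x _ a b ab; rewrite lee_fin ler_wpM2r//.
    exact/lefP/nd_nnsfun_approx.
congr (limn _); apply/funext => n.
have mi r : measurable_fun setT (fun x => (r * \1_(h n @^-1` [set r]) x)%:E).
  by apply/measurable_EFinP; exact: measurable_funM.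
transitivity (\int[nu]_x (\sum_(y \in range (h n))
    (y * \1_(h n @^-1` [set y]) x)%:E)).
  by apply: eq_integral => t tE; rewrite /= fimfunE -fsumEFin.
rewrite ge0_integral_fsum//; last by move=> y x _; exact: nnfun_muleindic_ge0.
transitivity (\int[m]_x (\sum_(y \in range (h n))
    (y * \1_(h n @^-1` [set y]) x)%:E * (g x)%:E)); last first.
  apply: eq_integral => x _.
  rewrite -ge0_mule_fsuml => [|y]; last exact: nnfun_muleindic_ge0.
  by rewrite fsumEFin// -(fimfunE _ x).
rewrite ge0_integral_fsum//; last 2 first.
- by move=> y; apply: emeasurable_funM => //; exact/measurable_EFinP.
- move=> y x _; apply: mule_ge0; last by rewrite lee_fin.
  exact: nnfun_muleindic_ge0.
apply: eq_fsbigr => r rhn.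
rewrite integralZl_indic_nnsfun//.
under [RHS]eq_integral do rewrite EFinM -muleA.
rewrite ge0_integralZl//.
- congr (_ * _); rewrite integral_indic// setIT nuE//.
  rewrite integral_mkcond; apply: eq_integral => x _.
  by rewrite epatch_indic muleC.
- by apply: emeasurable_funM; exact/measurable_EFinP.
- by move=> x _; rewrite mule_ge0 ?lee_fin.
- by move: rhn; rewrite inE => -[t _ <-]; rewrite lee_fin.
Qed.

End density.

Section lebesgue_affine.
Local Open Scope ereal_scope.
Context {R : realType}.

(** The pushforward scaled by [c] gives half-open intervals their length, which characterises
    Lebesgue measure. *)
Lemma lebesgue_affine (c b : R) (f : measurableTypeR R -> \bar R) : (0 < c)%R ->
  measurable_fun setT f -> (forall x, 0 <= f x) ->
  \int[lebesgue_measure]_x f x =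
  c%:E * \int[lebesgue_measure]_x f (c * x + b)%R.
Proof.
move=> c0 mf f0.
pose phi (x : measurableTypeR R) : measurableTypeR R := (c * x + b)%R.
have mphi : measurable_fun setT phi.
  by apply: measurable_funD => //; exact: measurable_funM.
have -> : \int[lebesgue_measure]_x f (c * x + b)%R =
    \int[pushforward lebesgue_measure phi]_x f x.
  by rewrite ge0_integral_pushforward.
have c00 : (0 <= c)%R by exact: ltW.
rewrite -[c]/((NngNum c00)%:num) -ge0_integral_mscale//.
apply: eq_measure_integral => A mA _.
apply: lebesgue_measure_unique => // _ [[u v]] _ <- /=.
rewrite /mscale/= /pushforward.
have -> : phi @^-1` `]u, v]%classic = `]((u - b) / c)%R, ((v - b) / c)%R]%classic.
  apply/seteqP; split => x /=; rewrite !in_itv/= /phi => /andP[h1 h2]; apply/andP;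
   split.
  - by rewrite ltr_pdivrMr// ltrBlDr mulrC.
  - by rewrite ler_pdivlMr// lerBrDr mulrC.
  - by move: h1; rewrite ltr_pdivrMr// ltrBlDr mulrC.
  - by move: h2; rewrite ler_pdivlMr// lerBrDr mulrC.
rewrite !lebesgue_measure_itv/= !lte_fin ltr_pM2r ?invr_gt0// ltrD2r.
case: ifP => _; last by rewrite mule0.
by rewrite -!EFinB -EFinM; congr EFin; field; rewrite gt_eqF.
Qed.

Lemma integral_lebesgue_rVS n (f : 'rV[R]_n.+1 -> \bar R) :
  measurable_fun setT f -> (forall x, 0 <= f x) ->
  \int[lebesgue_rV n.+1]_x f x =
  \int[lebesgue_measure]_a \int[lebesgue_rV n]_v f (rV_cons (a, v)).
Proof.
move=> mf f0.
transitivity (\int[lebesgue_measure \x lebesgue_rV n]_p f (rV_cons p)).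
  rewrite -[LHS]/(\int[pushforward (lebesgue_measure \x lebesgue_rV n) (@rV_cons R n)]_x f x).
  rewrite ge0_integral_pushforward//; exact: measurable_rV_cons.
rewrite fubini_tonelli1//.
by apply: measurableT_comp mf _; exact: measurable_rV_cons.
Qed.

Lemma measurable_rV_affine d (c : R) (b : 'rV[R]_d) :
  measurable_fun setT (fun x : 'rV[R]_d => (c *: x + b)%R).
Proof.
apply/measurable_fun_mxP => i j.
rewrite [X in measurable_fun _ X](_ : _ = fun x : 'rV[R]_d => (c * x i j + b i j)%R).
  apply: measurable_funD => //; apply: measurable_funM => //.
  exact: measurable_mx_coord.
by apply/funext => x; rewrite !mxE.
Qed.

Lemma rV_cons_affine n (c : R) (b : 'rV[R]_n.+1) (a : R) (v : 'rV[R]_n) :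
  (c *: rV_cons (a, v) + b)%R =
  rV_cons ((c * a + b 0 (lshift n (0 : 'I_1)))%R,
           (c *: v + rsubmx (b : 'rV[R]_(1 + n)))%R).
Proof.
apply/rowP => j; rewrite !mxE.
have [k ->|k ->] := split_ordP (j : 'I_(1 + n)).
  by rewrite (ord1 k) -!/(rV_cons (_, _)) !mxE ?ord1 !eqxx !mulr1n.
by rewrite !mxE.
Qed.

(** Only homotheties and translations occur in the proof, so the Jacobian is [c ^+ d] and induction
    on the coordinates suffices. *)
Lemma lebesgue_rV_affine d (c : R) (b : 'rV[R]_d) (f : 'rV[R]_d -> \bar R) :
  (0 < c)%R -> measurable_fun setT f -> (forall x, 0 <= f x) ->
  \int[lebesgue_rV d]_x f x =
  (c ^+ d)%:E * \int[lebesgue_rV d]_x f (c *: x + b)%R.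
Proof.
move=> c0; elim: d => [|n IH] in b f *.
  move=> mf f0; rewrite expr0 mul1e; apply: eq_integral => x _.
  by congr f; apply/rowP => -[].
move=> mf f0.
have mfc : measurable_fun setT (fun p : measurableTypeR R * 'rV[R]_n => f (rV_cons p)).
  by apply: measurableT_comp mf _; exact: measurable_rV_cons.
rewrite !integral_lebesgue_rVS//; last first.
  exact: (measurableT_comp mf (measurable_rV_affine c b)).
pose b0 := (b 0 (lshift n (0 : 'I_1)))%R; pose b' := rsubmx (b : 'rV[R]_(1 + n)).
pose h p := f (rV_cons (p.1, (c *: p.2 + b')%R)).
have mh : measurable_fun setT (h : measurableTypeR R * 'rV[R]_n -> \bar R).
  apply: (measurableT_comp mfc); apply: measurable_fun_pair => //=.
  exact: (measurableT_comp (measurable_rV_affine c b') measurable_snd).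
transitivity (\int[lebesgue_measure]_a ((c ^+ n)%:E *
    \int[lebesgue_rV n]_v h (a, v))).
  apply: eq_integral => a _; rewrite (IH b') //.
  by apply: measurableT_comp mfc _; exact: measurable_fun_pair.
pose H a := \int[lebesgue_rV n]_v h (a, v).
have mH : measurable_fun setT H.
  exact: (measurable_fun_fubini_tonelli_F (m2 := lebesgue_rV n) h mh (fun p => f0 _)).
have H0 a : 0 <= H a by apply: integral_ge0 => v _; exact: f0.
have cn0 : 0 <= (c ^+ n)%:E by rewrite lee_fin exprn_ge0// ltW.
rewrite (ge0_integralZl lebesgue_measure measurableT mH (fun a _ => H0 a) cn0).
rewrite exprSr EFinM -muleA; congr (_ * _).
rewrite (lebesgue_affine b0 c0 mH H0).
congr (_ * _); apply: eq_integral => a _; apply: eq_integral => v _.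
by rewrite rV_cons_affine.
Qed.

End lebesgue_affine.

(** * Real-valued integrals, bilinear forms and Gaussian measures *)

Section Rintegral_setT.
Context d (T : measurableType d) (R : realType) (m : {measure set T -> \bar R}).
Implicit Types f g : T -> R.

Definition Rintegrable f := m.-integrable setT (EFin \o f).

Lemma Rintegrable_measurable f : Rintegrable f -> measurable_fun setT f.
Proof. by move=> /measurable_int/measurable_EFinP. Qed.

Lemma RintegrableD f g : Rintegrable f -> Rintegrable g ->
  Rintegrable (fun x => f x + g x).
Proof. exact: (@integrableD _ _ _ m setT measurableT). Qed.

Lemma RintegrableB f g : Rintegrable f -> Rintegrable g ->
  Rintegrable (fun x => f x - g x).
Proof. exact: (@integrableB _ _ _ m setT measurableT). Qed.

Lemma RintegrableZ f r : Rintegrable f -> Rintegrable (fun x => r * f x).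
Proof. exact: (@integrableZl _ _ _ m setT measurableT r). Qed.

Lemma Rintegrable_sum (I : Type) (s : seq I) (h : I -> T -> R) :
  (forall i, Rintegrable (h i)) -> Rintegrable (fun x => \sum_(i <- s) h i x).
Proof.
move=> ih; rewrite /Rintegrable [EFin \o _](_ : _ =
  (fun x => \sum_(i <- s) (h i x)%:E)%E).
  by apply: integrable_sum => // i _; exact: ih.
by apply/funext => x /=; rewrite sumEFin.
Qed.

Lemma Rintegrable_le f g : measurable_fun setT f -> (forall x, `|f x| <= g x) ->
  Rintegrable g -> Rintegrable f.
Proof.
move=> mf fg; apply: le_integrable => //; first exact/measurable_EFinP.
by move=> x _; rewrite lee_fin (le_trans (fg x))// ler_norm.
Qed.

Lemma Rintegrable_norm f : Rintegrable f -> Rintegrable (fun x => `|f x|).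
Proof. exact: integrable_norm. Qed.

Lemma EFin_Rintegral f : Rintegrable f ->
  (\int[m]_x (f x)%:E = (\int[m]_x f x)%R%:E)%E.
Proof. by move=> fi; rewrite /Rintegral fineK//; exact: integrable_fin_num. Qed.

Lemma RintegralD_setT f g : Rintegrable f -> Rintegrable g ->
  \int[m]_x (f x + g x) = \int[m]_x f x + \int[m]_x g x.
Proof. exact: RintegralD. Qed.

Lemma RintegralB_setT f g : Rintegrable f -> Rintegrable g ->
  \int[m]_x (f x - g x) = \int[m]_x f x - \int[m]_x g x.
Proof. exact: RintegralB. Qed.

Lemma RintegralZ_setT f r : Rintegrable f ->
  \int[m]_x (r * f x) = r * \int[m]_x f x.
Proof. exact: RintegralZl. Qed.

Lemma Rintegral_sum (I : Type) (s : seq I) (h : I -> T -> R) :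
  (forall i, Rintegrable (h i)) ->
  \int[m]_x (\sum_(i <- s) h i x) = \sum_(i <- s) \int[m]_x h i x.
Proof.
move=> ih; elim: s => [|i s IH].
  rewrite big_nil (@eq_Rintegral _ _ _ _ _ (cst 0)) ?Rintegral_cst ?mul0r//.
  by move=> x _; rewrite big_nil.
rewrite big_cons -IH -RintegralD_setT//; last exact: Rintegrable_sum.
by apply: eq_Rintegral => x _; rewrite big_cons.
Qed.

Lemma le_Rintegral_setT f g : Rintegrable f -> Rintegrable g ->
  (forall x, f x <= g x) -> \int[m]_x f x <= \int[m]_x g x.
Proof. by move=> fi gi fg; apply: le_Rintegral. Qed.

Lemma eq_Rintegral_setT f g : f =1 g -> \int[m]_x f x = \int[m]_x g x.
Proof. by move=> fg; apply: eq_Rintegral => x _; exact: fg. Qed.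

Lemma eq_Rintegrable f g : f =1 g -> Rintegrable f -> Rintegrable g.
Proof. by move=> /funext ->. Qed.

Lemma ge0_RintegrableP f r : measurable_fun setT f -> (forall x, 0 <= f x) ->
  (\int[m]_x (f x)%:E = r%:E)%E -> Rintegrable f /\ \int[m]_x f x = r.
Proof.
move=> mf f0 fr; split; last by rewrite /Rintegral fr.
apply/integrableP; split; first exact/measurable_EFinP.
under eq_integral do rewrite /= ger0_norm//.
by rewrite fr ltry.
Qed.

Lemma ge0_Rintegrable f : measurable_fun setT f -> (forall x, 0 <= f x) ->
  (\int[m]_x (f x)%:E < +oo)%E -> Rintegrable f.
Proof.
move=> mf f0 fr; apply/integrableP; split; first exact/measurable_EFinP.
by under eq_integral do rewrite /= ger0_norm//.
Qed.

Lemma le_norm_Rintegral f g : measurable_fun setT f -> (forall x, `|f x| <= g x) ->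
  Rintegrable g -> `|\int[m]_x f x| <= \int[m]_x g x.
Proof.
move=> mf fg gi; have fi := Rintegrable_le mf fg gi.
apply: le_trans (le_normr_Rintegral _ fi) _ => //.
by apply: le_Rintegral_setT => //; exact: Rintegrable_norm.
Qed.

Definition square_Rintegrable f :=
  measurable_fun setT f /\ Rintegrable (fun x => f x ^+ 2).

Lemma square_RintegrableM f g : square_Rintegrable f -> square_Rintegrable g ->
  Rintegrable (fun x => f x * g x).
Proof.
move=> [mf f2] [mg g2]; apply: (@Rintegrable_le _ (fun x => f x ^+ 2 + g x ^+ 2)).
- exact: measurable_funM.
- move=> x; rewrite normrM -(real_normK (num_real (f x))).
  rewrite -(real_normK (num_real (g x))).
  set a := `|f x|; set b := `|g x|.
  have : 0 <= (a - b) ^+ 2 by exact: sqr_ge0.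
  have := sqr_ge0 a; have := sqr_ge0 b; rewrite sqrrB; lra.
- exact: RintegrableD.
Qed.

Lemma square_RintegrableZ f r : square_Rintegrable f ->
  square_Rintegrable (fun x => r * f x).
Proof.
move=> [mf f2]; split; first exact: measurable_funM.
apply: eq_Rintegrable (RintegrableZ (r ^+ 2) f2) => x.
by rewrite exprMn.
Qed.

Lemma square_RintegrableD f g : square_Rintegrable f -> square_Rintegrable g ->
  square_Rintegrable (fun x => f x + g x).
Proof.
move=> hf hg; have fg := square_RintegrableM hf hg; case: hf hg => [mf f2] [mg g2].
split; first exact: measurable_funD.
apply: eq_Rintegrable (RintegrableD (RintegrableD f2 g2) (RintegrableZ 2 fg)).
by move=> x; ring.
Qed.

Lemma square_RintegrableB f g : square_Rintegrable f -> square_Rintegrable g ->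
  square_Rintegrable (fun x => f x - g x).
Proof.
move=> hf /(square_RintegrableZ (-1)) hg.
have := square_RintegrableD hf hg.
by under [X in square_Rintegrable X -> _]eq_fun do rewrite mulN1r.
Qed.

Lemma square_Rintegrable_le f g : measurable_fun setT f ->
  (forall x, `|f x| <= `|g x|) -> square_Rintegrable g -> square_Rintegrable f.
Proof.
move=> mf fg [mg g2]; split => //; apply: Rintegrable_le g2.
  exact: measurable_funX.
by move=> x; rewrite normrX -(real_normK (num_real (g x))) lerXn2r ?nnegrE.
Qed.

End Rintegral_setT.

Section Rintegral_probability.
Context d (T : measurableType d) (R : realType) (m : probability T R).

Lemma Rintegral_cst1 r : \int[m]_x r = r.
Proof.
rewrite Rintegral_cst// -[RHS]mulr1; congr (_ * _).
by rewrite -[RHS]/(fine 1%E); congr fine; exact: probability_setT.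
Qed.

Lemma Rintegrable_cst r : Rintegrable m (fun=> r).
Proof. exact: finite_measure_integrable_cst. Qed.

Lemma square_Rintegrable_cst r : square_Rintegrable m (fun=> r).
Proof. by split => //; exact: Rintegrable_cst. Qed.

Lemma square_RintegrableW (f : T -> R) : square_Rintegrable m f -> Rintegrable m f.
Proof.
move=> hf; have := square_RintegrableM hf (square_Rintegrable_cst 1).
by under [X in Rintegrable _ X -> _]eq_fun do rewrite mulr1.
Qed.

Lemma square_Rintegrable_bounded (f : T -> R) (M : R) : measurable_fun setT f ->
  (forall x, `|f x| <= M) -> square_Rintegrable m f.
Proof.
move=> mf fM; apply: square_Rintegrable_le mf _ (square_Rintegrable_cst M).
by move=> x; rewrite (le_trans (fM x))// ler_norm.
Qed.

End Rintegral_probability.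

Section bilinear_form.
Context {R : realType} {d : nat}.
Implicit Types (A C : 'M[R]_d) (x y z : 'rV[R]_d).

(** With [A := invmx C] this is the Cameron-Martin inner product of N(0, C), the metric in which all
    energies are measured. *)
Definition bform A x y : R := (x *m A *m y^T) 0 0.

Lemma bformE A x y : bform A x y = \sum_j \sum_i x 0 i * A i j * y 0 j.
Proof.
rewrite /bform mxE; apply: eq_bigr => j _; rewrite !mxE big_distrl/=.
by apply: eq_bigr.
Qed.

Lemma bformDl A x y z : bform A (x + y) z = bform A x z + bform A y z.
Proof. by rewrite /bform !mulmxDl mxE. Qed.

Lemma bformDr A x y z : bform A z (x + y) = bform A z x + bform A z y.
Proof. by rewrite /bform linearD mulmxDr mxE. Qed.

Lemma bformZl A c x y : bform A (c *: x) y = c * bform A x y.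
Proof. by rewrite /bform -!scalemxAl mxE. Qed.

Lemma bformZr A c x y : bform A x (c *: y) = c * bform A x y.
Proof. by rewrite /bform linearZ -scalemxAr mxE. Qed.

Lemma bformNr A x y : bform A x (- y) = - bform A x y.
Proof. by rewrite -scaleN1r bformZr mulN1r. Qed.

Lemma bformNl A x y : bform A (- x) y = - bform A x y.
Proof. by rewrite -scaleN1r bformZl mulN1r. Qed.

Lemma bformC A x y : A^T = A -> bform A x y = bform A y x.
Proof.
move=> AT; rewrite /bform; transitivity ((x *m A *m y^T)^T 0 0).
  by rewrite [RHS]mxE.
by rewrite !trmx_mul trmxK AT mulmxA.
Qed.

Lemma bform_sqrD A x y : A^T = A ->
  bform A (x + y) (x + y) = bform A x x + 2 * bform A x y + bform A y y.
Proof. by move=> AT; rewrite bformDl !bformDr (bformC y x AT); ring. Qed.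

Lemma measurable_bform dT (T : measurableType dT) A (f g : T -> 'rV[R]_d) :
  measurable_fun setT f -> measurable_fun setT g ->
  measurable_fun setT (fun t => bform A (f t) (g t)).
Proof.
move=> /measurable_fun_mxP mf /measurable_fun_mxP mg.
under eq_fun do rewrite bformE.
apply: measurable_sum => j; apply: measurable_sum => i.
by apply: measurable_funM => //; apply: measurable_funM.
Qed.

Lemma posdefmx_unit C : posdefmx C -> C \in unitmx.
Proof.
move=> [_ C0]; rewrite -row_free_unit -kermx_eq0; apply/rowV0P => v.
move=> /sub_kermxP vC; apply/eqP; apply: contraT => /C0.
by rewrite vC mul0mx mxE ltxx.
Qed.

Lemma posdefmx_inv_sym C : posdefmx C -> (invmx C)^T = invmx C.
Proof. by move=> [CT _]; rewrite trmx_inv CT. Qed.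

Lemma bform_inv_gt0 C x : posdefmx C -> x != 0 -> 0 < bform (invmx C) x x.
Proof.
move=> Cp x0; have Cu := posdefmx_unit Cp; have Ci := posdefmx_inv_sym Cp.
have /(proj2 Cp) : x *m invmx C != 0.
  by apply: contra_neq x0 => x0; rewrite -(mulmxKV Cu x) x0 mul0mx.
by rewrite mulmxKV// trmx_mul Ci mulmxA.
Qed.

Lemma bform_inv_ge0 C x : posdefmx C -> 0 <= bform (invmx C) x x.
Proof.
move=> Cp; have [->|/(bform_inv_gt0 Cp)/ltW//] := eqVneq x 0.
by rewrite /bform !mul0mx mxE.
Qed.

End bilinear_form.

(** * Shifts and scalings of the Gaussian measure *)

Section gaussian.
Context {R : realType} {d : nat} {C : 'M[R]_d} (gam : probability 'rV[R]_d R).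
Hypothesis Cp : posdefmx C.
Hypothesis gamE : forall A, measurable A ->
  gam A = (\int[lebesgue_rV d]_(x in A) (gaussian_pdf C x)%:E)%E.
Let q := bform (invmx C).

Lemma gaussian_pdf_ge0 (x : 'rV[R]_d) : 0 <= gaussian_pdf C x.
Proof. by rewrite /gaussian_pdf mulr_ge0// ?expR_ge0// invr_ge0 sqrtr_ge0. Qed.

Lemma measurable_gaussian_pdf : measurable_fun setT (gaussian_pdf C).
Proof.
rewrite /gaussian_pdf; apply: measurable_funM => //.
apply: measurableT_comp => //; apply: measurable_funM => //.
by apply: measurableT_comp => //; exact: measurable_bform.
Qed.

Lemma gaussian_integralE (f : 'rV[R]_d -> \bar R) : measurable_fun setT f ->
  (forall x, 0 <= f x)%E ->
  (\int[gam]_x f x = \int[lebesgue_rV d]_x (f x * (gaussian_pdf C x)%:E))%E.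
Proof.
by move=> mf f0; apply: ge0_integral_density => //;
  [exact: measurable_gaussian_pdf | exact: gaussian_pdf_ge0].
Qed.

(** Change of variables for Lebesgue measure, then expansion of the square in the exponent. The
    normalising factor is common to both sides and is never evaluated. *)
Lemma gaussian_affine (c : R) (b : 'rV[R]_d) (f : 'rV[R]_d -> \bar R) : 0 < c ->
  measurable_fun setT f -> (forall x, 0 <= f x)%E ->
  (\int[gam]_z f z = \int[gam]_z (f (c *: z + b)%R *
    (c ^+ d * expR (((1 - c ^+ 2) * q z z - 2 * c * q z b - q b b) / 2))%R%:E))%E.
Proof.
move=> c0 mf f0; have mg := measurable_gaussian_pdf.
have mfc : measurable_fun setT (fun x : 'rV[R]_d => f (c *: x + b)%R).
  exact: (measurableT_comp mf (measurable_rV_affine c b)).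
rewrite !gaussian_integralE//; last 2 first.
- apply: emeasurable_funM => //; apply/measurable_EFinP.
  apply: measurable_funM => //; apply: measurableT_comp => //.
  apply: measurable_funM => //; apply: measurable_funB; last first.
    exact: measurable_cst.
  apply: measurable_funB.
    by apply: measurable_funM => //; exact: measurable_bform.
  by apply: measurable_funM => //; exact: measurable_bform.
- move=> x; rewrite mule_ge0// lee_fin mulr_ge0 ?expR_ge0// exprn_ge0//.
  exact: ltW.
rewrite (lebesgue_rV_affine b c0); last 2 first.
- by apply: emeasurable_funM => //; exact/measurable_EFinP.
- by move=> x; rewrite mule_ge0// lee_fin gaussian_pdf_ge0.
rewrite -ge0_integralZl//; last 3 first.
- apply: emeasurable_funM => //; apply/measurable_EFinP.
  exact: (measurableT_comp mg (measurable_rV_affine c b)).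
- by move=> x _; rewrite mule_ge0// lee_fin gaussian_pdf_ge0.
- by rewrite lee_fin exprn_ge0// ltW.
apply: eq_integral => x _.
rewrite muleCA -muleA; congr (_ * _)%E; rewrite -!EFinM; congr EFin.
rewrite -[RHS]mulrA; congr (_ * _).
rewrite /gaussian_pdf mulrA; congr (_ * _).
rewrite -expRD; congr expR.
rewrite -!/(bform _ _ _) -/q /q (bform_sqrD _ _ (posdefmx_inv_sym Cp)).
by rewrite !bformZl !bformZr; field.
Qed.

(** The Cameron-Martin formula. Shifting the right-hand side by [x] through [gaussian_affine] makes
    the two exponential weights cancel. *)
Lemma gaussian_shift (x : 'rV[R]_d) (f : 'rV[R]_d -> \bar R) :
  measurable_fun setT f -> (forall x, 0 <= f x)%E ->
  (\int[gam]_z f (z + x)%R =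
   \int[gam]_z (f z * (expR (q x z - q x x / 2))%:E))%E.
Proof.
move=> mf f0.
have mq : measurable_fun setT (fun z : 'rV[R]_d => (expR (q x z - q x x / 2))).
  by apply: measurableT_comp => //; apply: measurable_funB => //; exact: measurable_bform.
rewrite [RHS](gaussian_affine x ltr01); last 2 first.
- by apply: emeasurable_funM => //; exact/measurable_EFinP.
- by move=> z; rewrite mule_ge0// lee_fin expR_ge0.
apply: eq_integral => z _; rewrite scale1r -muleA -EFinM expr1n mul1r -expRD.
rewrite [X in expR X](_ : _ = 0) ?expR0 ?mule1//.
by rewrite /q bformDr (bformC z x (posdefmx_inv_sym Cp)); field.
Qed.

Lemma gaussian_scale (c : R) (f : 'rV[R]_d -> \bar R) : 0 < c ->
  measurable_fun setT f -> (forall x, 0 <= f x)%E ->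
  (\int[gam]_z f z = \int[gam]_z (f (c *: z)%R *
    (c ^+ d * expR ((1 - c ^+ 2) * q z z / 2))%R%:E))%E.
Proof.
move=> c0 mf f0; rewrite (gaussian_affine 0 c0 mf f0); apply: eq_integral => z _.
have q0 y : q y 0 = 0 by rewrite /q /bform trmx0 mulmx0 mxE.
by rewrite addr0 !q0 mulr0 !subr0.
Qed.

(** Cameron-Martin for the constant 1: a shift preserves the total mass, which determines the
    Laplace transform. The exponential moments used for domination derive from it. *)
Lemma gaussian_expR (x : 'rV[R]_d) :
  Rintegrable gam (fun z => expR (q x z)) /\
  \int[gam]_z expR (q x z) = expR (q x x / 2).
Proof.
have mq : measurable_fun setT (fun z : 'rV[R]_d => expR (q x z)).
  by apply: measurableT_comp => //; exact: measurable_bform.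
apply: ge0_RintegrableP => //.
have := @gaussian_shift x (cst 1%E) (measurable_cst _) (fun=> lee01).
rewrite integral_cst// mul1e [X in X = _ -> _]probability_setT.
move=> h; have e0 : expR (q x x / 2) != 0 by rewrite gt_eqF// expR_gt0.
rewrite -[RHS]mule1 h -ge0_integralZl//; last 2 first.
- apply: emeasurable_funM => //; apply/measurable_EFinP.
  apply: measurableT_comp => //; apply: measurable_funB => //.
  exact: measurable_bform.
- by move=> z _; rewrite mul1e lee_fin expR_ge0.
apply: eq_integral => z _; rewrite mul1e -EFinM -expRD; congr (expR _)%:E.
by ring.
Qed.

End gaussian.

Section expR_remainder.
Context {R : realType}.
Implicit Types u w k : R.

Lemma expR_taylor1 u : 0 <= expR u - 1 - u <= u ^+ 2 * expR `|u|.
Proof.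
have h1 := expR_ge1Dx u; have h2 := expR_ge1Dx (- u).
have u1 : expR u - 1 <= u * expR u.
  have : expR u * (1 + - u) <= expR u * expR (- u) by rewrite ler_pM2l// expR_gt0.
  rewrite -expRD subrr expR0; lra.
apply/andP; split; first by lra.
have [u0|u0] := leP 0 u.
  have : u * (expR u - 1) <= u * (u * expR u) by exact: ler_wpM2l.
  rewrite (ger0_norm u0) expr2 mulrA; lra.
have h3 : u * expR u <= u * (1 + u) by rewrite ler_wnM2l// ltW.
apply: (@le_trans _ _ (u ^+ 2)); first by rewrite expr2; lra.
by rewrite -[leLHS]mulr1 ler_wpM2l ?sqr_ge0// -expR0 ler_expR.
Qed.

(** Meant for the Cameron-Martin exponent: [w] is its part linear in the shift and is kept, [k] its
    quadratic part and is counted as an error. *)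
Lemma expR_remainder w k : 0 <= k ->
  `|expR (w - k) - 1 - w| <= (`|w| + k) ^+ 2 * expR (`|w| + k) + k.
Proof.
move=> k0; have /andP[l1 l2] := expR_taylor1 (w - k).
have nk : `|w - k| <= `|w| + k by rewrite (le_trans (ler_normB _ _))// (ger0_norm k0).
have : (w - k) ^+ 2 * expR `|w - k| <= (`|w| + k) ^+ 2 * expR (`|w| + k).
  rewrite ler_pM ?sqr_ge0 ?expR_ge0 ?ler_expR// -(real_normK (num_real (w - k))).
  by rewrite lerXn2r ?nnegrE// addr_ge0.
have : 0 <= (`|w| + k) ^+ 2 * expR (`|w| + k) by rewrite mulr_ge0 ?sqr_ge0 ?expR_ge0.
move=> h0 h; rewrite ler_norml; lra.
Qed.

End expR_remainder.

Section l1_norm.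
Context {R : realType} {d : nat}.
Implicit Types (x y : 'rV[R]_d) (A : 'M[R]_d).

Lemma l1_norm_ge0 x : 0 <= l1_norm x.
Proof. exact: sumr_ge0. Qed.

Lemma le_coord_l1_norm x i : `|x 0 i| <= l1_norm x.
Proof. by rewrite /l1_norm (bigD1 i)//= lerDl sumr_ge0. Qed.

Lemma le_coord_norm x i : `|x 0 i| <= `|x|.
Proof.
rewrite /Num.norm/= mx_normrE.
exact: (le_bigmax 0 (fun ij : 'I_1 * 'I_d => `|x ij.1 ij.2|) (0, i)).
Qed.

Lemma bform_le A x y : `|bform A x y| <= (\sum_j \sum_i `|A i j|) * `|x| * l1_norm y.
Proof.
rewrite bformE (le_trans (ler_norm_sum _ _ _))// !big_distrl/=.
apply: ler_sum => j _; rewrite (le_trans (ler_norm_sum _ _ _))// !big_distrl/=.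
apply: ler_sum => i _; rewrite !normrM mulrC [in leRHS]mulrC.
rewrite ler_pM ?mulr_ge0// ?le_coord_l1_norm//.
by rewrite mulrC ler_wpM2l// le_coord_norm.
Qed.

Lemma l1_norm_le x : l1_norm x <= d%:R * `|x|.
Proof.
rewrite /l1_norm -[X in X%:R]card_ord -sum1_card natr_sum big_distrl/=.
by apply: ler_sum => i _; rewrite mul1r le_coord_norm.
Qed.

Lemma measurable_l1_norm : measurable_fun setT (@l1_norm R d).
Proof.
apply: measurable_sum => i; apply: measurableT_comp => //.
exact: measurable_mx_coord.
Qed.

End l1_norm.

Section gaussian_moments.
Context {R : realType} {d : nat} {C : 'M[R]_d} (gam : probability 'rV[R]_d R).
Hypothesis Cp : posdefmx C.
Hypothesis gamE : forall A, measurable A ->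
  gam A = (\int[lebesgue_rV d]_(x in A) (gaussian_pdf C x)%:E)%E.
Let q := bform (invmx C).

(** Coordinates are Cameron-Martin functionals, so the formulas for [q h z] give the moments of the
    coordinates. *)
Lemma bform_row_inv (i : 'I_d) (z : 'rV[R]_d) : q (row i C) z = z 0 i.
Proof.
rewrite /q /bform rowE mulmxK; last exact: posdefmx_unit.
by rewrite -rowE !mxE.
Qed.

Lemma gaussian_expR_coord (c : R) (i : 'I_d) :
  Rintegrable gam (fun z => expR (c * z 0 i)) /\
  \int[gam]_z expR (c * z 0 i) = expR (c ^+ 2 * C i i / 2).
Proof.
have [h1 h2] := gaussian_expR Cp gamE (c *: row i C).
have e z : q (c *: row i C) z = c * z 0 i.
  by rewrite /q bformZl; congr (_ * _); exact: bform_row_inv.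
rewrite -(_ : q (c *: row i C) (c *: row i C) = c ^+ 2 * C i i); last first.
  by rewrite e !mxE expr2 mulrA.
by split; [move: h1; apply: eq_Rintegrable => z; rewrite -e
          |rewrite -h2; apply: eq_Rintegral_setT => z; rewrite -e].
Qed.

(** The l1 norm is at most [d] times the largest coordinate, and the exponential of an absolute
    value is at most a sum of two exponentials. This is the universal dominating function under
    [gam]. *)
Lemma Rintegrable_expR_l1 (c : R) : 0 <= c ->
  Rintegrable gam (fun z => expR (c * l1_norm z)).
Proof.
move=> c0; have [d0|d0] := posnP d.
  apply: (@eq_Rintegrable _ _ _ _ (fun=> 1)); last exact: Rintegrable_cst.
  move=> z; rewrite /l1_norm big1 ?mulr0 ?expR0// => i _.
  by have := leq_ltn_trans (leq0n i) (ltn_ord i); rewrite [X in (_ < X)%N]d0.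
pose F (z : 'rV[R]_d) :=
  \sum_i (expR (c * d%:R * z 0 i) + expR (- (c * d%:R) * z 0 i)).
apply: (@Rintegrable_le _ _ _ _ _ F).
- apply: measurableT_comp => //; apply: measurable_funM => //.
  exact: measurable_l1_norm.
- move=> z; rewrite ger0_norm ?expR_ge0//.
  pose i0 : 'I_d := Ordinal d0.
  case: (@arg_maxP _ _ _ i0 xpredT (fun i => `|z 0 i|)) => // k _ kmax.
  rewrite /F (bigD1 k)//=.
  have : expR (c * l1_norm z) <= expR (c * d%:R * `|z 0 k|).
    rewrite ler_expR -mulrA ler_wpM2l// /l1_norm.
    rewrite -[X in X%:R]card_ord -sum1_card natr_sum big_distrl/=.
    by apply: ler_sum => i _; rewrite mul1r; exact: kmax.
  move/le_trans; apply; apply: ler_wpDr.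
    by apply: sumr_ge0 => i _; rewrite addr_ge0 ?expR_ge0.
  have [z0|z0] := leP 0 (z 0 k).
    by rewrite ger0_norm// lerDl expR_ge0.
  by rewrite ltr0_norm// mulrN mulNr lerDr expR_ge0.
- apply: Rintegrable_sum => i.
  by apply: RintegrableD; exact: (gaussian_expR_coord _ i).1.
Qed.

Lemma Rintegrable_l1_bound (f : 'rV[R]_d -> R) (K c : R) : measurable_fun setT f ->
  0 <= c -> (forall z, `|f z| <= K * expR (c * l1_norm z)) -> Rintegrable gam f.
Proof.
move=> mf c0 fK; apply: Rintegrable_le mf fK _.
exact/RintegrableZ/Rintegrable_expR_l1.
Qed.

Lemma le_l1_expR (z : 'rV[R]_d) : 1 + l1_norm z <= expR (l1_norm z).
Proof. exact: expR_ge1Dx. Qed.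

Lemma measurable_coord (i : 'I_d) : measurable_fun setT (fun z : 'rV[R]_d => z 0 i).
Proof. exact: measurable_mx_coord. Qed.

Lemma square_Rintegrable_coord i : square_Rintegrable gam (fun z => z 0 i).
Proof.
split; first exact: measurable_coord.
apply: (@Rintegrable_l1_bound _ 1 2) => //.
  by apply: measurable_funX; exact: measurable_coord.
move=> z; rewrite normrX mul1r expRM_natl lerXn2r ?nnegrE ?expR_ge0//.
by have := le_l1_expR z; have := le_coord_l1_norm z i; lra.
Qed.

Lemma gaussian_shiftR (x : 'rV[R]_d) (f : 'rV[R]_d -> R) :
  measurable_fun setT f ->
  \int[gam]_z f (z + x) = \int[gam]_z (f z * expR (q x z - q x x / 2)).
Proof.
move=> mf; rewrite /Rintegral; congr fine.
have mE : measurable_fun setT (EFin \o f) by exact/measurable_EFinP.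
have k0 z : (0 <= (expR (q x z - q x x / 2))%:E)%E by rewrite lee_fin expR_ge0.
rewrite integralE [RHS]integralE; congr (_ - _)%E.
- transitivity (\int[gam]_z ((EFin \o f)^\+ (z + x)%R))%E.
    by apply: eq_integral => z _; rewrite !funeposE.
  rewrite (gaussian_shift Cp gamE)//; last exact: measurable_funepos.
  by apply: eq_integral => z _; rewrite !funeposE /= EFinM maxe_pMl// mul0e.
- transitivity (\int[gam]_z ((EFin \o f)^\- (z + x)%R))%E.
    by apply: eq_integral => z _; rewrite !funenegE.
  rewrite (gaussian_shift Cp gamE)//; last exact: measurable_funeneg.
  apply: eq_integral => z _; rewrite !funenegE /= -(mulNr (f z)) EFinM.
  by rewrite maxe_pMl// mul0e.
Qed.

End gaussian_moments.

(** * Differentiation of Gaussian averages through the weight *)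

Section gaussian_derivative.
Context {R : realType} {d : nat} {C : 'M[R]_d} (gam : probability 'rV[R]_d R).
Hypothesis Cp : posdefmx C.
Hypothesis gamE : forall A, measurable A ->
  gam A = (\int[lebesgue_rV d]_(x in A) (gaussian_pdf C x)%:E)%E.
Let q := bform (invmx C).

Let c0 := \sum_j \sum_i `|invmx C i j|.
Let c0_ge0 : 0 <= c0.
Proof. by apply: sumr_ge0 => j _; exact: sumr_ge0. Qed.

(** The dependence on the shift is exactly quadratic, and the growth in [z] stays exponential in the
    l1 norm, hence integrable, uniformly over the unit ball of shifts. *)
Lemma gaussian_kernel_remainder (h z : 'rV[R]_d) : `|h| <= 1 ->
  `|expR (q h z - q h h / 2) - 1 - q h z| <=
  `|h| ^+ 2 * (((c0 + c0 * d%:R) ^+ 2 + c0 * d%:R) * expR (c0 * d%:R) *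
    expR ((2 + c0) * l1_norm z)).
Proof.
move=> h1; set b := c0 * d%:R; have b0 : 0 <= b by rewrite mulr_ge0.
have l0 := l1_norm_ge0 z; set l := l1_norm z in l0 *.
have k0 : 0 <= q h h / 2 by rewrite divr_ge0// bform_inv_ge0.
have kb : q h h / 2 <= `|h| ^+ 2 * b.
  have := bform_le (invmx C) h h; rewrite -/c0 => hb.
  have qn : q h h <= `|h| ^+ 2 * b.
    apply: le_trans (ler_norm _) _; apply: le_trans hb _.
    rewrite /b expr2 -mulrA [leRHS]mulrC -[leRHS]mulrA ler_wpM2l//.
    by rewrite [leRHS]mulrCA ler_wpM2l// l1_norm_le.
  by apply: le_trans qn; have := bform_inv_ge0 h Cp; rewrite -/(q h h); lra.
have wb : `|q h z| <= `|h| * (c0 * l).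
  by rewrite mulrA [X in X * _]mulrC; exact: bform_le.
apply: le_trans (expR_remainder _ k0) _.
have n0 := normr_ge0 h.
have kb' : q h h / 2 <= `|h| * b.
  apply: le_trans kb _; rewrite expr2 -mulrA ler_piMl// mulr_ge0//.
have s1 : `|q h z| + q h h / 2 <= `|h| * (c0 * l + b).
  by rewrite mulrDr lerD.
have clb0 : 0 <= c0 * l + b by rewrite addr_ge0// mulr_ge0.
have s2 : `|q h z| + q h h / 2 <= c0 * l + b.
  by apply: le_trans s1 _; rewrite ler_piMl.
have s0 : 0 <= `|q h z| + q h h / 2 by rewrite addr_ge0.
have e1 : 1 <= expR l by rewrite -expR0 ler_expR.
have el : 1 + l <= expR l by exact: expR_ge1Dx.
have m1 : c0 * l + b <= (c0 + b) * expR l.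
  have h1' : c0 * l <= c0 * expR l by rewrite ler_wpM2l//; lra.
  have h2' : b * 1 <= b * expR l by rewrite ler_wpM2l//.
  by rewrite mulrDl; lra.
have E0 : 0 <= expR l by exact: expR_ge0.
have E1 : 1 <= expR (b + c0 * l).
  by rewrite -expR0 ler_expR addr_ge0// mulr_ge0.
(* In the exponent [2 + c0], the 2 pays for the polynomial factors in [l] and [c0] for the
   exponential of the linear term. *)
have -> : `|h| ^+ 2 * (((c0 + b) ^+ 2 + b) * expR b * expR ((2 + c0) * l)) =
   `|h| ^+ 2 * ((((c0 + b) * expR l) ^+ 2 + b * expR l ^+ 2) * expR (b + c0 * l)).
  rewrite (mulrDl 2 c0) !expRD expRM_natl; ring.
rewrite mulrDl mulrDr; apply: lerD.
  rewrite mulrA -exprMn ler_pM ?sqr_ge0 ?expR_ge0//; last first.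
    by rewrite ler_expR addrC; move: s2; lra.
  rewrite lerXn2r ?nnegrE ?mulr_ge0 ?addr_ge0//.
  by apply: le_trans s1 _; rewrite ler_wpM2l.
apply: le_trans kb _; rewrite ler_wpM2l ?sqr_ge0//.
rewrite -[leLHS]mulr1 ler_pM ?mulr_ge0 ?sqr_ge0//.
by rewrite -[leLHS]mulr1 ler_wpM2l// -(expr1n _ 2%N) lerXn2r ?nnegrE.
Qed.

(** By Cameron-Martin the increment falls on the weight, whose first-order term is [q h z]; [g]
    needs growth control but no smoothness. *)
Lemma gaussian_shift_derivative (g : 'rV[R]_d -> R) (K c : R) :
  measurable_fun setT g -> 0 <= c -> 0 <= K ->
  (forall z, `|g z| <= K * expR (c * l1_norm z)) ->
  exists2 L : R, 0 <= L & forall h : 'rV[R]_d, `|h| <= 1 ->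
    `|\int[gam]_z g (z + h) - \int[gam]_z g z - \int[gam]_z (g z * q h z)|
      <= L * `|h| ^+ 2.
Proof.
move=> mg c00 K0 gK; set B := ((c0 + c0 * d%:R) ^+ 2 + c0 * d%:R) * expR (c0 * d%:R).
have B0 : 0 <= B.
  by rewrite mulr_ge0 ?expR_ge0// addr_ge0 ?sqr_ge0// mulr_ge0.
pose E (z : 'rV[R]_d) := expR ((c + (2 + c0)) * l1_norm z).
have iE : Rintegrable gam E.
  by apply: (Rintegrable_expR_l1 Cp gamE); rewrite !addr_ge0.
exists (B * K * \int[gam]_z E z).
  apply: mulr_ge0; first exact: mulr_ge0.
  by apply: Rintegral_ge0 => z _; exact: expR_ge0.
move=> h h1; have mq x : measurable_fun setT (q x) by exact: measurable_bform.
have mk : measurable_fun setT (fun z => expR (q h z - q h h / 2)).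
  by apply: measurableT_comp => //; exact: measurable_funB.
have ig : Rintegrable gam g by exact: (Rintegrable_l1_bound Cp gamE) gK.
have gB z : `|g z * (expR (q h z - q h h / 2) - 1 - q h z)| <=
    B * K * `|h| ^+ 2 * E z.
  rewrite normrM; have := gaussian_kernel_remainder z h1; rewrite -/B => r1.
  apply: le_trans (ler_pM _ _ (gK z) r1) _ => //.
  by rewrite /E (mulrDl c) expRD le_eqVlt; apply/orP; left; apply/eqP; ring.
have igq : Rintegrable gam (fun z => g z * q h z).
  apply: (@Rintegrable_l1_bound _ _ _ _ Cp gamE _ (K * c0) (c + 1)).
  - exact: measurable_funM.
  - by lra.
  - move=> z; rewrite normrM mulrDl expRD mul1r mulrACA ler_pM//.
    apply: le_trans (bform_le _ _ _) _; rewrite -/c0 -mulrA ler_wpM2l//.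
    have := le_l1_expR z; have := l1_norm_ge0 z => l0 l1.
    by apply: le_trans (ler_piMl _ h1) _ => //; lra.
have ir : Rintegrable gam (fun z => g z * (expR (q h z - q h h / 2) - 1 - q h z)).
  apply: Rintegrable_le gB _; last exact: RintegrableZ.
  by apply: measurable_funM => //; apply: measurable_funB => //; exact: measurable_funB.
have ik : Rintegrable gam (fun z => g z * expR (q h z - q h h / 2)).
  apply: (eq_Rintegrable _ (RintegrableD ir (RintegrableD ig igq))) => z /=.
  by ring.
rewrite (gaussian_shiftR Cp gamE)// -RintegralB_setT// -RintegralB_setT//; last first.
  exact: RintegrableB.
rewrite mulrAC -RintegralZ_setT//; apply: le_norm_Rintegral.
- apply: measurable_funB; last exact: measurable_funM.
  by apply: measurable_funB => //; exact: measurable_funM.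
- move=> z; apply: le_trans (gB z); rewrite le_eqVlt; apply/orP; left.
  by apply/eqP; congr `|_|; rewrite -/(q h z) -/(q h h); ring.
- exact: RintegrableZ.
Qed.

End gaussian_derivative.

Section gaussian_covariance.
Context {R : realType} {d : nat} {C : 'M[R]_d} (gam : probability 'rV[R]_d R).
Hypothesis Cp : posdefmx C.
Hypothesis gamE : forall A, measurable A ->
  gam A = (\int[lebesgue_rV d]_(x in A) (gaussian_pdf C x)%:E)%E.
Let q := bform (invmx C).

(** Shrinking [h] by a factor [r] gains a factor [r]. When the increment of a Gaussian average under
    a shift is known exactly, this turns the quadratic remainder into an identity, and so computes
    moments without any explicit integration. *)
Lemma quadratic_linear_eq0 (a : 'rV[R]_d -> R) (L : R) :
  (forall r h, a (r *: h) = r * a h) ->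
  (forall h, `|h| <= 1 -> `|a h| <= L * `|h| ^+ 2) -> forall h, a h = 0.
Proof.
move=> aZ aL h; apply/eqP; rewrite -normr_le0; apply/ler_addgt0Pl => e e0.
rewrite addr0; have n0 := normr_ge0 h; set n := `|h| in n0.
have L0 : 0 <= `|L| by [].
(* The first term puts [r *: h] in the unit ball, the second makes the surviving bound at most
   [e]. *)
pose r := Num.min (1 + n)^-1 (e / (1 + `|L| * n ^+ 2)).
have D0 : 0 < 1 + `|L| * n ^+ 2 by rewrite ltr_pwDl// mulr_ge0// sqr_ge0.
have r0 : 0 < r by rewrite lt_min invr_gt0 divr_gt0// ltr_pwDl.
have r1 : r * n <= 1.
  apply: (@le_trans _ _ ((1 + n)^-1 * n)).
    by rewrite ler_wpM2r// ge_min lexx.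
  by rewrite ler_pdivrMl ?mulr1 ?lerDr// ltr_pwDl.
have r2 : r * (1 + `|L| * n ^+ 2) <= e.
  by rewrite -ler_pdivlMr// ge_min lexx orbT.
have := aL (r *: h); rewrite aZ normrM normrZ (gtr0_norm r0) -/n => /(_ r1) hL.
have {}hL : `|a h| <= L * r * n ^+ 2.
  by rewrite -(ler_pM2l r0); apply: le_trans hL _; rewrite exprMn; lra.
apply: le_trans hL _; apply: le_trans r2.
have LL : L <= `|L| by exact: ler_norm.
have : L * (r * n ^+ 2) <= `|L| * (r * n ^+ 2).
  by rewrite ler_wpM2r// mulr_ge0 ?sqr_ge0// ltW.
by lra.
Qed.

Lemma Rintegral_gaussian_form (g : 'rV[R]_d -> R) (K c : R) :
  measurable_fun setT g -> 0 <= c -> 0 <= K ->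
  (forall z, `|g z| <= K * expR (c * l1_norm z)) ->
  forall h, Rintegrable gam (fun z => g z * q h z).
Proof.
move=> mg c00 K0 gK h.
pose c0 := \sum_j \sum_i `|invmx C i j|.
have c0_ge0 : 0 <= c0 by apply: sumr_ge0 => j _; exact: sumr_ge0.
apply: (@Rintegrable_l1_bound _ _ _ _ Cp gamE _ (K * (c0 * `|h|)) (c + 1)).
- by apply: measurable_funM => //; exact: measurable_bform.
- by rewrite addr_ge0.
- move=> z; rewrite normrM mulrDl expRD mul1r mulrACA ler_pM//.
  apply: le_trans (bform_le _ _ _) _; rewrite -/c0 ler_wpM2l ?mulr_ge0//.
  have := le_l1_expR z; lra.
Qed.

(** The constant 1 does not change under a shift, so its first-order term vanishes. *)
Lemma gaussian_mean_form h : \int[gam]_z q h z = 0.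
Proof.
have k1 : forall z : 'rV[R]_d, `|1 : R| <= 1 * expR (0 * l1_norm z).
  by move=> z; rewrite mul0r expR0 normr1 mulr1.
have m1 : measurable_fun setT (fun _ : 'rV[R]_d => 1 : R) by [].
have ih := Rintegral_gaussian_form m1 (lexx 0) ler01 k1.
have [L L0 hL] := gaussian_shift_derivative Cp gamE m1 (lexx 0) ler01 k1.
have e h' : \int[gam]_z (1 * q h' z) = \int[gam]_z q h' z.
  by apply: eq_Rintegral_setT => z; rewrite mul1r.
rewrite -e; apply: (@quadratic_linear_eq0 (fun h => \int[gam]_z (1 * q h z)) L) => [r h'|h' h1].
  rewrite -RintegralZ_setT//; apply: eq_Rintegral_setT => z.
  by rewrite /q bformZl mulrCA.
by have := hL _ h1; rewrite subrr sub0r normrN.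
Qed.

Lemma gaussian_mean i : \int[gam]_z z 0 i = 0.
Proof.
rewrite -(gaussian_mean_form (row i C)); apply: eq_Rintegral_setT => z.
exact/esym/(bform_row_inv Cp).
Qed.

(** A shift by [h] changes the mean of the [i]-th coordinate by exactly [h 0 i], which must then be
    the first-order term. *)
Lemma gaussian_coord_form i h : \int[gam]_z (z 0 i * q h z) = h 0 i.
Proof.
have k1 : forall z : 'rV[R]_d, `|z 0 i| <= 1 * expR (1 * l1_norm z).
  by move=> z; have := le_l1_expR z; have := le_coord_l1_norm z i; rewrite !mul1r; lra.
have m1 := @measurable_coord R d i.
have ih := Rintegral_gaussian_form m1 ler01 ler01 k1.
have [L L0 hL] := gaussian_shift_derivative Cp gamE m1 ler01 ler01 k1.
have iz := square_RintegrableW (square_Rintegrable_coord Cp gamE i).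
apply/esym/eqP; rewrite -subr_eq0; apply/eqP.
apply: (@quadratic_linear_eq0 (fun h => h 0 i - \int[gam]_z (z 0 i * q h z)) L) => [r h'|h' h1].
  rewrite mxE mulrBr; congr (_ - _).
  rewrite -RintegralZ_setT//; apply: eq_Rintegral_setT => z.
  by rewrite /q bformZl mulrCA.
have := hL _ h1; under eq_Rintegral_setT do rewrite mxE.
rewrite RintegralD_setT//; last exact: Rintegrable_cst.
by rewrite Rintegral_cst1 [X in X - _ - _]addrC addrK.
Qed.

Lemma gaussian_covariance i j : \int[gam]_z (z 0 i * z 0 j) = C i j.
Proof.
have <- : (row j C) 0 i = C i j by rewrite -[in RHS](proj1 Cp) !mxE.
rewrite -gaussian_coord_form; apply: eq_Rintegral_setT => z.
by congr (_ * _); exact/esym/(bform_row_inv Cp).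
Qed.

(** Supplies the test functions for the Stein identity: averaging a bounded measurable [g] over the
    noise makes it differentiable, and the derivative is a Gaussian integration by parts. *)
Lemma gaussian_derivable (g : 'rV[R]_d -> R) (K b : R) : measurable_fun setT g ->
  0 <= K -> (forall z, `|g z| <= K) ->
  forall x, differentiable (fun x => \int[gam]_z g (z + b *: x)) x /\
   forall v, 'D_v (fun x => \int[gam]_z g (z + b *: x)) x =
     b * \int[gam]_z (g (z + b *: x) * q v z).
Proof.
move=> mg K0 gK x; set u := fun x => _.
pose gx z := g (z + b *: x).
have mgx : measurable_fun setT gx.
  have := measurable_rV_affine 1 (b *: x).
  under eq_fun do rewrite scale1r.
  by move=> h; exact: (measurableT_comp mg h).
have k1 z : `|gx z| <= K * expR (0 * l1_norm z).
  by rewrite mul0r expR0 mulr1; exact: gK.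
have ih := Rintegral_gaussian_form mgx (lexx 0) K0 k1.
have [L L0 hL] := gaussian_shift_derivative Cp gamE mgx (lexx 0) K0 k1.
pose w i := b * \int[gam]_z (gx z * q (delta_mx 0 i) z).
(* In coordinates the candidate differential is a finite sum, so its linearity and continuity are
   immediate. *)
pose df (h : 'rV[R]_d) : R^o := \sum_i h 0 i * w i.
have dfE h : df h = b * \int[gam]_z (gx z * q h z).
  transitivity (\sum_i b * \int[gam]_z (h 0 i * (gx z * q (delta_mx 0 i) z))).
    by apply: eq_bigr => i _; rewrite RintegralZ_setT// /w mulrCA.
  rewrite -mulr_sumr -Rintegral_sum; last by move=> i; exact: RintegrableZ.
  congr (_ * _); apply: eq_Rintegral_setT => z.
  rewrite {2}[h]row_sum_delta /q.
  have -> : bform (invmx C) (\sum_j h 0 j *: delta_mx 0 j) z =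
      \sum_j h 0 j * bform (invmx C) (delta_mx 0 j) z.
    elim/big_ind2 : _ => // [|x1 x2 y1 y2 <- <-|j _]; last by rewrite bformZl.
    - by rewrite /bform !mul0mx mxE.
    - by rewrite bformDl.
  by rewrite mulr_sumr; apply: eq_bigr => i _; rewrite mulrCA.
have dflin : linear df.
  move=> k h h'; rewrite /df scaler_sumr -big_split/=; apply: eq_bigr => i _.
  by rewrite !mxE mulrDl -mulrA.
pose df' : {linear 'rV[R]_d -> R^o} := HB.pack df (GRing.isLinear.Build _ _ _ _ df dflin).
have dfc : continuous df'.
  apply/linear_bounded_continuous/bounded_funP => r.
  exists (\sum_i r * `|w i|) => h hr; apply: le_trans (ler_norm_sum _ _ _) _.
  apply: ler_sum => i _; rewrite normrM ler_wpM2r//.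
  exact: le_trans (le_coord_norm h i) hr.
have ue : (u : 'rV[R]_d -> R^o) \o shift x = cst (u x) + df' +o_ 0 id.
  apply/eqaddoP => _/posnumP[e].
  have D1 : 0 < 1 + `|b| by rewrite ltr_pwDl.
  have D2 : 0 < 1 + L * `|b| ^+ 2 by rewrite ltr_pwDl// mulr_ge0// sqr_ge0.
  (* On this ball [b *: h] has norm at most 1, and the quadratic remainder is at most [e] times the
     norm of [h]. *)
  pose r := Num.min (1 + `|b|)^-1 (e%:num / (1 + L * `|b| ^+ 2)).
  have r0 : 0 < r by rewrite lt_min invr_gt0 D1 divr_gt0.
  have := @nbhs0_le _ 'rV[R]_d _ r0; apply: filterS => h hr.
  have -> : ((u \o shift x) - (cst (u x) + df')) h =
     \int[gam]_z gx (z + b *: h) - \int[gam]_z gx z - \int[gam]_z (gx z * q (b *: h) z).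
    rewrite !fctE/= /df' /= dfE opprD addrA; congr (_ - _ - _).
      apply: eq_Rintegral_setT => z; rewrite /gx scalerDr; congr g.
      by rewrite addrA.
    rewrite -RintegralZ_setT//; apply: eq_Rintegral_setT => z.
    by rewrite /q bformZl mulrCA.
  have n0 := normr_ge0 h; have b0 := normr_ge0 b.
  have h1 : `|b *: h| <= 1.
    rewrite normrZ; apply: (@le_trans _ _ ((1 + `|b|) * `|h|)).
      by rewrite ler_wpM2r// lerDr.
    by rewrite -ler_pdivlMl// mulr1 (le_trans hr)// ge_min lexx.
  apply: le_trans (hL _ h1) _; rewrite normrZ.
  have h2 : `|h| * (1 + L * `|b| ^+ 2) <= e%:num.
    by rewrite -ler_pdivlMr// (le_trans hr)// ge_min lexx orbT.
  have : `|h| * (`|h| * (1 + L * `|b| ^+ 2)) <= `|h| * e%:num.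
    by rewrite ler_wpM2l.
  rewrite [leRHS]mulrC; apply: le_trans.
  rewrite -subr_ge0 (_ : _ - _ = `|h| ^+ 2) ?sqr_ge0//; ring.
have udiff : differentiable (u : 'rV[R]_d -> R^o) x.
  apply/diff_locallyP; rewrite (diff_unique dfc ue); split => //.
split => // v.
by rewrite deriveE// (diff_unique dfc ue) /= dfE.
Qed.

End gaussian_covariance.

(** * The Gaussian channel *)

Lemma integral_probability_cst d (T : measurableType d) (R : realType)
  (m : probability T R) (c : \bar R) : (\int[m]_x c = c)%E.
Proof. by rewrite integral_cst// [X in (_ * X)%E]probability_setT mule1. Qed.

Section product_Rintegral.
Context d1 d2 (T1 : measurableType d1) (T2 : measurableType d2) (R : realType)
  (mu : probability T1 R) (gam : probability T2 R).
Local Notation m := (mu \x gam)%E.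

Lemma Rintegral_fst (f : T1 -> R) : Rintegrable mu f ->
  Rintegrable m (fun p => f p.1) /\ \int[m]_p f p.1 = \int[mu]_x f x.
Proof.
move=> fi; have mf := Rintegrable_measurable fi.
have mf1 : measurable_fun setT (fun p : T1 * T2 => f p.1).
  exact: (measurableT_comp mf measurable_fst).
have i1 : Rintegrable m (fun p => f p.1).
  apply/integrable12ltyP; first exact/measurable_EFinP.
  under eq_integral => x _ do rewrite /= integral_probability_cst.
  by move/integrableP : fi => [].
split => //; rewrite /Rintegral -integral12_prod_meas1//; congr fine.
by apply: eq_integral => x _; rewrite /fubini_F/= integral_probability_cst.
Qed.

Lemma Rintegral_snd (f : T2 -> R) : Rintegrable gam f ->
  Rintegrable m (fun p => f p.2) /\ \int[m]_p f p.2 = \int[gam]_z f z.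
Proof.
move=> fi; have mf := Rintegrable_measurable fi.
have mf1 : measurable_fun setT (fun p : T1 * T2 => f p.2).
  exact: (measurableT_comp mf measurable_snd).
have i1 : Rintegrable m (fun p => f p.2).
  apply/integrable21ltyP; first exact/measurable_EFinP.
  under eq_integral => x _ do rewrite /= integral_probability_cst.
  by move/integrableP : fi => [].
split => //; rewrite /Rintegral -integral21_prod_meas1//; congr fine.
by apply: eq_integral => x _; rewrite /fubini_G/= integral_probability_cst.
Qed.

Lemma square_Rintegrable_fst (f : T1 -> R) : square_Rintegrable mu f ->
  square_Rintegrable m (fun p => f p.1).
Proof.
move=> [mf f2]; split; last exact: (Rintegral_fst f2).1.
exact: (measurableT_comp mf measurable_fst).
Qed.

Lemma square_Rintegrable_snd (f : T2 -> R) : square_Rintegrable gam f ->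
  square_Rintegrable m (fun p => f p.2).
Proof.
move=> [mf f2]; split; last exact: (Rintegral_snd f2).1.
exact: (measurableT_comp mf measurable_snd).
Qed.

(** Sections are integrable at every point, not just almost everywhere, so that the real-valued
    inner integral agrees pointwise with the extended one. *)
Lemma Rintegral_fubini21 (f : T1 * T2 -> R) : Rintegrable m f ->
  (forall z, Rintegrable mu (fun x => f (x, z))) ->
  Rintegrable gam (fun z => \int[mu]_x f (x, z)) /\
  \int[m]_p f p = \int[gam]_z \int[mu]_x f (x, z).
Proof.
move=> fi fz.
have e z : ((\int[mu]_x f (x, z))%:E = \int[mu]_x (f (x, z))%:E)%E.
  by rewrite EFin_Rintegral.
have GE : EFin \o (fun z => \int[mu]_x f (x, z)) = fubini_G mu (EFin \o f).
  by apply/funext => z /=; rewrite e.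
split.
  rewrite /Rintegrable GE; apply/integrableP; split.
    exact: measurable_fubini_G fi.
  have := (integrable21ltyP _ _ (measurable_int _ fi)).1 fi.
  apply: le_lt_trans.
  have mf : measurable_fun setT (EFin \o f) by exact: measurable_int fi.
  apply: ge0_le_integral => //.
  - by apply: measurableT_comp => //; exact: measurable_fubini_G fi.
  - apply: (measurable_fun_fubini_tonelli_G (abse \o (EFin \o f))) => //=.
    exact: measurableT_comp.
  - move=> z _; apply: le_abse_integral => //.
    exact/measurable_EFinP/(Rintegrable_measurable (fz z)).
rewrite /Rintegral -integral21_prod_meas1//; congr fine.
by apply: eq_integral => z _; rewrite -/(Rintegral _ _ _) e.
Qed.

Lemma Rintegral_fubini12 (f : T1 * T2 -> R) : Rintegrable m f ->
  (forall x, Rintegrable gam (fun z => f (x, z))) ->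
  Rintegrable mu (fun x => \int[gam]_z f (x, z)) /\
  \int[m]_p f p = \int[mu]_x \int[gam]_z f (x, z).
Proof.
move=> fi fz.
have e x : ((\int[gam]_z f (x, z))%:E = \int[gam]_z (f (x, z))%:E)%E.
  by rewrite EFin_Rintegral.
have GE : EFin \o (fun x => \int[gam]_z f (x, z)) = fubini_F gam (EFin \o f).
  by apply/funext => z /=; rewrite e.
split; first by rewrite /Rintegrable GE; exact: integrable_fubini_F fi.
rewrite /Rintegral -integral12_prod_meas1//; congr fine.
by apply: eq_integral => z _; rewrite -/(Rintegral _ _ _) e.
Qed.

End product_Rintegral.

Section gaussian_channel.
Context {R : realType} {d : nat} {C : 'M[R]_d}.
Variables (mu gam : probability 'rV[R]_d R).
Hypothesis Cp : posdefmx C.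
Hypothesis gamE : forall A, measurable A ->
  gam A = (\int[lebesgue_rV d]_(x in A) (gaussian_pdf C x)%:E)%E.
Let q := bform (invmx C).
Local Notation m := (mu \x gam)%E.

(* The likelihood ratio of the laws of [Z + b *: x] and [Z]. *)
Definition channel_kernel b (x z : 'rV[R]_d) :=
  expR (b * bform (invmx C) x z - b ^+ 2 * bform (invmx C) x x / 2).
Local Notation k := channel_kernel.

Lemma measurable_channel_kernel b :
  measurable_fun setT (fun p : 'rV[R]_d * 'rV[R]_d => k b p.1 p.2).
Proof.
apply: measurableT_comp => //; apply: measurable_funB.
  by apply: measurable_funM => //; exact: measurable_bform.
apply: measurable_funM => //; apply: measurable_funM => //.
exact: measurable_bform.
Qed.

Lemma measurable_channel_kernel1 b z : measurable_fun setT (k b ^~ z).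
Proof.
apply: measurableT_comp => //; apply: measurable_funB.
  by apply: measurable_funM => //; exact: measurable_bform.
apply: measurable_funM => //; apply: measurable_funM => //.
exact: measurable_bform.
Qed.

Lemma channel_kernel_ge0 b x z : 0 <= k b x z.
Proof. exact: expR_ge0. Qed.

(** Completing the square: the gap between the exponents is half the energy of [z - b *: x]. Being
    uniform in [x], the bound makes integrals over the signal finite at every [z]. *)
Lemma channel_kernel_le b x z : k b x z <= expR (q z z / 2).
Proof.
rewrite ler_expR; have := bform_inv_ge0 (z + (- b) *: x) Cp.
rewrite (bform_sqrD _ _ (posdefmx_inv_sym Cp)) !bformZr bformZl.
rewrite (bformC z x (posdefmx_inv_sym Cp)) /q; lra.
Qed.

(** The signal is kept next to the observation: under the product measure, this pair carries their
    joint law. *)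
Definition channel b (p : 'rV[R]_d * 'rV[R]_d) : 'rV[R]_d * 'rV[R]_d :=
  (p.1, p.2 + b *: p.1).

Lemma measurable_shift b :
  measurable_fun setT (fun p : 'rV[R]_d * 'rV[R]_d => p.2 + b *: p.1).
Proof.
apply/measurable_fun_mxP => i j.
rewrite [X in measurable_fun _ X](_ : _ =
    fun p : 'rV[R]_d * 'rV[R]_d => p.2 i j + b * p.1 i j).
  apply: measurable_funD.
    exact: (measurableT_comp (measurable_mx_coord i j) measurable_snd).
  apply: measurable_funM => //.
  exact: (measurableT_comp (measurable_mx_coord i j) measurable_fst).
by apply/funext => p; rewrite !mxE.
Qed.

Lemma measurable_pair_shift b (f : 'rV[R]_d * 'rV[R]_d -> \bar R) :
  measurable_fun setT f ->
  measurable_fun setT (fun p => f (channel b p)).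
Proof.
move=> mf; apply: (measurableT_comp mf).
by apply: measurable_fun_pair => //; exact: measurable_shift.
Qed.

(** Cameron-Martin in the noise for each fixed signal: the joint law of signal and observation has
    density [k] with respect to the product of [mu] and [gam]. *)
Lemma ge0_integral_channel b (f : 'rV[R]_d * 'rV[R]_d -> \bar R) :
  measurable_fun setT f -> (forall p, 0 <= f p)%E ->
  (\int[m]_p f (channel b p) = \int[m]_p (f p * (k b p.1 p.2)%:E))%E.
Proof.
move=> mf f0; have mfs := measurable_pair_shift b mf.
have mfk : measurable_fun setT (fun p => f p * (k b p.1 p.2)%:E)%E.
  apply: emeasurable_funM => //; apply/measurable_EFinP.
  exact: measurable_channel_kernel.
have fk0 p : (0 <= f p * (k b p.1 p.2)%:E)%E.
  by rewrite mule_ge0// lee_fin channel_kernel_ge0.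
rewrite (fubini_tonelli1 _ mfs (fun p => f0 _)) (fubini_tonelli1 _ mfk fk0).
apply: eq_integral => x _; rewrite /fubini_F/=.
have mfx : measurable_fun setT (fun z : 'rV[R]_d => f (x, z)).
  exact: (measurableT_comp mf (measurable_pair1 x)).
transitivity (\int[gam]_z (f (x, z) *
    (expR (q (b *: x) z - q (b *: x) (b *: x) / 2))%:E))%E.
  exact: (gaussian_shift Cp gamE (b *: x) mfx (fun z => f0 (x, z))).
apply: eq_integral => z _; rewrite /channel_kernel /q !bformZl !bformZr mulrA -expr2.
by [].
Qed.

Lemma Rintegral_channel b (f : 'rV[R]_d * 'rV[R]_d -> R) : measurable_fun setT f ->
  (Rintegrable m (fun p => f (channel b p)) <->
   Rintegrable m (fun p => f p * k b p.1 p.2)) /\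
  \int[m]_p f (channel b p) = \int[m]_p (f p * k b p.1 p.2).
Proof.
move=> mf.
have mE : measurable_fun setT (EFin \o f) by exact/measurable_EFinP.
have mk := measurable_channel_kernel b.
have k0 p : (0 <= (k b p.1 p.2)%:E)%E by rewrite lee_fin channel_kernel_ge0.
split.
  have mab : measurable_fun setT (fun p => `|f p|%:E).
    by apply/measurable_EFinP; exact: measurableT_comp.
  have := ge0_integral_channel b mab (fun p => normr_ge0 (f p)).
  move=> e; split => /integrableP[m1 f1]; apply/integrableP; split.
  - by apply/measurable_EFinP; exact: measurable_funM.
  - move: f1; rewrite /= e; apply: le_lt_trans; rewrite le_eqVlt; apply/orP; left.
    apply/eqP; apply: eq_integral => p _; rewrite /= -EFinM normrM.
    by rewrite (ger0_norm (channel_kernel_ge0 _ _ _)).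
  - exact: (measurable_pair_shift b mE).
  - rewrite /= e; apply: le_lt_trans f1; rewrite le_eqVlt; apply/orP; left.
    apply/eqP; apply: eq_integral => p _; rewrite /= -EFinM normrM.
    by rewrite (ger0_norm (channel_kernel_ge0 _ _ _)).
rewrite /Rintegral; congr fine.
rewrite integralE [RHS]integralE; congr (_ - _)%E.
- transitivity (\int[m]_p ((EFin \o f)^\+ (channel b p)))%E.
    by apply: eq_integral => z _; rewrite !funeposE.
  rewrite ge0_integral_channel//; last exact: measurable_funepos.
  by apply: eq_integral => z _; rewrite !funeposE /= EFinM maxe_pMl// mul0e.
- transitivity (\int[m]_p ((EFin \o f)^\- (channel b p)))%E.
    by apply: eq_integral => z _; rewrite !funenegE.
  rewrite ge0_integral_channel//; last exact: measurable_funeneg.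
  apply: eq_integral => z _; rewrite !funenegE /= -(mulNr (f z)) EFinM.
  by rewrite maxe_pMl// mul0e.
Qed.

End gaussian_channel.

Lemma ln_ge_expR (R : realType) (a c M : R) : 0 < a -> a * expR c <= M ->
  ln a + c <= ln M.
Proof.
move=> a0 aM; have e0 := expR_gt0 c; have ac0 : 0 < a * expR c by rewrite mulr_gt0.
by rewrite -[X in _ + X]expRK -lnM// ler_ln// posrE (lt_le_trans ac0).
Qed.

(** Jensen's inequality for the weight [w] without normalisation, obtained by integrating the
    tangent of [expR] at the weighted mean of [l]. *)
Lemma expR_jensen d (T : measurableType d) (R : realType)
    (m : {measure set T -> \bar R}) (w l : T -> R) :
  (forall x, 0 <= w x) -> Rintegrable m w -> 0 < \int[m]_x w x ->
  Rintegrable m (fun x => w x * l x) ->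
  Rintegrable m (fun x => w x * expR (l x)) ->
  (\int[m]_x w x) * expR ((\int[m]_x (w x * l x)) / \int[m]_x w x) <=
  \int[m]_x (w x * expR (l x)).
Proof.
move=> w0 iw W0 iwl iwe; set W := \int[m]_x w x; set c := _ / W.
have e : \int[m]_x (expR c * (w x * l x + (1 - c) * w x)) = W * expR c.
  rewrite RintegralZ_setT; last by apply: RintegrableD => //; exact: RintegrableZ.
  rewrite RintegralD_setT//; last exact: RintegrableZ.
  by rewrite RintegralZ_setT// -/W /c; field; rewrite gt_eqF.
rewrite -e; apply: le_Rintegral_setT => //.
  by apply/RintegrableZ/RintegrableD => //; exact: RintegrableZ.
move=> x; rewrite (_ : _ * _ = w x * (expR c * (1 + (l x - c)))); last by ring.
rewrite ler_wpM2l// (_ : l x = c + (l x - c)); last by ring.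
rewrite [in leRHS]expRD (_ : c + (l x - c) - c = l x - c); last by ring.
by rewrite ler_wpM2l ?expR_ge0 ?expR_ge1Dx.
Qed.

Section square_Rintegrable_rV.
Context d (T : measurableType d) (R : realType) (m : {measure set T -> \bar R}).
Context {n : nat}.
Implicit Types (f g : T -> 'rV[R]_n) (A : 'M[R]_n).

Definition square_Rintegrable_rV f := forall i, square_Rintegrable m (fun t => f t 0 i).

Lemma square_Rintegrable_rVD f g : square_Rintegrable_rV f ->
  square_Rintegrable_rV g -> square_Rintegrable_rV (fun t => f t + g t).
Proof.
move=> hf hg i; have := square_RintegrableD (hf i) (hg i).
by congr square_Rintegrable; apply/funext => t; rewrite mxE.
Qed.

Lemma square_Rintegrable_rVZ f c : square_Rintegrable_rV f ->
  square_Rintegrable_rV (fun t => c *: f t).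
Proof.
move=> hf i; have := square_RintegrableZ c (hf i).
by congr square_Rintegrable; apply/funext => t; rewrite mxE.
Qed.

Lemma square_Rintegrable_rVB f g : square_Rintegrable_rV f ->
  square_Rintegrable_rV g -> square_Rintegrable_rV (fun t => f t - g t).
Proof.
move=> hf /(square_Rintegrable_rVZ (-1)) hg.
have := square_Rintegrable_rVD hf hg; congr square_Rintegrable_rV.
by apply/funext => t; rewrite scaleN1r.
Qed.

Lemma Rintegral_bform A f g : square_Rintegrable_rV f -> square_Rintegrable_rV g ->
  Rintegrable m (fun t => bform A (f t) (g t)) /\
  \int[m]_t bform A (f t) (g t) =
    \sum_j \sum_i A i j * \int[m]_t (f t 0 i * g t 0 j).
Proof.
move=> hf hg.
have h i j : Rintegrable m (fun t => A i j * (f t 0 i * g t 0 j)).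
  by apply: RintegrableZ; exact: square_RintegrableM.
have e : (fun t => bform A (f t) (g t)) =
    fun t => \sum_j \sum_i A i j * (f t 0 i * g t 0 j).
  apply/funext => t; rewrite bformE; apply: eq_bigr => j _; apply: eq_bigr => i _.
  by rewrite mulrA [A i j * _]mulrC.
rewrite e; split.
  by apply: Rintegrable_sum => j; exact: Rintegrable_sum.
rewrite Rintegral_sum; last by move=> j; exact: Rintegrable_sum.
apply: eq_bigr => j _; rewrite Rintegral_sum//; apply: eq_bigr => i _.
by rewrite RintegralZ_setT//; exact: square_RintegrableM.
Qed.

End square_Rintegrable_rV.

(** The trace of [C^-1 C]; therefore any centred vector with covariance [C] has energy [d]. *)
Lemma trace_bform_inv (R : realType) d (C : 'M[R]_d) : posdefmx C ->
  \sum_j \sum_i invmx C i j * C i j = d%:R.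
Proof.
move=> Cp; have := mulVmx (posdefmx_unit Cp) => /(congr1 mxtrace).
rewrite mxtrace1 => <-; rewrite /mxtrace exchange_big/=; apply: eq_bigr => i _.
rewrite mxE; apply: eq_bigr => j _; congr (_ * _).
by rewrite -[in LHS](proj1 Cp) mxE.
Qed.

(** * Bayes' formula and pointwise bounds on the evidence *)

Section posterior.
Context {R : realType} {d : nat} {C : 'M[R]_d}.
Variables (mu gam : probability 'rV[R]_d R).
Hypothesis Cp : posdefmx C.
Hypothesis gamE : forall A, measurable A ->
  gam A = (\int[lebesgue_rV d]_(x in A) (gaussian_pdf C x)%:E)%E.
Hypothesis mu2 : square_Rintegrable_rV mu (@id 'rV[R]_d).
Hypothesis mu_mean : forall i, \int[mu]_x x 0 i = 0.
Hypothesis mu_cov : forall i j, \int[mu]_x (x 0 i * x 0 j) = C i j.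
Let q := bform (invmx C).
Local Notation m := (mu \x gam)%E.
Local Notation k := (@channel_kernel _ _ C).

(* The density of [Z + b *: F] with respect to the law of [Z]; [posterior_mean]
   below is the conditional expectation of [F] given [Z + b *: F]. *)
Definition evidence b z := \int[mu]_x k b x z.
Local Notation M := evidence.

Definition posterior_mean b z : 'rV[R]_d :=
  \row_j ((\int[mu]_x (x 0 j * k b x z)) / M b z).
Local Notation Xh := posterior_mean.

Lemma Rintegrable_kernelM b z (f : 'rV[R]_d -> R) : Rintegrable mu f ->
  Rintegrable mu (fun x => f x * k b x z).
Proof.
move=> fi; apply: (@Rintegrable_le _ _ _ _ _ (fun x => expR (q z z / 2) * `|f x|)).
- apply: measurable_funM; first exact: Rintegrable_measurable fi.
  exact: measurable_channel_kernel1.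
- move=> x; rewrite normrM mulrC (ger0_norm (channel_kernel_ge0 _ _ _)).
  by rewrite ler_wpM2r//; exact: channel_kernel_le.
- by apply: RintegrableZ; exact: Rintegrable_norm.
Qed.

Lemma Rintegrable_kernel b z : Rintegrable mu (k b ^~ z).
Proof.
have := Rintegrable_kernelM b z (Rintegrable_cst mu 1).
by congr Rintegrable; apply/funext => x; rewrite mul1r.
Qed.

Lemma Rintegrable_prior i : Rintegrable mu (fun x => x 0 i).
Proof. exact: square_RintegrableW (mu2 i). Qed.

Lemma prior_energy : Rintegrable mu (fun x => q x x) /\ \int[mu]_x q x x = d%:R.
Proof.
have [h ->] := Rintegral_bform (invmx C) mu2 mu2; split => //.
rewrite -(trace_bform_inv Cp); apply: eq_bigr => j _; apply: eq_bigr => i _.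
by rewrite mu_cov.
Qed.

Lemma bform_sumE (x y : 'rV[R]_d) :
  q x y = \sum_i (\sum_j invmx C i j * y 0 j) * x 0 i.
Proof.
rewrite /q bformE exchange_big/=; apply: eq_bigr => i _; rewrite big_distrl/=.
by apply: eq_bigr => j _; ring.
Qed.

Lemma prior_form z : Rintegrable mu (fun x => q x z) /\ \int[mu]_x q x z = 0.
Proof.
have e : (fun x => q x z) =
    fun x => \sum_i (\sum_j invmx C i j * z 0 j) * x 0 i.
  by apply/funext => x; exact: bform_sumE.
rewrite e; split.
  by apply: Rintegrable_sum => i; apply: RintegrableZ; exact: Rintegrable_prior.
rewrite Rintegral_sum; last first.
  by move=> i; apply: RintegrableZ; exact: Rintegrable_prior.
rewrite big1// => i _; rewrite RintegralZ_setT; last exact: Rintegrable_prior.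
by rewrite mu_mean mulr0.
Qed.

(** Jensen's inequality: as [mu] is centred with energy [d], the mean of the exponent of [k] does
    not depend on [z]. With [evidence_le] this makes the log evidence at most quadratic. *)
Lemma evidence_ge b z : expR (- (b ^+ 2 * d%:R / 2)) <= M b z.
Proof.
have [iq eq] := prior_energy; have [il el] := prior_form z.
have := @expR_jensen _ _ _ mu (fun=> 1)
  (fun x => b * q x z - b ^+ 2 / 2 * q x x) (fun=> ler01) (Rintegrable_cst mu 1).
rewrite !Rintegral_cst1 divr1 mul1r.
have e : (fun x => 1 * (b * q x z - b ^+ 2 / 2 * q x x)) =
    fun x => b * q x z - b ^+ 2 / 2 * q x x by apply/funext => x; rewrite mul1r.
have ee : (fun x => 1 * expR (b * q x z - b ^+ 2 / 2 * q x x)) = k b ^~ z.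
  by apply/funext => x; rewrite mul1r /channel_kernel; congr expR; rewrite /q; ring.
have -> : \int[mu]_x (1 * (b * q x z - b ^+ 2 / 2 * q x x)) = - (b ^+ 2 * d%:R / 2).
  rewrite [LHS](_ : _ = \int[mu]_x (b * q x z - b ^+ 2 / 2 * q x x)); last first.
    by apply: eq_Rintegral_setT => x; rewrite mul1r.
  rewrite RintegralB_setT; [|exact: RintegrableZ..].
  by rewrite !RintegralZ_setT// eq el; ring.
have -> : \int[mu]_x (1 * expR (b * q x z - b ^+ 2 / 2 * q x x)) = M b z.
  by apply: eq_Rintegral_setT => x; move/(congr1 (@^~ x)) : ee.
rewrite e ee; apply => //.
  by apply: RintegrableB; exact: RintegrableZ.
exact: Rintegrable_kernel.
Qed.

Lemma evidence_gt0 b z : 0 < M b z.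
Proof. exact: lt_le_trans (expR_gt0 _) (evidence_ge _ _). Qed.

Lemma evidence_le b z : M b z <= expR (q z z / 2).
Proof.
rewrite -[leRHS](Rintegral_cst1 mu); apply: le_Rintegral_setT.
- exact: Rintegrable_kernel.
- exact: Rintegrable_cst.
- by move=> x; exact: channel_kernel_le.
Qed.

Lemma ln_evidence_norm b z : `|ln (M b z)| <= b ^+ 2 * d%:R / 2 + q z z / 2.
Proof.
have h0 := evidence_gt0 b z; have q0 := bform_inv_ge0 z Cp.
have l1 : - (b ^+ 2 * d%:R / 2) <= ln (M b z).
  by rewrite -[leLHS]expRK ler_ln ?posrE ?expR_gt0// evidence_ge.
have l2 : ln (M b z) <= q z z / 2.
  by rewrite -[leRHS]expRK ler_ln ?posrE ?expR_gt0// evidence_le.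
have b0 : 0 <= b ^+ 2 * d%:R / 2 by rewrite divr_ge0// mulr_ge0// sqr_ge0.
by rewrite ler_norml; rewrite -/(q z z) in q0; lra.
Qed.

(* Jensen's inequality for the posterior law given the observation [y']. *)
Lemma ln_evidence_convex b y y' :
  ln (M b y') - ln (M b y) <= b * q (Xh b y') (y' - y).
Proof.
have h0 := evidence_gt0 b y; have h0' := evidence_gt0 b y'.
pose l x := b * q x (y - y').
have il : Rintegrable mu (fun x => k b x y' * l x).
  have [il _] := prior_form (y - y').
  have := RintegrableZ b (Rintegrable_kernelM b y' il).
  by congr Rintegrable; apply/funext => x; rewrite /l; ring.
have ke x : k b x y' * expR (l x) = k b x y.
  rewrite /channel_kernel -expRD; congr expR; rewrite /l /q bformDr.
  by rewrite bformNr; ring.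
have ie : Rintegrable mu (fun x => k b x y' * expR (l x)).
  have := Rintegrable_kernel b y.
  by congr Rintegrable; apply/funext => x; rewrite ke.
have := expR_jensen (fun x => channel_kernel_ge0 b x y') (Rintegrable_kernel b y')
  h0' il ie.
have -> : \int[mu]_x (k b x y' * expR (l x)) = M b y.
  by apply: eq_Rintegral_setT => x; rewrite ke.
have -> : (\int[mu]_x (k b x y' * l x)) / \int[mu]_x k b x y' =
    b * q (Xh b y') (y - y').
  have -> : \int[mu]_x (k b x y' * l x) =
    \int[mu]_x (\sum_i (b * (\sum_j invmx C i j * (y - y') 0 j)) * (x 0 i * k b x y')).
    apply: eq_Rintegral_setT => x; rewrite /l bform_sumE mulr_sumr mulr_sumr.
    by apply: eq_bigr => i _; ring.
  have ii i : Rintegrable mu (fun x => x 0 i * k b x y').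
    by apply: Rintegrable_kernelM; exact: Rintegrable_prior.
  rewrite Rintegral_sum; last by move=> i; exact: RintegrableZ.
  rewrite bform_sumE mulr_suml mulr_sumr; apply: eq_bigr => i _.
  by rewrite RintegralZ_setT// mxE -/(M b y'); ring.
move=> /(ln_ge_expR h0') h.
by rewrite -(opprB y) /q bformNr mulrN lerBlDr [leRHS]addrC lerBrDr; exact: h.
Qed.

End posterior.

(** * Conditional expectation of the signal given the observation *)

Section conditional_mean.
Context {R : realType} {d : nat} {C : 'M[R]_d}.
Variables (mu gam : probability 'rV[R]_d R).
Hypothesis Cp : posdefmx C.
Hypothesis gamE : forall A, measurable A ->
  gam A = (\int[lebesgue_rV d]_(x in A) (gaussian_pdf C x)%:E)%E.
Hypothesis mu2 : square_Rintegrable_rV mu (@id 'rV[R]_d).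
Hypothesis mu_mean : forall i, \int[mu]_x x 0 i = 0.
Hypothesis mu_cov : forall i j, \int[mu]_x (x 0 i * x 0 j) = C i j.
Let q := bform (invmx C).
Local Notation m := (mu \x gam)%E.
Local Notation k := (@channel_kernel _ _ C).
Local Notation M := (@evidence _ _ C mu).
Local Notation Xh := (@posterior_mean _ _ C mu).

Let gam2 : square_Rintegrable_rV gam (@id 'rV[R]_d).
Proof. by move=> i; exact: (square_Rintegrable_coord Cp gamE). Qed.

Lemma Rintegral_weight b (f : 'rV[R]_d -> R) :
  Rintegrable mu f ->
  Rintegrable m (fun p => f p.1 * k b p.1 p.2).
Proof.
move=> fi; have mf : measurable_fun setT (fun p : 'rV[R]_d * 'rV[R]_d => f p.1).
  exact: (measurableT_comp (Rintegrable_measurable fi) measurable_fst).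
by apply/(Rintegral_channel mu Cp gamE b mf).1; exact: (Rintegral_fst gam fi).1.
Qed.

Lemma measurable_weighted b (f : 'rV[R]_d -> R) : Rintegrable mu f ->
  measurable_fun setT (fun z => \int[mu]_x (f x * k b x z)).
Proof.
move=> fi; apply: Rintegrable_measurable.
apply: (Rintegral_fubini21 (Rintegral_weight b fi) _).1 => z.
exact: Rintegrable_kernelM.
Qed.

Lemma measurable_evidence b : measurable_fun setT (M b).
Proof.
rewrite (_ : M b = fun z => \int[mu]_x (1 * k b x z)).
  by apply: measurable_weighted; exact: Rintegrable_cst.
by apply/funext => z; apply: eq_Rintegral_setT => x; rewrite mul1r.
Qed.

Lemma measurable_ln_evidence b : measurable_fun setT (fun z => ln (M b z)).
Proof. by apply: measurableT_comp => //; exact: measurable_evidence. Qed.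

Lemma measurable_posterior_mean b i : measurable_fun setT (fun z => Xh b z 0 i).
Proof.
(* The evidence is positive, so division by it can be written as [expR (- ln _)], which reduces
   measurability to that of the log evidence. *)
rewrite (_ : (fun z => _) =
    fun z => (\int[mu]_x (x 0 i * k b x z)) * expR (- ln (M b z))).
  apply: measurable_funM.
    by apply: measurable_weighted; exact: Rintegrable_prior.
  apply: measurableT_comp => //; apply: measurableT_comp => //.
  exact: measurable_ln_evidence.
apply/funext => z; rewrite mxE expRN lnK// posrE.
exact: evidence_gt0.
Qed.

(** Integrating the signal out of the joint density shows that the observation has density [M b]
    with respect to [gam]. *)
Lemma ge0_Rintegral_observation b (f : 'rV[R]_d -> R) :
  measurable_fun setT f -> (forall z, 0 <= f z) ->
  (\int[m]_p (f (channel b p).2)%:E = \int[gam]_z (f z * M b z)%:E)%E.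
Proof.
move=> mf f0.
have mf2 : measurable_fun setT (fun p : 'rV[R]_d * 'rV[R]_d => (f p.2)%:E).
  by apply/measurable_EFinP; exact: (measurableT_comp mf measurable_snd).
have f20 (p : 'rV[R]_d * 'rV[R]_d) : (0 <= (f p.2)%:E)%E by rewrite lee_fin.
rewrite (ge0_integral_channel mu Cp gamE b mf2 f20).
have mfk : measurable_fun setT (fun p => (f p.2)%:E * (k b p.1 p.2)%:E)%E.
  apply: emeasurable_funM => //; apply/measurable_EFinP.
  exact: measurable_channel_kernel.
have fk0 p : (0 <= (f p.2)%:E * (k b p.1 p.2)%:E)%E.
  by rewrite mule_ge0// lee_fin channel_kernel_ge0.
rewrite (fubini_tonelli2 _ mfk fk0); apply: eq_integral => z _.
rewrite /fubini_G/=.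
have ik := Rintegrable_kernel mu Cp b z.
rewrite EFinM (_ : M b z = \int[mu]_x k b x z)// -EFin_Rintegral//.
rewrite -ge0_integralZl ?lee_fin//.
- by apply/measurable_EFinP; exact: Rintegrable_measurable ik.
- by move=> x _; rewrite lee_fin channel_kernel_ge0.
Qed.

(** The posterior variance is nonnegative; everything is multiplied by the evidence so that no
    normalised posterior measure has to be built. *)
Lemma posterior_mean_sqr_le b z i :
  Xh b z 0 i ^+ 2 * M b z <= \int[mu]_x (x 0 i ^+ 2 * k b x z).
Proof.
have M0 := evidence_gt0 Cp mu2 mu_mean mu_cov b z.
have ik := Rintegrable_kernel mu Cp b z.
have i1 := Rintegrable_kernelM Cp b z (Rintegrable_prior mu2 i).
have i2 := Rintegrable_kernelM Cp b z (mu2 i).2.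
have Ve : \int[mu]_x (x 0 i * k b x z) = Xh b z 0 i * M b z.
  by rewrite mxE divfK// gt_eqF.
set X := Xh b z 0 i in Ve *; set W := M b z in M0 Ve *.
have : 0 <= \int[mu]_x (x 0 i ^+ 2 * k b x z +
    (- (2 * X) * (x 0 i * k b x z) + X ^+ 2 * k b x z)).
  apply: Rintegral_ge0 => x _.
  rewrite (_ : _ + _ = (x 0 i - X) ^+ 2 * k b x z); last by ring.
  by rewrite mulr_ge0 ?sqr_ge0// channel_kernel_ge0.
have i3 := RintegrableZ (- (2 * X)) i1; have i4 := RintegrableZ (X ^+ 2) ik.
rewrite RintegralD_setT//; last exact: RintegrableD.
rewrite RintegralD_setT// !RintegralZ_setT// Ve -/(M b z) -/W.
rewrite (_ : - (2 * X) * (X * W) + X ^+ 2 * W = - (X ^+ 2 * W)); last by ring.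
by rewrite subr_ge0.
Qed.

Lemma square_Rintegrable_posterior_mean b :
  square_Rintegrable_rV m (fun p => Xh b (channel b p).2).
Proof.
move=> i; have mX := measurable_posterior_mean b i.
have mY : measurable_fun setT (fun p : 'rV[R]_d * 'rV[R]_d => (channel b p).2).
  exact: measurable_shift.
split; first exact: (measurableT_comp mX mY).
apply: ge0_Rintegrable.
- by apply: measurable_funX; exact: (measurableT_comp mX mY).
- by move=> p; exact: sqr_ge0.
- have mX2 : measurable_fun setT (fun z => Xh b z 0 i ^+ 2) by exact: measurable_funX.
  rewrite (ge0_Rintegral_observation b mX2 (fun z => sqr_ge0 _)).
  have iw := Rintegral_weight b (mu2 i).2.
  have [iW _] := Rintegral_fubini21 iw (fun z => Rintegrable_kernelM Cp b z (mu2 i).2).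
  move/integrableP : iW => [mW]; apply: le_lt_trans; apply: ge0_le_integral => //.
  + move=> z _; rewrite lee_fin mulr_ge0 ?sqr_ge0// ltW//.
    exact: (evidence_gt0 Cp mu2 mu_mean mu_cov).
  + apply/measurable_EFinP; apply: measurable_funM => //.
    exact: measurable_evidence.
  + by apply: measurableT_comp.
  + move=> z _; rewrite lee_fin; apply: le_trans (posterior_mean_sqr_le _ _ _) _.
    exact: ler_norm.
Qed.

Lemma square_Rintegrable_signal :
  square_Rintegrable_rV m (fun p : 'rV[R]_d * 'rV[R]_d => p.1).
Proof. by move=> i; exact: (square_Rintegrable_fst gam (mu2 i)). Qed.

Lemma square_Rintegrable_noise :
  square_Rintegrable_rV m (fun p : 'rV[R]_d * 'rV[R]_d => p.2).
Proof. by move=> i; exact: (square_Rintegrable_snd mu (gam2 i)). Qed.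

Lemma square_Rintegrable_observation b :
  square_Rintegrable_rV m (fun p => (channel b p).2).
Proof.
apply: square_Rintegrable_rVD square_Rintegrable_noise _.
exact/square_Rintegrable_rVZ/square_Rintegrable_signal.
Qed.

(** The defining property of a conditional expectation. Under the joint density, integrating over
    the signal first turns both sides into the same function of [z], by the definition of [Xh]. *)
Lemma posterior_meanP b (psi : 'rV[R]_d -> R) i : measurable_fun setT psi ->
  square_Rintegrable m (fun p => psi (channel b p).2) ->
  \int[m]_p (psi (channel b p).2 * p.1 0 i) =
  \int[m]_p (psi (channel b p).2 * Xh b (channel b p).2 0 i).
Proof.
move=> mpsi psi2.
have mi : measurable_fun setT (fun p : 'rV[R]_d * 'rV[R]_d => p.1 0 i).
  exact: (measurableT_comp (measurable_coord i) measurable_fst).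
have mp : measurable_fun setT (fun p : 'rV[R]_d * 'rV[R]_d => psi p.2).
  exact: (measurableT_comp mpsi measurable_snd).
have mX : measurable_fun setT (fun p : 'rV[R]_d * 'rV[R]_d => Xh b p.2 0 i).
  exact: (measurableT_comp (measurable_posterior_mean b i) measurable_snd).
have m1 := measurable_funM mp mi; have m2 := measurable_funM mp mX.
have [h1 e1] := Rintegral_channel mu Cp gamE b m1.
have [h2 e2] := Rintegral_channel mu Cp gamE b m2.
rewrite [LHS]e1 [RHS]e2.
have /h1 i1 : Rintegrable m (fun p => psi (channel b p).2 * p.1 0 i).
  exact: square_RintegrableM psi2 (square_Rintegrable_signal i).
have /h2 i2 : Rintegrable m (fun p => psi (channel b p).2 * Xh b (channel b p).2 0 i).
  exact: square_RintegrableM psi2 (square_Rintegrable_posterior_mean b i).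
have s1 z : Rintegrable mu (fun x => psi z * x 0 i * k b x z).
  have := RintegrableZ (psi z) (Rintegrable_kernelM Cp b z (Rintegrable_prior mu2 i)).
  by congr Rintegrable; apply/funext => x; rewrite mulrA.
have s2 z : Rintegrable mu (fun x => psi z * Xh b z 0 i * k b x z).
  exact: RintegrableZ (Rintegrable_kernel mu Cp b z).
rewrite (Rintegral_fubini21 i1 s1).2 (Rintegral_fubini21 i2 s2).2.
apply: eq_Rintegral_setT => z.
transitivity (psi z * \int[mu]_x (x 0 i * k b x z)).
  rewrite -RintegralZ_setT; last exact: Rintegrable_kernelM (Rintegrable_prior mu2 i).
  by apply: eq_Rintegral_setT => x; rewrite mulrA.
transitivity (psi z * Xh b z 0 i * \int[mu]_x k b x z); last first.
  rewrite -RintegralZ_setT; last exact: Rintegrable_kernel.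
  exact: eq_Rintegral_setT.
rewrite -mulrA; congr (_ * _); rewrite mxE -/(M b z) divfK// gt_eqF//.
exact: (evidence_gt0 Cp mu2 mu_mean mu_cov).
Qed.

Lemma posterior_mean_bform b (f : 'rV[R]_d -> 'rV[R]_d) : measurable_fun setT f ->
  square_Rintegrable_rV m (fun p => f (channel b p).2) ->
  \int[m]_p q (f (channel b p).2) p.1 =
  \int[m]_p q (f (channel b p).2) (Xh b (channel b p).2).
Proof.
move=> /measurable_fun_mxP mf f2.
have [_ ->] := Rintegral_bform (invmx C) f2 square_Rintegrable_signal.
have [_ ->] := Rintegral_bform (invmx C) f2 (square_Rintegrable_posterior_mean b).
apply: eq_bigr => j _; apply: eq_bigr => i _; congr (_ * _).
exact: (posterior_meanP (psi := fun z => f z 0 i) j (mf 0 i) (f2 i)).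
Qed.

Lemma signal_noise_uncorrelated i j : \int[m]_p (p.1 0 i * p.2 0 j) = 0.
Proof.
have h : Rintegrable m (fun p : 'rV[R]_d * 'rV[R]_d => p.1 0 i * p.2 0 j).
  by apply: square_RintegrableM; [exact: square_Rintegrable_signal|exact: square_Rintegrable_noise].
have iz := square_RintegrableW (gam2 j).
rewrite (Rintegral_fubini12 h (fun x => RintegrableZ _ iz)).2.
rewrite -[RHS](Rintegral_cst1 mu); apply: eq_Rintegral_setT => x.
by rewrite RintegralZ_setT// (gaussian_mean Cp gamE) mulr0.
Qed.

Lemma noise_signal_form : \int[m]_p q p.1 p.2 = 0.
Proof.
have [_ ->] := Rintegral_bform (invmx C) square_Rintegrable_signal square_Rintegrable_noise.
rewrite big1// => j _; rewrite big1// => i _.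
by rewrite signal_noise_uncorrelated mulr0.
Qed.

Lemma noise_energy : \int[m]_p q p.2 p.2 = d%:R.
Proof.
have [_ ->] := Rintegral_bform (invmx C) square_Rintegrable_noise square_Rintegrable_noise.
rewrite -(trace_bform_inv Cp); apply: eq_bigr => j _; apply: eq_bigr => i _.
have := square_RintegrableM (gam2 i) (gam2 j) => h.
by rewrite (Rintegral_snd mu h).2 (gaussian_covariance Cp gamE).
Qed.

Lemma signal_energy : \int[m]_p q p.1 p.1 = d%:R.
Proof.
by have [h e] := prior_energy Cp mu2 mu_cov; rewrite (Rintegral_fst gam h).2.
Qed.

Lemma observation_energy b : \int[m]_p q (channel b p).2 (channel b p).2 =
  (1 + b ^+ 2) * d%:R.
Proof.
have [i1 _] := Rintegral_bform (invmx C) square_Rintegrable_signal square_Rintegrable_signal.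
have [i2 _] := Rintegral_bform (invmx C) square_Rintegrable_noise square_Rintegrable_noise.
have [i12 _] := Rintegral_bform (invmx C) square_Rintegrable_signal square_Rintegrable_noise.
transitivity (\int[m]_p (q p.2 p.2 + (2 * b * q p.1 p.2 + b ^+ 2 * q p.1 p.1))).
  apply: eq_Rintegral_setT => p; rewrite /channel/= /q.
  rewrite (bform_sqrD _ _ (posdefmx_inv_sym Cp)) !bformZr bformZl.
  by rewrite (bformC p.2 p.1 (posdefmx_inv_sym Cp)); ring.
have j1 := RintegrableZ (b ^+ 2) i1; have j2 := RintegrableZ (2 * b) i12.
rewrite RintegralD_setT//; last exact: RintegrableD.
rewrite RintegralD_setT// !RintegralZ_setT// signal_energy noise_energy.
by rewrite noise_signal_form; ring.
Qed.

Lemma observation_signal b : \int[m]_p q (channel b p).2 p.1 = b * d%:R.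
Proof.
have [i1 _] := Rintegral_bform (invmx C) square_Rintegrable_signal square_Rintegrable_signal.
have [i12 _] := Rintegral_bform (invmx C) square_Rintegrable_signal square_Rintegrable_noise.
transitivity (\int[m]_p (q p.1 p.2 + b * q p.1 p.1)).
  apply: eq_Rintegral_setT => p; rewrite /channel/= /q.
  by rewrite bformDl bformZl (bformC p.2 p.1 (posdefmx_inv_sym Cp)).
rewrite RintegralD_setT//; last exact: RintegrableZ.
by rewrite RintegralZ_setT// signal_energy noise_signal_form add0r.
Qed.

End conditional_mean.

Lemma ln_sqrtV (R : realType) (w : R) : 0 < w ->
  ln (Num.sqrt w)^-1 = - (ln w / 2).
Proof.
move=> w0; have s0 : 0 < Num.sqrt w by rewrite sqrtr_gt0.
rewrite lnV ?posrE//; congr (- _); rewrite -[in RHS](sqr_sqrtr (ltW w0)).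
by rewrite lnXn// -[X in X / _]mulr_natr mulfK// pnatr_eq0.
Qed.

(** * Entropy increments and energies along the channel *)

Section entropy_step.
Context {R : realType} {d : nat} {C : 'M[R]_d}.
Variables (mu gam : probability 'rV[R]_d R).
Hypothesis Cp : posdefmx C.
Hypothesis gamE : forall A, measurable A ->
  gam A = (\int[lebesgue_rV d]_(x in A) (gaussian_pdf C x)%:E)%E.
Hypothesis mu2 : square_Rintegrable_rV mu (@id 'rV[R]_d).
Hypothesis mu_mean : forall i, \int[mu]_x x 0 i = 0.
Hypothesis mu_cov : forall i j, \int[mu]_x (x 0 i * x 0 j) = C i j.
Let q := bform (invmx C).
Local Notation m := (mu \x gam)%E.
Local Notation k := (@channel_kernel _ _ C).
Local Notation M := (@evidence _ _ C mu).
Local Notation Xh := (@posterior_mean _ _ C mu).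

Let Xh2 b : square_Rintegrable_rV m (fun p => Xh b (channel b p).2).
Proof. exact: (square_Rintegrable_posterior_mean Cp gamE mu2 mu_mean mu_cov). Qed.

Let Y2 b : square_Rintegrable_rV m (fun p => (channel b p).2).
Proof. exact: (square_Rintegrable_observation Cp gamE mu2). Qed.

Let F2 : square_Rintegrable_rV m (fun p : 'rV[R]_d * 'rV[R]_d => p.1).
Proof. exact: (square_Rintegrable_signal gam mu2). Qed.

Let measurable_Y b : measurable_fun setT (fun p : 'rV[R]_d * 'rV[R]_d => (channel b p).2).
Proof. exact: measurable_shift. Qed.

(* The relative entropy of [Z + b *: F] with respect to [Z]. *)
Definition log_evidence_mean b := \int[m]_p ln (M b (channel b p).2).
Local Notation phi := log_evidence_mean.

Definition posterior_energy b :=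
  \int[m]_p bform (invmx C) (Xh b (channel b p).2) (Xh b (channel b p).2).
Local Notation J := posterior_energy.

Lemma Rintegrable_observation_energy b :
  Rintegrable m (fun p => q (channel b p).2 (channel b p).2).
Proof. exact: (Rintegral_bform (invmx C) (Y2 b) (Y2 b)).1. Qed.

Lemma Rintegrable_ln_evidence b b' : Rintegrable m (fun p => ln (M b (channel b' p).2)).
Proof.
apply: (@Rintegrable_le _ _ _ _ _
  (fun p => b ^+ 2 * d%:R / 2 + 2^-1 * q (channel b' p).2 (channel b' p).2)).
- exact: (measurableT_comp
    (measurable_ln_evidence mu Cp gamE b) (measurable_Y b')).
- move=> p; rewrite [X in _ <= _ + X]mulrC.
  exact: (ln_evidence_norm Cp mu2 mu_mean mu_cov).
- apply: RintegrableD; first exact: Rintegrable_cst.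
  by apply: RintegrableZ; exact: Rintegrable_observation_energy.
Qed.

(** Integrate [u <= v + expR (u - v) - 1] for [u] the test function and [v] the log evidence: as
    [M b] is the density of the observation, the exponential term becomes [r]. The linear [r - 1] in
    place of [ln r] spares any normalisation of test functions. *)
Lemma evidence_gibbs b (psi : 'rV[R]_d -> R) r : measurable_fun setT psi ->
  Rintegrable m (fun p => psi (channel b p).2) ->
  (\int[gam]_z (expR (psi z))%:E = r%:E)%E ->
  \int[m]_p psi (channel b p).2 <= phi b + r - 1.
Proof.
move=> mpsi ipsi er; have il := Rintegrable_ln_evidence b b.
have M0 z := evidence_gt0 Cp mu2 mu_mean mu_cov b z.
pose f z := expR (psi z - ln (M b z)).
have mf : measurable_fun setT f.
  apply: measurableT_comp => //; apply: measurable_funB => //.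
  exact: (measurable_ln_evidence mu Cp gamE b).
have f0 z : 0 <= f z by exact: expR_ge0.
have [jf ef] : Rintegrable m (fun p => f (channel b p).2) /\
    \int[m]_p f (channel b p).2 = r.
  apply: ge0_RintegrableP.
  - exact: (measurableT_comp mf (measurable_Y b)).
  - by move=> p; exact: f0.
  rewrite (ge0_Rintegral_observation mu Cp gamE b mf f0) -er.
  apply: eq_integral => z _; congr EFin; rewrite /f.
  have := M0 z; move: (M b z) => u u0.
  by rewrite expRB lnK ?posrE// divfK// gt_eqF.
have i1 := RintegrableD il jf; have ic := Rintegrable_cst m 1.
rewrite -ef /phi -[X in _ - X](Rintegral_cst1 m) -(RintegralD_setT il jf).
rewrite -(RintegralB_setT i1 ic); apply: le_Rintegral_setT.
- exact: ipsi.
- exact: RintegrableB i1 ic.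
move=> p; rewrite /f; move: (psi _) (ln _) => u v.
by have := expR_ge1Dx (u - v); lra.
Qed.

Lemma integral_evidence b : (\int[gam]_z (M b z)%:E = 1%:E)%E.
Proof.
have m1 : measurable_fun setT (fun _ : 'rV[R]_d => 1 : R) by [].
have := ge0_Rintegral_observation mu Cp gamE b m1 (fun=> ler01).
rewrite integral_probability_cst => ->; apply: eq_integral => z _.
by rewrite mul1r.
Qed.

(* Gibbs' variational principle for the law of [Z + b *: F], tested on the log
   evidence at [b'], plus convexity of the latter: this replaces the derivative
   of the relative entropy along the channel. *)
Lemma log_evidence_mean_step b b' : 0 <= b' ->
  phi b' - phi b <= (b' - b) * b' * J b'.
Proof.
move=> b'0; have il := Rintegrable_ln_evidence b' b.
have il' := Rintegrable_ln_evidence b' b'.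
have M0 z := evidence_gt0 Cp mu2 mu_mean mu_cov b' z.
have g : \int[m]_p ln (M b' (channel b p).2) <= phi b.
  rewrite -[leRHS](addrK 1).
  apply: (evidence_gibbs (measurable_ln_evidence mu Cp gamE b') il).
  rewrite -(integral_evidence b'); apply: eq_integral => z _.
  have := M0 z; move: (M b' z) => u u0.
  by rewrite lnK// posrE.
have [iXF _] := Rintegral_bform (invmx C) (Xh2 b') F2.
(* One posterior mean is traded for the signal, because the observation changes by [(b' - b) *: p.1]
   between the two levels. *)
have e : J b' = \int[m]_p q (Xh b' (channel b' p).2) p.1.
  apply/esym; apply: (posterior_mean_bform Cp gamE mu2 mu_mean mu_cov) => //.
  apply/measurable_fun_mxP => i j; rewrite ord1.
  exact: (measurable_posterior_mean Cp gamE mu2 mu_mean mu_cov).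
apply: (@le_trans _ _ (phi b' - \int[m]_p ln (M b' (channel b p).2))).
  by rewrite lerD2l lerN2.
rewrite /phi -(RintegralB_setT il' il) e -(RintegralZ_setT _ iXF).
apply: le_Rintegral_setT; [exact: RintegrableB|exact: RintegrableZ|move=> p].
apply: le_trans (ln_evidence_convex Cp mu2 mu_mean mu_cov _ _ _) _.
rewrite (_ : (channel b' p).2 - (channel b p).2 = (b' - b) *: p.1).
  by rewrite bformZr [X in _ <= X * _]mulrC mulrA.
by rewrite /channel/= opprD addrACA subrr add0r -scalerBl.
Qed.

Lemma log_evidence_mean0 : phi 0 = 0.
Proof.
rewrite -[RHS](Rintegral_cst1 m); apply: eq_Rintegral_setT => p.
rewrite (_ : M 0 _ = 1) ?ln1//.
rewrite -[RHS](Rintegral_cst1 mu); apply: eq_Rintegral_setT => x.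
by rewrite /channel_kernel expr0n/= !mul0r subrr expR0.
Qed.

Lemma donsker_varadhan b (g : 'rV[R]_d -> R) (K r : R) : 0 <= b ->
  measurable_fun setT g -> (forall z, `|g z| <= K) ->
  (\int[gam]_z (expR (g z))%:E = r%:E)%E ->
  \int[m]_p g ((Num.sqrt (1 + b ^+ 2))^-1 *: (channel b p).2) <=
  phi b - b ^+ 2 * d%:R / 2 + d%:R / 2 * ln (1 + b ^+ 2) + r - 1.
Proof.
move=> b0 mg gK er; set w := 1 + b ^+ 2; have w0 : 0 < w.
  by rewrite ltr_pwDl// sqr_ge0.
set c := (Num.sqrt w)^-1; have c0 : 0 < c by rewrite invr_gt0 sqrtr_gt0.
have c2 : c ^+ 2 = w^-1 by rewrite /c exprVn sqr_sqrtr// ltW.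
have mgc : measurable_fun setT (fun z : 'rV[R]_d => g (c *: z)).
  have := measurable_rV_affine c (0 : 'rV[R]_d).
  under eq_fun do rewrite addr0.
  by move=> h; exact: (measurableT_comp mg h).
have mq : measurable_fun setT (fun z => q z z) by exact: measurable_bform.
(* The correction is the logarithm of the weight in [gaussian_scale], so [expR psi] has the same
   integral as [expR g]. Its mean under the observation accounts for the two terms added to
   [phi b]. *)
pose psi z := g (c *: z) + ((1 - c ^+ 2) / 2 * q z z + d%:R * ln c).
have mpsi : measurable_fun setT psi.
  by apply: measurable_funD => //; apply: measurable_funD => //; exact: measurable_funM.
have iq := Rintegrable_observation_energy b.
have ig : Rintegrable m (fun p => g (c *: (channel b p).2)).
  apply: (@Rintegrable_le _ _ _ _ _ (fun=> K)) => //; last exact: Rintegrable_cst.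
  exact: (measurableT_comp mgc (measurable_Y b)).
have jq := RintegrableZ ((1 - c ^+ 2) / 2) iq.
have jc := Rintegrable_cst m (d%:R * ln c).
have jqc := RintegrableD jq jc.
have ipsi : Rintegrable m (fun p => psi (channel b p).2).
  exact: RintegrableD ig jqc.
have epsi : (\int[gam]_z (expR (psi z))%:E = r%:E)%E.
  have mE : measurable_fun setT (fun z : 'rV[R]_d => (expR (g z))%:E).
    by apply/measurable_EFinP; exact: measurableT_comp.
  have E0 (z : 'rV[R]_d) : (0 <= (expR (g z))%:E)%E by rewrite lee_fin expR_ge0.
  rewrite -er [RHS](gaussian_scale Cp gamE c0 mE E0).
  apply: eq_integral => z _; rewrite -EFinM; congr EFin.
  rewrite /psi expRD; congr (_ * _); rewrite expRD [LHS]mulrC; congr (_ * _).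
    by rewrite expRM_natl lnK// posrE.
  by congr expR; rewrite /q; ring.
have := evidence_gibbs mpsi ipsi epsi.
rewrite [X in X <= _ -> _](_ : _ = \int[m]_p g (c *: (channel b p).2) +
    ((1 - c ^+ 2) / 2 * (w * d%:R) + d%:R * ln c)); last first.
  rewrite -(observation_energy Cp gamE mu2 mu_cov b).
  rewrite -RintegralZ_setT// -[X in _ + (_ + X)](Rintegral_cst1 m).
  by rewrite -RintegralD_setT// -RintegralD_setT.
have -> : ln c = - (ln w / 2) by exact: ln_sqrtV.
have -> : (1 - c ^+ 2) / 2 * (w * d%:R) = b ^+ 2 * d%:R / 2.
  by rewrite c2 /w; field; rewrite gt_eqF.
move: (\int[m]_p _) (phi b) => u v; lra.
Qed.

(** Used at two values of [r]. For [r = 1], [V] is the conditional expectation of the noise; for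
    [r = b^2 / (1 + b^2)], it is [b] times the gap between the estimator optimal for a Gaussian
    signal and [Xh]. The cross term is a known covariance by conditioning, so bounding [V] bounds
    [J]. *)
Lemma residual_energy b r :
  let V p := r *: (channel b p).2 - b *: Xh b (channel b p).2 in
  square_Rintegrable_rV m V /\
  \int[m]_p q (V p) (V p) =
    r ^+ 2 * (1 + b ^+ 2) * d%:R - 2 * r * b ^+ 2 * d%:R + b ^+ 2 * J b.
Proof.
move=> V; have V2 : square_Rintegrable_rV m V.
  by apply: square_Rintegrable_rVB; exact: square_Rintegrable_rVZ.
split => //.
have [iYX _] := Rintegral_bform (invmx C) (Y2 b) (Xh2 b).
have [iYY _] := Rintegral_bform (invmx C) (Y2 b) (Y2 b).
have [iXX _] := Rintegral_bform (invmx C) (Xh2 b) (Xh2 b).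
have eYX : \int[m]_p q (channel b p).2 (Xh b (channel b p).2) = b * d%:R.
  rewrite -(observation_signal Cp gamE mu2 mu_cov b).
  apply/esym/(posterior_mean_bform Cp gamE mu2 mu_mean mu_cov (f := id)) => //.
transitivity (\int[m]_p (r ^+ 2 * q (channel b p).2 (channel b p).2 +
   (- (2 * r * b) * q (channel b p).2 (Xh b (channel b p).2) +
    b ^+ 2 * q (Xh b (channel b p).2) (Xh b (channel b p).2)))).
  apply: eq_Rintegral_setT => p; rewrite /V; set y := (channel b p).2.
  rewrite /q (bform_sqrD _ _ (posdefmx_inv_sym Cp)).
  rewrite !bformNr !bformNl !bformZl !bformZr; ring.
have j1 := RintegrableZ (r ^+ 2) iYY; have j2 := RintegrableZ (- (2 * r * b)) iYX.
have j3 := RintegrableZ (b ^+ 2) iXX.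
rewrite RintegralD_setT//; last exact: RintegrableD.
rewrite RintegralD_setT// !RintegralZ_setT// eYX.
by rewrite (observation_energy Cp gamE mu2 mu_cov) -/(J b); ring.
Qed.

(** Conditional expectation contracts the energy, and the signal has energy [d]: expand the
    nonnegative energy of [F - Xh]. *)
Lemma posterior_energy_le b : J b <= d%:R.
Proof.
have [iXX _] := Rintegral_bform (invmx C) (Xh2 b) (Xh2 b).
have [iXF _] := Rintegral_bform (invmx C) (Xh2 b) F2.
have [iFF _] := Rintegral_bform (invmx C) F2 F2.
have e : J b = \int[m]_p q (Xh b (channel b p).2) p.1.
  apply/esym; apply: (posterior_mean_bform Cp gamE mu2 mu_mean mu_cov) => //.
  apply/measurable_fun_mxP => i j; rewrite ord1.
  exact: (measurable_posterior_mean Cp gamE mu2 mu_mean mu_cov).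
have : 0 <= \int[m]_p (q p.1 p.1 + (- 2 * q (Xh b (channel b p).2) p.1 +
    q (Xh b (channel b p).2) (Xh b (channel b p).2))).
  apply: Rintegral_ge0 => p _; set x := Xh _ _.
  have := bform_inv_ge0 (p.1 - x) Cp.
  rewrite (bform_sqrD _ _ (posdefmx_inv_sym Cp)) !bformNr bformNl.
  rewrite (bformC p.1 x (posdefmx_inv_sym Cp)) /q.
  move: (bform _ _ _) (bform _ _ _) (bform _ _ _) => u v w; lra.
have j2 := RintegrableZ (- 2) iXF.
rewrite RintegralD_setT//; last exact: RintegrableD.
rewrite RintegralD_setT// RintegralZ_setT// -e -/(J b).
rewrite (signal_energy gam Cp mu2 mu_cov); move: (J b) => u; lra.
Qed.

End entropy_step.

(** * The two bounds on the posterior energy *)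

Lemma sqr_sum_le (R : realType) n (a : 'I_n -> R) :
  (\sum_i a i) ^+ 2 <= n%:R * \sum_i a i ^+ 2.
Proof.
case: n => [|n] in a *; first by rewrite !big_ord0 mulr0 expr0n.
set S := \sum_i a i; set c := S / n.+1%:R.
have n0 : n.+1%:R != 0 :> R by rewrite pnatr_eq0.
have : 0 <= n.+1%:R * \sum_i (a i - c) ^+ 2.
  by rewrite mulr_ge0// sumr_ge0// => i _; exact: sqr_ge0.
have -> : \sum_i (a i - c) ^+ 2 = \sum_i a i ^+ 2 - 2 * c * S + n.+1%:R * c ^+ 2.
  rewrite (eq_bigr (fun i => a i ^+ 2 + (- (2 * c) * a i + c ^+ 2))); last first.
    by move=> i _; ring.
  by rewrite !big_split/= -mulr_sumr sumr_const card_ord -mulr_natl -/S; ring.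
rewrite -subr_ge0 => h; rewrite -subr_ge0; move: h.
by rewrite (_ : _ - 0 = n.+1%:R * (\sum_i a i ^+ 2) - S ^+ 2)// /c; field.
Qed.

Lemma Rintegral_prodM d1 d2 (T1 : measurableType d1) (T2 : measurableType d2)
    (R : realType) (mu : probability T1 R) (gam : probability T2 R)
    (f : T1 -> R) (g : T2 -> R) : Rintegrable mu f -> Rintegrable gam g ->
  Rintegrable (mu \x gam)%E (fun p => f p.1 * g p.2) /\
  \int[(mu \x gam)%E]_p (f p.1 * g p.2) = (\int[mu]_x f x) * \int[gam]_z g z.
Proof.
move=> fi gi.
have mf := Rintegrable_measurable fi; have mg := Rintegrable_measurable gi.
have mfg : measurable_fun setT (fun p : T1 * T2 => f p.1 * g p.2).
  apply: measurable_funM.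
    exact: (measurableT_comp mf measurable_fst).
  exact: (measurableT_comp mg measurable_snd).
have mE : measurable_fun setT (EFin \o (fun p : T1 * T2 => f p.1 * g p.2)).
  exact/measurable_EFinP.
have ig := Rintegrable_norm gi.
have h : Rintegrable (mu \x gam)%E (fun p => f p.1 * g p.2).
  apply/(integrable12ltyP _ _ mE).
  rewrite (eq_integral (fun x => (`|f x| * \int[gam]_z `|g z|)%:E)); last first.
    move=> x _; rewrite EFinM -EFin_Rintegral// -ge0_integralZl ?lee_fin//.
    - by apply: eq_integral => z _; rewrite /= normrM EFinM.
    - by apply/measurable_EFinP; exact: measurableT_comp.
  have /integrableP[_] := RintegrableZ (\int[gam]_z `|g z|) (Rintegrable_norm fi).
  apply: le_lt_trans; apply: ge0_le_integral => //.
  - by move=> x _; rewrite lee_fin mulr_ge0// Rintegral_ge0.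
  - by apply/measurable_EFinP; apply: measurable_funM => //; exact: measurableT_comp.
  - apply/measurable_EFinP; apply: measurableT_comp => //.
    by apply: measurable_funM => //; exact: measurableT_comp.
  - by move=> x _; rewrite /= lee_fin mulrC ler_norm.
split => //.
rewrite (Rintegral_fubini12 h (fun x => RintegrableZ (f x) gi)).2.
rewrite mulrC -RintegralZ_setT//; apply: eq_Rintegral_setT => x.
by rewrite mulrC -(RintegralZ_setT (f x) gi).
Qed.

(** Monotone convergence. It lets square norms be estimated by duality against bounded functions
    only. *)
Lemma Rintegral_sqr_le_trunc d (T : measurableType d) (R : realType)
    (m : {measure set T -> \bar R}) (f : T -> R) (K : R) : square_Rintegrable m f ->
  (forall n : nat, \int[m]_x (if `|f x| <= n%:R then f x ^+ 2 else 0) <= K) ->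
  \int[m]_x f x ^+ 2 <= K.
Proof.
move=> [mf f2] h.
pose g n x := if `|f x| <= n%:R then f x ^+ 2 else 0.
have mg n : measurable_fun setT (g n).
  apply: measurable_fun_ifT => //; last exact: measurable_funX.
  by apply: measurable_fun_ler => //; exact: measurableT_comp.
have g0 n x : 0 <= g n x by rewrite /g; case: ifP => // _; exact: sqr_ge0.
have gle n x : g n x <= f x ^+ 2 by rewrite /g; case: ifP => // _; exact: sqr_ge0.
have ig n : Rintegrable m (g n).
  by apply: Rintegrable_le (mg n) _ f2 => x; rewrite ger0_norm.
rewrite -lee_fin -EFin_Rintegral//.
have -> : (\int[m]_x (f x ^+ 2)%:E)%E = limn (fun n => \int[m]_x (g n x)%:E)%E.
  rewrite -monotone_convergence//.
  - apply: eq_integral => x _; apply/esym/cvg_lim => //.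
    apply: cvg_near_cst.
    have [N _ hN] := nbhs_infty_ger `|f x|.
    by exists N => // n /= /hN; rewrite /g => ->.
  - by move=> n; exact/measurable_EFinP.
  - by move=> n x _; rewrite lee_fin.
  - move=> x _ n n' nn'; rewrite lee_fin /g; case: ifP => [xn|_]; last exact: g0.
    by rewrite (le_trans xn)// ler_nat.
apply: lime_le.
  apply: ereal_nondecreasing_is_cvgn => n n' nn'.
  rewrite !EFin_Rintegral// lee_fin; apply: le_Rintegral_setT => // x.
  rewrite /g; case: ifP => [xn|_]; last exact: g0.
  by rewrite (le_trans xn)// ler_nat.
by apply: nearW => n; rewrite EFin_Rintegral// lee_fin; exact: h.
Qed.

(** * Energy bound from the Stein identity *)

Section stein_bound.
Context {R : realType} {d : nat} {C : 'M[R]_d}.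
Variables (mu gam : probability 'rV[R]_d R).
Hypothesis Cp : posdefmx C.
Hypothesis gamE : forall A, measurable A ->
  gam A = (\int[lebesgue_rV d]_(x in A) (gaussian_pdf C x)%:E)%E.
Hypothesis mu2 : square_Rintegrable_rV mu (@id 'rV[R]_d).
Hypothesis mu_mean : forall i, \int[mu]_x x 0 i = 0.
Hypothesis mu_cov : forall i j, \int[mu]_x (x 0 i * x 0 j) = C i j.
Let q := bform (invmx C).
Local Notation m := (mu \x gam)%E.
Local Notation Xh := (@posterior_mean _ _ C mu).
Local Notation J := (@posterior_energy _ _ C mu gam).

Variable tau : 'rV[R]_d -> 'M[R]_d.
Hypothesis tau1 : forall i j, Rintegrable mu (fun x => tau x i j).
Hypothesis stein : forall (i : 'I_d) (g : 'rV[R]_d -> R),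
  (forall x, differentiable g x) ->
  Rintegrable mu (fun x => x 0 i * g x) ->
  (forall j, Rintegrable mu (fun x => tau x i j * 'D_(delta_mx 0 j) g x)) ->
  \int[mu]_x (x 0 i * g x) =
  \sum_j \int[mu]_x (tau x i j * 'D_(delta_mx 0 j) g x).
Hypothesis tau2 : forall i j, square_Rintegrable mu (fun x => C i j - tau x i j).

Let measurable_Y b : measurable_fun setT (fun p : 'rV[R]_d * 'rV[R]_d => (channel b p).2).
Proof. exact: measurable_shift. Qed.

(** The [j]-th coordinate of [C^-1 z], written as the weight that differentiation in direction [j]
    produces in [gaussian_derivable]. *)
Definition dual_noise (j : 'I_d) (z : 'rV[R]_d) := bform (invmx C) (delta_mx 0 j) z.
Local Notation Zt := dual_noise.

Lemma dual_noiseE j (z : 'rV[R]_d) : Zt j z = (invmx C *m z^T) j 0.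
Proof. by rewrite /dual_noise /bform -mulmxA -rowE mxE. Qed.

Lemma square_Rintegrable_dual_noise j : square_Rintegrable gam (Zt j).
Proof.
have mZ : measurable_fun setT (Zt j) by exact: measurable_bform.
pose c := \sum_l \sum_i `|invmx C i l|.
split => //; apply: (@Rintegrable_l1_bound _ _ _ _ Cp gamE _
  ((c * `|delta_mx 0 j : 'rV[R]_d|) ^+ 2) 2) => //.
  exact: measurable_funX.
move=> z; rewrite normrX expRM_natl -exprMn.
have c0 : 0 <= c by apply: sumr_ge0 => l _; exact: sumr_ge0.
rewrite lerXn2r ?nnegrE ?mulr_ge0 ?expR_ge0//.
apply: le_trans (bform_le _ _ _) _; rewrite ler_wpM2l ?mulr_ge0//.
by have := le_l1_expR z; lra.
Qed.

Lemma noise_dual_noise j (z : 'rV[R]_d) : z 0 j = \sum_l C j l * Zt l z.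
Proof.
rewrite -[LHS](bform_row_inv Cp) [row j C]row_sum_delta.
elim/big_ind2 : _ => [|x1 x2 y1 y2 <- <-|l _].
- by rewrite /bform !mul0mx mxE.
- by rewrite bformDl.
- by rewrite bformZl mxE.
Qed.

(** The Stein identity is applied to the average of [psi (z + b *: x)] over the noise; its partial
    derivatives bring out [b] and the dual noise, with no smoothness of [psi]. *)
Lemma stein_channel (b : R) j (psi : 'rV[R]_d -> R) (K : R) : measurable_fun setT psi ->
  0 <= K -> (forall y, `|psi y| <= K) ->
  \int[m]_p (p.1 0 j * psi (channel b p).2) =
  b * \sum_l \int[m]_p (tau p.1 j l * Zt l p.2 * psi (channel b p).2).
Proof.
move=> mpsi K0 psiK.
have mY := measurableT_comp mpsi (measurable_Y b).
have mx1 x : measurable_fun setT (fun z : 'rV[R]_d => psi (z + b *: x)).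
  have := measurable_rV_affine 1 (b *: x).
  under eq_fun do rewrite scale1r.
  by move=> h; exact: (measurableT_comp mpsi h).
pose u x := \int[gam]_z psi (z + b *: x).
have hu := gaussian_derivable Cp gamE b mpsi K0 psiK.
have Du x l : 'D_(delta_mx 0 l) u x = b * \int[gam]_z (psi (z + b *: x) * Zt l z).
  exact: (hu x).2.
have ipsi x : Rintegrable gam (fun z => psi (z + b *: x)).
  apply: (@Rintegrable_le _ _ _ _ _ (fun=> K)) => //.
  exact: Rintegrable_cst.
have iZ l := square_RintegrableW (square_Rintegrable_dual_noise l).
have iZpsi l x : Rintegrable gam (fun z => psi (z + b *: x) * Zt l z).
  apply: (@Rintegrable_le _ _ _ _ _ (fun z => K * `|Zt l z|)).
  - by apply: measurable_funM => //; exact: Rintegrable_measurable (iZ l).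
  - by move=> z; rewrite normrM ler_wpM2r.
  - exact/RintegrableZ/Rintegrable_norm.
have i1 : Rintegrable m (fun p => p.1 0 j * psi (channel b p).2).
  have h := (Rintegral_fst gam (square_RintegrableW (mu2 j))).1.
  apply: (@Rintegrable_le _ _ _ _ _ (fun p : 'rV[R]_d * 'rV[R]_d => K * `|p.1 0 j|)).
  - by apply: measurable_funM; [exact: Rintegrable_measurable h|exact: mY].
  - by move=> p; rewrite normrM mulrC ler_wpM2r.
  - exact/RintegrableZ/Rintegrable_norm.
have i2 l : Rintegrable m (fun p => tau p.1 j l * Zt l p.2 * psi (channel b p).2).
  have h := (Rintegral_prodM (tau1 j l) (iZ l)).1.
  apply: (@Rintegrable_le _ _ _ _ _ (fun p : 'rV[R]_d * 'rV[R]_d => K * `|tau p.1 j l * Zt l p.2|)).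
  - by apply: measurable_funM; [exact: Rintegrable_measurable h|exact: mY].
  - by move=> p; rewrite normrM mulrC ler_wpM2r.
  - exact/RintegrableZ/Rintegrable_norm.
have [k1 ->] := Rintegral_fubini12 i1 (fun x => RintegrableZ (x 0 j) (ipsi x)).
have s2 l x : Rintegrable gam (fun z => tau x j l * Zt l z * psi (z + b *: x)).
  have := RintegrableZ (tau x j l) (iZpsi l x).
  by congr Rintegrable; apply/funext => z; ring.
have e2 l x : b * \int[gam]_z (tau x j l * Zt l z * psi (z + b *: x)) =
    tau x j l * 'D_(delta_mx 0 l) u x.
  rewrite Du mulrCA; congr (_ * _); rewrite -RintegralZ_setT//.
  by apply: eq_Rintegral_setT => z; ring.
have e1 (x : 'rV[R]_d) : \int[gam]_z (x 0 j * psi (z + b *: x)) = x 0 j * u x.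
  by rewrite RintegralZ_setT.
transitivity (\int[mu]_x (x 0 j * u x)).
  by apply: eq_Rintegral_setT => x; exact: e1.
rewrite stein.
- rewrite mulr_sumr; apply: eq_bigr => l _.
  have [k2 ->] := Rintegral_fubini12 (i2 l) (s2 l).
  rewrite -RintegralZ_setT//; apply: eq_Rintegral_setT => x.
  by rewrite -e2.
- by move=> x; exact: (hu x).1.
- by apply: eq_Rintegrable k1; exact: e1.
- move=> l; have [k2 _] := Rintegral_fubini12 (i2 l) (s2 l).
  by apply: eq_Rintegrable (RintegrableZ b k2) => x; exact: e2.
Qed.

(** The Stein defect contracted with the dual noise. As [Z = C (C^-1 Z)], replacing [tau] by [C] in
    [stein_channel] turns the sum into the noise itself, and [X] is the discrepancy. *)
Let X j (p : 'rV[R]_d * 'rV[R]_d) := \sum_l (C j l - tau p.1 j l) * Zt l p.2.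

Let square_Rintegrable_X j : square_Rintegrable m (X j).
Proof.
have h l : square_Rintegrable m (fun p : 'rV[R]_d * 'rV[R]_d =>
    (C j l - tau p.1 j l) * Zt l p.2).
  have [mt t2] := tau2 j l; have [mZ Z2] := square_Rintegrable_dual_noise l.
  split.
    apply: measurable_funM.
      exact: (measurableT_comp mt measurable_fst).
    exact: (measurableT_comp mZ measurable_snd).
  have := (Rintegral_prodM t2 Z2).1.
  by congr Rintegrable; apply/funext => p; rewrite exprMn.
rewrite /X; elim: (index_enum _) => [|l s IH].
  under eq_fun do rewrite big_nil; exact: square_Rintegrable_cst.
under eq_fun do rewrite big_cons; exact: square_RintegrableD (h l) IH.
Qed.

Let residual b r (j : 'I_d) (y : 'rV[R]_d) := r * y 0 j - b * Xh b y 0 j.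

Let measurable_residual b r j : measurable_fun setT (residual b r j).
Proof.
apply: measurable_funB; apply: measurable_funM => //.
  exact: measurable_coord.
exact: (measurable_posterior_mean Cp gamE mu2 mu_mean mu_cov).
Qed.

Let square_Rintegrable_residual b r j :
  square_Rintegrable m (fun p => residual b r j (channel b p).2).
Proof.
apply: square_RintegrableB; apply: square_RintegrableZ.
  exact: (square_Rintegrable_observation Cp gamE mu2).
exact: (square_Rintegrable_posterior_mean Cp gamE mu2 mu_mean mu_cov).
Qed.

(** Against functions of the observation, [X] acts as [Z - b^-1 F] by the Stein identity, and the
    residual as [t Z - b (1 - t) F]. The value of [t] is the one that makes the second [t] times the
    first. *)
Lemma residual_duality b t j (psi : 'rV[R]_d -> R) (K : R) : b != 0 ->
  t = b ^+ 2 / (1 + b ^+ 2) ->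
  measurable_fun setT psi -> 0 <= K -> (forall y, `|psi y| <= K) ->
  \int[m]_p (residual b t j (channel b p).2 * psi (channel b p).2) =
  t * \int[m]_p (X j p * psi (channel b p).2).
Proof.
move=> b0 tE mpsi K0 psiK.
have mY := measurableT_comp mpsi (measurable_Y b).
have psi2 : square_Rintegrable m (fun p => psi (channel b p).2).
  apply: (@square_Rintegrable_bounded _ _ _ _ _ K); first exact: mY.
  by move=> p; exact: psiK.
have F2 := square_Rintegrable_signal gam mu2.
have Z2 := square_Rintegrable_noise mu Cp gamE.
have Xh2 := square_Rintegrable_posterior_mean Cp gamE mu2 mu_mean mu_cov b.
have iF := square_RintegrableM (F2 j) psi2.
have iZ := square_RintegrableM (Z2 j) psi2.
have iXh := square_RintegrableM (Xh2 j) psi2.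
have iD l := square_RintegrableW (square_Rintegrable_dual_noise l).
have itau l : Rintegrable m (fun p => tau p.1 j l * Zt l p.2 * psi (channel b p).2).
  have h := (Rintegral_prodM (tau1 j l) (iD l)).1.
  apply: (@Rintegrable_le _ _ _ _ _
    (fun p : 'rV[R]_d * 'rV[R]_d => K * `|tau p.1 j l * Zt l p.2|)).
  - by apply: measurable_funM; [exact: Rintegrable_measurable h|exact: mY].
  - by move=> p; rewrite normrM mulrC ler_wpM2r.
  - exact/RintegrableZ/Rintegrable_norm.
have eXh : \int[m]_p (Xh b (channel b p).2 0 j * psi (channel b p).2) =
    \int[m]_p (p.1 0 j * psi (channel b p).2).
  transitivity (\int[m]_p (psi (channel b p).2 * p.1 0 j)); last first.
    by apply: eq_Rintegral_setT => p; rewrite mulrC.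
  rewrite (posterior_meanP Cp gamE mu2 mu_mean mu_cov j mpsi psi2).
  by apply: eq_Rintegral_setT => p; rewrite mulrC.
have eX : \int[m]_p (X j p * psi (channel b p).2) =
    \int[m]_p (p.2 0 j * psi (channel b p).2) -
    b^-1 * \int[m]_p (p.1 0 j * psi (channel b p).2).
  rewrite (stein_channel b j mpsi K0 psiK) mulKf// -Rintegral_sum//.
  rewrite -RintegralB_setT//; last exact: Rintegrable_sum.
  apply: eq_Rintegral_setT => p; rewrite [p.2 0 j]noise_dual_noise /X.
  rewrite !mulr_suml -sumrB; apply: eq_bigr => l _; ring.
have w0 : 1 + b ^+ 2 != 0 by rewrite gt_eqF// ltr_pwDl// sqr_ge0.
rewrite eX; transitivity (t * \int[m]_p (p.2 0 j * psi (channel b p).2) +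
   t * b * \int[m]_p (p.1 0 j * psi (channel b p).2) -
   b * \int[m]_p (Xh b (channel b p).2 0 j * psi (channel b p).2)); last first.
  rewrite eXh tE; move: (\int[m]_p _) (\int[m]_p _) => u v; field.
  by rewrite w0 b0.
have j1 := RintegrableZ t iZ; have j2 := RintegrableZ (t * b) iF.
have j3 := RintegrableZ b iXh.
rewrite -(RintegralZ_setT t iZ) -(RintegralZ_setT (t * b) iF) -(RintegralZ_setT b iXh).
rewrite -(RintegralD_setT j1 j2) -(RintegralB_setT (RintegrableD j1 j2) j3).
by apply: eq_Rintegral_setT => p; rewrite /residual /channel/= !mxE; ring.
Qed.

(** The residual is [t] times the conditional expectation of [X], hence a contraction in L2. The
    duality accepts bounded tests, so the residual is tested against its own truncation. *)
Lemma residual_sqr_le b t j : b != 0 -> t = b ^+ 2 / (1 + b ^+ 2) ->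
  \int[m]_p residual b t j (channel b p).2 ^+ 2 <= t ^+ 2 * \int[m]_p X j p ^+ 2.
Proof.
move=> b0 tE; apply: (Rintegral_sqr_le_trunc (square_Rintegrable_residual b t j)) => n.
pose psi y := if `|residual b t j y| <= n%:R then residual b t j y else 0.
have mr := measurable_residual b t j.
have mpsi : measurable_fun setT psi.
  apply: measurable_fun_ifT => //.
  by apply: measurable_fun_ler => //; exact: measurableT_comp.
have psiK y : `|psi y| <= n%:R.
  by rewrite /psi; case: ifP => // _; rewrite normr0.
have psi2 : square_Rintegrable m (fun p => psi (channel b p).2).
  apply: (@square_Rintegrable_bounded _ _ _ _ _ n%:R).
    exact: (measurableT_comp mpsi (measurable_Y b)).
  by move=> p; exact: psiK.
have := residual_duality j b0 tE mpsi (ler0n _ n) psiK.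
have -> : \int[m]_p (residual b t j (channel b p).2 * psi (channel b p).2) =
    \int[m]_p psi (channel b p).2 ^+ 2.
  by apply: eq_Rintegral_setT => p; rewrite /psi; case: ifP => _;
    rewrite ?expr2// !mulr0.
have -> : \int[m]_x (if `|residual b t j (channel b x).2| <= n%:R
    then residual b t j (channel b x).2 ^+ 2 else 0) = \int[m]_p psi (channel b p).2 ^+ 2.
  by apply: eq_Rintegral_setT => p; rewrite /psi; case: ifP => _ //; rewrite expr0n.
have X2 := square_Rintegrable_X j.
have iX := square_RintegrableM X2 psi2.
(* Young's inequality with weights one half: the [psi] term is absorbed by the left-hand side of the
   duality. *)
have : \int[m]_p (t * (X j p * psi (channel b p).2)) <=
    \int[m]_p (t ^+ 2 / 2 * X j p ^+ 2 + 2^-1 * psi (channel b p).2 ^+ 2).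
  apply: le_Rintegral_setT; first exact: RintegrableZ.
    by apply: RintegrableD; apply: RintegrableZ; [exact: X2.2|exact: psi2.2].
  move=> p; have := sqr_ge0 (t * X j p - psi (channel b p).2).
  by move: (X j p) (psi _) => u v; nra.
rewrite RintegralZ_setT// RintegralD_setT; [|exact/RintegrableZ/X2.2|exact/RintegrableZ/psi2.2].
rewrite RintegralZ_setT; last exact: X2.2.
rewrite RintegralZ_setT; last exact: psi2.2.
move: (\int[m]_p _) (\int[m]_p _) (\int[m]_p _) => u v w; lra.
Qed.

Variables (lam M2 : R).
Hypothesis lamP : forall x : 'rV[R]_d, q x x <= lam * \sum_i x 0 i ^+ 2.
Hypothesis lam0 : 0 <= lam.
Hypothesis M2_ge0 : 0 <= M2.
Hypothesis M2P : forall j, \int[gam]_z Zt j z ^+ 2 <= M2.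

(** Cauchy-Schwarz over the index [l], then the product measure separates [tau] from the dual noise.
    This is where the factor [d] of the leading term comes from. *)
Let X_sqr_le j :
  \int[m]_p X j p ^+ 2 <= d%:R * M2 * \sum_l \int[mu]_x (C j l - tau x j l) ^+ 2.
Proof.
have i2 l := Rintegral_prodM (tau2 j l).2 (square_Rintegrable_dual_noise l).2.
have isum : Rintegrable m (fun p : 'rV[R]_d * 'rV[R]_d =>
    \sum_l (C j l - tau p.1 j l) ^+ 2 * Zt l p.2 ^+ 2).
  by apply: Rintegrable_sum => l; exact: (i2 l).1.
apply: (@le_trans _ _ (\int[m]_p (d%:R *
    \sum_l (C j l - tau p.1 j l) ^+ 2 * Zt l p.2 ^+ 2))).
  apply: le_Rintegral_setT; first exact: (square_Rintegrable_X j).2.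
    exact: RintegrableZ.
  move=> p; rewrite /X; apply: le_trans (sqr_sum_le _) _.
  by rewrite le_eqVlt; apply/orP; left; apply/eqP; congr (_ * _);
    apply: eq_bigr => l _; rewrite exprMn.
rewrite RintegralZ_setT// -mulrA ler_wpM2l// Rintegral_sum; last first.
  by move=> l; exact: (i2 l).1.
rewrite mulr_sumr; apply: ler_sum => l _; rewrite (i2 l).2 mulrC.
by rewrite ler_wpM2r// Rintegral_ge0// => x _; exact: sqr_ge0.
Qed.

Lemma posterior_energy_stein b : 0 < b ->
  J b <= d%:R * (1 - (1 + b ^+ 2)^-1) +
    lam * (d%:R * M2 * \sum_j \sum_l \int[mu]_x (C j l - tau x j l) ^+ 2) *
      (1 + b ^+ 2)^-1.
Proof.
move=> b0; have bn0 : b != 0 by rewrite gt_eqF.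
pose t := b ^+ 2 / (1 + b ^+ 2).
have w0 : 0 < 1 + b ^+ 2 by rewrite ltr_pwDl// sqr_ge0.
have [V2 eV] := residual_energy Cp gamE mu2 mu_mean mu_cov b t.
set V := fun p => _ in V2 eV; set D := \sum_j \sum_l _.
have VE p j : V p 0 j = residual b t j (channel b p).2 by rewrite /V /residual !mxE.
have h1 : \int[m]_p q (V p) (V p) <= lam * (t ^+ 2 * (d%:R * M2 * D)).
  have [iq _] := Rintegral_bform (invmx C) V2 V2.
  have isum : Rintegrable m (fun p => \sum_j V p 0 j ^+ 2).
    by apply: Rintegrable_sum => j; exact: (V2 j).2.
  apply: (@le_trans _ _ (\int[m]_p (lam * \sum_j V p 0 j ^+ 2))).
    by apply: (le_Rintegral_setT iq (RintegrableZ lam isum)) => p; exact: lamP.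
  rewrite RintegralZ_setT// ler_wpM2l// Rintegral_sum; last by move=> j; exact: (V2 j).2.
  rewrite /D 2!mulr_sumr; apply: ler_sum => j _.
  have := residual_sqr_le j bn0 (erefl t).
  under [X in X <= _ -> _]eq_Rintegral_setT do rewrite -VE.
  by move/le_trans; apply; rewrite ler_wpM2l ?sqr_ge0//; exact: X_sqr_le.
have E0 : 0 <= lam * (d%:R * M2 * D).
  rewrite mulr_ge0// mulr_ge0 ?mulr_ge0// sumr_ge0// => j _; apply: sumr_ge0 => l _.
  by apply: Rintegral_ge0 => x _; exact: sqr_ge0.
move: h1 E0; rewrite eV; move: (J b) (d%:R * M2 * D) => u E h1 E0.
have b20 : 0 < b ^+ 2 by rewrite exprn_gt0.
(* For this [t] the residual energy is exactly [b^2] times the excess of [J] over its Gaussian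
   value. *)
have e1 : t ^+ 2 * (1 + b ^+ 2) * d%:R - 2 * t * b ^+ 2 * d%:R + b ^+ 2 * u =
    b ^+ 2 * u - b ^+ 2 * (d%:R * (1 - (1 + b ^+ 2)^-1)).
  by rewrite /t; field; rewrite gt_eqF.
have t01 : t <= 1 by rewrite ler_pdivrMr// mul1r lerDr.
(* One factor [t] is spent as [b^2 / (1 + b^2)], the other is bounded by 1. *)
have e2 : lam * (t ^+ 2 * E) <= b ^+ 2 * (lam * E * (1 + b ^+ 2)^-1).
  rewrite (_ : lam * _ = b ^+ 2 * (lam * E * (1 + b ^+ 2)^-1) * t); last first.
    by rewrite /t; field; rewrite gt_eqF.
  by rewrite ler_piMr// mulr_ge0 ?(ltW b20)// mulr_ge0// invr_ge0 ltW.
rewrite -(ler_pM2l b20) mulrDr; move: h1; rewrite e1 => h1.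
by rewrite -lerBlDl; exact: le_trans h1 e2.
Qed.

End stein_bound.

(** From [x / p <= expR (x / p - 1)], raised to the power [p]. The sharp constant has Euler's number
    in place of 2; the weaker base 2 suits the later comparison with powers of 2. *)
Lemma powR_le_expR (R : realType) (x p : R) : 0 <= x -> 0 < p ->
  x `^ p <= (p / 2) `^ p * expR x.
Proof.
move=> x0 p0.
have e2 : 2 <= expR (1 : R) by have := expR_ge1Dx (1 : R); lra.
have xp : x <= p / 2 * expR (x / p).
  have h : x / p <= expR (x / p - 1) by have := expR_ge1Dx (x / p - 1); lra.
  have e0 := expR_ge0 (x / p - 1).
  rewrite [in leRHS](_ : x / p = 1 + (x / p - 1)); last by ring.
  rewrite expRD; apply: (@le_trans _ _ (p / 2 * (2 * expR (x / p - 1)))).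
    rewrite mulrA divfK ?pnatr_eq0//.
    by rewrite -ler_pdivrMl// mulrC.
  by rewrite ler_wpM2l ?divr_ge0 ?(ltW p0)// ler_wpM2r.
rewrite (_ : expR x = expR (x / p) `^ p); last first.
  by rewrite -expRM divfK// gt_eqF.
rewrite -powRM ?expR_ge0 ?divr_ge0 ?(ltW p0)//.
by rewrite ge0_ler_powR ?nnegrE ?(ltW p0)// mulr_ge0 ?expR_ge0 ?divr_ge0 ?(ltW p0).
Qed.

Lemma expR_weighted3 (R : realType) (a b c u v w : R) : 0 <= a -> 0 <= b -> 0 <= c ->
  a + b + c = 1 -> expR (a * u + b * v + c * w) <= a * expR u + b * expR v + c * expR w.
Proof.
move=> a0 b0 c0 abc; set m := a * u + b * v + c * w.
have h y : expR m * (1 + (y - m)) <= expR y.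
  rewrite [in leRHS](_ : y = m + (y - m)); last by ring.
  by rewrite (expRD m (y - m)) ler_wpM2l ?expR_ge0 ?expR_ge1Dx.
have hu := ler_wpM2l a0 (h u); have hv := ler_wpM2l b0 (h v).
have hw := ler_wpM2l c0 (h w).
apply: le_trans (lerD (lerD hu hv) hw).
rewrite (_ : _ + _ + _ = expR m * ((a + b + c) * (1 - m) + m)); last by rewrite /m; ring.
by rewrite abc mul1r subrK mulr1.
Qed.

(** Three-factor Hoelder inequality with weights [a = eta / p], [b = 1 / p], [b], where
    [p = eta + 2]: the product of [|f|^a], [(f^2)^b] and [(|g|^p)^b] is [|f g|]. It is proved
    pointwise by weighted convexity of [expR], each factor being normalised by its bound. *)
Lemma Rintegral_interpolation d (T : measurableType d) (R : realType)
    (m : probability T R) (f g : T -> R) (eta A B K : R) :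
  0 < eta -> square_Rintegrable m f -> measurable_fun setT g ->
  Rintegrable m (fun x => `|g x| `^ (eta + 2)) ->
  0 < A -> 0 < K -> \int[m]_x `|f x| <= A ->
  \int[m]_x (`|g x| `^ (eta + 2)) <= K ->
  B = \int[m]_x f x ^+ 2 -> B = \int[m]_x (f x * g x) ->
  B <= A `^ (eta / (eta + 1)) * K `^ (eta + 1)^-1.
Proof.
move=> eta0 f2 mg ig A0 K0 fA gK BE Bfg.
have B0 : 0 <= B by rewrite BE Rintegral_ge0// => x _; exact: sqr_ge0.
have [->|Bn0] := eqVneq B 0; first by rewrite mulr_ge0// powR_ge0.
have {Bn0}B0 : 0 < B by rewrite lt_neqAle eq_sym Bn0.
set p := eta + 2 in ig gK; have p0 : 0 < p by rewrite /p; lra.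
pose a := eta / p; pose b := p^-1.
have a0 : 0 <= a by rewrite divr_ge0// ltW.
have b0 : 0 <= b by rewrite invr_ge0 ltW.
have ab : a + b + b = 1 by rewrite /a /b /p; field; rewrite gt_eqF.
pose E := expR (a * ln A + b * ln B + b * ln K).
have pw x : `|f x * g x| <= E * (a / A * `|f x| + b / B * f x ^+ 2 +
    b / K * `|g x| `^ p).
  have E0 : 0 <= E by exact: expR_ge0.
  have [fg0|] := eqVneq (f x * g x) 0.
    have h1 : 0 <= a / A * `|f x| by rewrite mulr_ge0// divr_ge0// ltW.
    have h2 : 0 <= b / B * f x ^+ 2 by rewrite mulr_ge0 ?sqr_ge0// divr_ge0// ltW.
    have h3 : 0 <= b / K * `|g x| `^ p by rewrite mulr_ge0 ?powR_ge0// divr_ge0// ltW.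
    by rewrite fg0 normr0 mulr_ge0// !addr_ge0.
  rewrite mulf_eq0 negb_or => /andP[fx gx].
  have fx0 : 0 < `|f x| by rewrite normr_gt0.
  have gx0 : 0 < `|g x| by rewrite normr_gt0.
  have := expR_weighted3 (ln `|f x| - ln A) (2 * ln `|f x| - ln B)
    (p * ln `|g x| - ln K) a0 b0 b0 ab.
  rewrite !expRB (lnK A0) (lnK B0) (lnK K0) lnK ?posrE//.
  have -> : expR (2 * ln `|f x|) = f x ^+ 2.
    by rewrite expRM_natl lnK ?posrE// real_normK// num_real.
  have -> : expR (p * ln `|g x|) = `|g x| `^ p by rewrite /powR gt_eqF.
  have -> : a * (ln `|f x| - ln A) + b * (2 * ln `|f x| - ln B) + b * (p * ln `|g x| - ln K)
    = (ln `|f x| + ln `|g x|) - (a * ln A + b * ln B + b * ln K).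
    have bp : b * p = 1 by rewrite mulVf// gt_eqF.
    transitivity ((a + b + b) * ln `|f x| + (b * p) * ln `|g x| -
      (a * ln A + b * ln B + b * ln K)); first by ring.
    by rewrite ab bp !mul1r.
  rewrite expRB expRD !lnK ?posrE// -/E ler_pdivrMr ?expR_gt0// -normrM.
  move/le_trans; apply; rewrite le_eqVlt; apply/orP; left; apply/eqP.
  by move: (`|g x| `^ p) => y; ring.
have i1 := Rintegrable_norm (square_RintegrableW f2).
have j1 := RintegrableZ (a / A) i1; have j2 := RintegrableZ (b / B) f2.2.
have j3 := RintegrableZ (b / K) ig; have j12 := RintegrableD j1 j2.
have j123 := RintegrableD j12 j3.
have BE2 : B <= E.
  rewrite {1}Bfg; apply: le_trans (ler_norm _) _.
  apply: le_trans (le_norm_Rintegral _ pw (RintegrableZ E j123)) _.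
    by apply: measurable_funM => //; case: f2.
  rewrite (RintegralZ_setT E j123) (RintegralD_setT j12 j3) (RintegralD_setT j1 j2).
  rewrite (RintegralZ_setT _ i1) (RintegralZ_setT _ f2.2) (RintegralZ_setT _ ig) -BE.
  rewrite -[leRHS]mulr1 ler_wpM2l ?expR_ge0// -ab.
  rewrite (divfK (lt0r_neq0 B0)) !lerD//.
    by rewrite mulrAC ler_pdivrMr// ler_wpM2l.
  by rewrite mulrAC ler_pdivrMr// ler_wpM2l.
(* The unknown [B] also stands on the right, with weight [b < 1]; absorbing it leaves the factor
   [1 - b = (eta + 1) b], which yields the final exponents. *)
have lB : ln B <= a * ln A + b * ln B + b * ln K.
  by rewrite -ler_expR lnK.
have pe : (eta + 1) * b = 1 - b by rewrite /b /p; field; rewrite gt_eqF.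
have e1 : 0 < eta + 1 by lra.
have {}lB : ln B <= eta / (eta + 1) * ln A + (eta + 1)^-1 * ln K.
  have bb : 0 < b by rewrite invr_gt0.
  rewrite -(ler_pM2l (_ : 0 < 1 - b)); last by rewrite -pe mulr_gt0.
  rewrite (_ : (1 - b) * (_ + _) = a * ln A + b * ln K); first by move: lB; lra.
  by rewrite -pe /a -/b mulrDr; field; rewrite gt_eqF.
by rewrite /powR !gt_eqF// -expRD -ler_ln ?posrE ?expR_gt0// expRK.
Qed.

(** * Energy bound from the total variation hypothesis *)

Section total_variation_bound.
Context {R : realType} {d : nat} {C : 'M[R]_d}.
Variables (mu gam : probability 'rV[R]_d R).
Hypothesis Cp : posdefmx C.
Hypothesis gamE : forall A, measurable A ->
  gam A = (\int[lebesgue_rV d]_(x in A) (gaussian_pdf C x)%:E)%E.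
Hypothesis mu2 : square_Rintegrable_rV mu (@id 'rV[R]_d).
Hypothesis mu_mean : forall i, \int[mu]_x x 0 i = 0.
Hypothesis mu_cov : forall i j, \int[mu]_x (x 0 i * x 0 j) = C i j.
Let q := bform (invmx C).
Local Notation m := (mu \x gam)%E.
Local Notation Xh := (@posterior_mean _ _ C mu).
Local Notation J := (@posterior_energy _ _ C mu gam).

Variables (kappa alpha eta : R).
Hypotheses (kappa0 : 0 < kappa) (alpha0 : 0 < alpha) (eta0 : 0 < eta).
Hypothesis tv : forall (A : set 'rV[R]_d) (z : 'rV[R]_d) (t : R), measurable A ->
  1 / 2 <= t <= 1 ->
  `|fine (mu ((fun y => Num.sqrt t *: y + Num.sqrt (1 - t) *: z) @^-1` A)) - fine (mu A)|
    <= kappa * (1 + l1_norm z) * (1 - t) `^ alpha.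

Let measurable_Y b : measurable_fun setT (fun p : 'rV[R]_d * 'rV[R]_d => (channel b p).2).
Proof. exact: measurable_shift. Qed.

Let Z2 : square_Rintegrable_rV m (fun p : 'rV[R]_d * 'rV[R]_d => p.2).
Proof. exact: (square_Rintegrable_noise mu Cp gamE). Qed.

(** The 2 is the gap between the values of a sign function, the first [l1_norm z] bounds a
    coordinate of the noise, and the rest is the total variation bound at [z]. *)
Definition noise_weight := 2 * kappa * \int[gam]_z (l1_norm z * (1 + l1_norm z)).

Lemma Rintegrable_noise_weight : Rintegrable gam (fun z => l1_norm z * (1 + l1_norm z)).
Proof.
have ml : measurable_fun setT (@l1_norm R d) by exact: measurable_l1_norm.
apply: (@Rintegrable_l1_bound _ _ _ _ Cp gamE _ 1 2) => //.
  by apply: measurable_funM => //; exact: measurable_funD.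
move=> z; have l0 := l1_norm_ge0 z; have := le_l1_expR z => l1.
rewrite mul1r expRM_natl expr2 ger0_norm ?mulr_ge0 ?addr_ge0//.
by rewrite ler_pM ?addr_ge0//; lra.
Qed.

Lemma le_diag_noise_weight j : 2 * kappa * C j j <= noise_weight.
Proof.
rewrite /noise_weight ler_wpM2l ?mulr_ge0 ?(ltW kappa0)//.
rewrite -(gaussian_covariance Cp gamE); apply: le_Rintegral_setT.
- exact: square_RintegrableM (square_Rintegrable_coord Cp gamE j) (square_Rintegrable_coord Cp gamE j).
- exact: Rintegrable_noise_weight.
- move=> z; have l0 := l1_norm_ge0 z; have lj := le_coord_l1_norm z j.
  rewrite -expr2 -(real_normK (num_real (z 0 j))) expr2.
  by rewrite ler_pM//; lra.
Qed.

Lemma posdefmx_diag_gt0 j : 0 < C j j.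
Proof.
have e0 : (delta_mx 0 j : 'rV[R]_d) != 0.
  apply/eqP => /rowP /(_ j); rewrite !mxE !eqxx/= => /eqP; rewrite oner_eq0//.
by have := proj2 Cp _ e0; rewrite -rowE trmx_delta -colE !mxE.
Qed.

Lemma noise_weight_gt0 (j : 'I_d) : 0 < noise_weight.
Proof.
apply: lt_le_trans (le_diag_noise_weight j).
by rewrite !mulr_gt0// posdefmx_diag_gt0.
Qed.

Lemma Rintegral_coord_powR j (p : R) : 0 < p ->
  Rintegrable gam (fun z => `|z 0 j| `^ p).
Proof.
move=> p0; apply: (@Rintegrable_l1_bound _ _ _ _ Cp gamE _ ((p / 2) `^ p) 1) => //.
  apply: (measurableT_comp (measurable_powR p)); apply: measurableT_comp => //.
  exact: measurable_coord.
move=> z; rewrite ger0_norm ?powR_ge0// mul1r.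
apply: le_trans (powR_le_expR _ p0) _ => //.
by rewrite ler_wpM2l ?powR_ge0// ler_expR le_coord_l1_norm.
Qed.

(** Values below [r] contribute at most [r^2], half the variance, so the other half is carried by
    larger values and is controlled by the moment. *)
Lemma noise_moment_gt0 j : 0 < \int[gam]_z (`|z 0 j| `^ (eta + 2)).
Proof.
have c0 := posdefmx_diag_gt0 j; set c := C j j in c0.
pose r := Num.sqrt (c / 2); have r0 : 0 < r by rewrite sqrtr_gt0 divr_gt0.
have r2 : r ^+ 2 = c / 2 by rewrite sqr_sqrtr// divr_ge0// ltW.
have p0 : 0 < eta + 2 by rewrite addr_gt0.
have ip := Rintegral_coord_powR j p0.
have rp : 0 < r `^ eta by rewrite powR_gt0.
have iz := square_Rintegrable_coord Cp gamE j.
have ir := RintegrableZ (r `^ eta)^-1 ip.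
have : \int[gam]_z (z 0 j * z 0 j) <=
    \int[gam]_z (r ^+ 2 + (r `^ eta)^-1 * `|z 0 j| `^ (eta + 2)).
  apply: le_Rintegral_setT; first exact: (square_RintegrableM iz iz).
    by apply: RintegrableD ir; exact: Rintegrable_cst.
  move=> z; rewrite -expr2 -(real_normK (num_real (z 0 j))).
  have [zr|zr] := leP `|z 0 j| r.
    apply: ler_wpDr; first by rewrite mulr_ge0 ?powR_ge0// invr_ge0 ltW.
    by rewrite lerXn2r ?nnegrE// ltW.
  have z0 : 0 < `|z 0 j| by exact: lt_trans zr.
  apply: ler_wpDl; first exact: sqr_ge0.
  rewrite powRD ?(gt_eqF z0) ?implybT// powR_mulrn// mulrA -[leLHS]mul1r.
  rewrite ler_wpM2r ?sqr_ge0// mulrC ler_pdivlMr// mul1r.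
  by rewrite ge0_ler_powR ?nnegrE ?ltW// ltW.
rewrite (gaussian_covariance Cp gamE) -/c RintegralD_setT//; last exact: Rintegrable_cst.
rewrite Rintegral_cst1 RintegralZ_setT// r2 => h.
have h2 : 0 < (r `^ eta)^-1 * \int[gam]_z `|z 0 j| `^ (eta + 2) by lra.
by move: h2; rewrite pmulr_rgt0// invr_gt0.
Qed.

(** Since the noise is the observation minus [b] times the signal, this is the conditional
    expectation of the [j]-th noise coordinate. *)
Let W b j (y : 'rV[R]_d) := y 0 j - b * Xh b y 0 j.

Let measurable_W b j : measurable_fun setT (W b j).
Proof.
apply: measurable_funB; first exact: measurable_coord.
apply: measurable_funM => //.
exact: (measurable_posterior_mean Cp gamE mu2 mu_mean mu_cov).
Qed.

Let square_Rintegrable_W b j : square_Rintegrable m (fun p => W b j (channel b p).2).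
Proof.
apply: square_RintegrableB; last apply: square_RintegrableZ.
  exact: (square_Rintegrable_observation Cp gamE mu2).
exact: (square_Rintegrable_posterior_mean Cp gamE mu2 mu_mean mu_cov).
Qed.

Let W_duality b j (psi : 'rV[R]_d -> R) : measurable_fun setT psi ->
  square_Rintegrable m (fun p => psi (channel b p).2) ->
  \int[m]_p (psi (channel b p).2 * W b j (channel b p).2) =
  \int[m]_p (psi (channel b p).2 * p.2 0 j).
Proof.
move=> mpsi psi2.
have F2 := square_Rintegrable_signal gam mu2.
have Y2 := square_Rintegrable_observation Cp gamE mu2 b.
have Xh2 := square_Rintegrable_posterior_mean Cp gamE mu2 mu_mean mu_cov b.
have iF := square_RintegrableM psi2 (F2 j).
have iY := square_RintegrableM psi2 (Y2 j).
have iX := square_RintegrableM psi2 (Xh2 j).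
have e := posterior_meanP Cp gamE mu2 mu_mean mu_cov j mpsi psi2.
transitivity (\int[m]_p (psi (channel b p).2 * (channel b p).2 0 j -
    b * (psi (channel b p).2 * Xh b (channel b p).2 0 j))).
  by apply: eq_Rintegral_setT => p; rewrite /W; ring.
rewrite (RintegralB_setT iY (RintegrableZ b iX)) (RintegralZ_setT b iX) -e.
rewrite -(RintegralZ_setT b iF) -(RintegralB_setT iY (RintegrableZ b iF)).
by apply: eq_Rintegral_setT => p; rewrite /channel/= !mxE; ring.
Qed.

Lemma Rintegral_indic_fine (B : set 'rV[R]_d) : measurable B ->
  Rintegrable mu (fun x => \1_B x : R) /\ \int[mu]_x \1_B x = fine (mu B).
Proof.
move=> mB; split; first exact: integrable_indic.
by rewrite /Rintegral integral_indic// setIT.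
Qed.

(** Tested against its sign [psi], the norm of [W] becomes the mean of [psi] times the noise
    coordinate. For a fixed noise value [z], the mean of [psi] over the signal is the probability of
    an event for [F] contracted and shifted along [z], which depends little on [z]. *)
Lemma W_L1_le b j : 1 <= b ->
  \int[m]_p `|W b j (channel b p).2| <= noise_weight * (1 + b ^+ 2)^-1 `^ alpha.
Proof.
move=> b1; set w := 1 + b ^+ 2.
have b21 : 1 <= b ^+ 2 by rewrite -(expr1n _ 2%N) lerXn2r ?nnegrE// (le_trans ler01).
have w0 : 0 < w by rewrite /w; lra.
pose t := b ^+ 2 / w; have t1 : 1 - t = w^-1 by rewrite /t /w; field; rewrite gt_eqF.
have t12 : 1 / 2 <= t <= 1.
  rewrite /t; apply/andP; split; first by rewrite ler_pdivlMr// /w; lra.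
  by rewrite ler_pdivrMr// /w; lra.
have mW := measurable_W b j.
have [B mB BE] : exists2 B : set 'rV[R]_d, measurable B &
    forall y, (y \in B) = (0 <= W b j y).
  exists (W b j @^-1` `[0, +oo[%classic).
    by rewrite -[X in measurable X]setTI; exact: mW.
  by move=> y; apply/idP/idP => [/set_mem|h]; [|apply/mem_set];
    rewrite /= in_itv/= andbT.
pose psi y : R := 2 * \1_B y - 1.
have mpsi : measurable_fun setT psi.
  by apply: measurable_funB => //; apply: measurable_funM => //; exact: measurable_indic.
have psiE y : psi y = if 0 <= W b j y then 1 else -1.
  rewrite /psi indicE BE; case: (0 <= W b j y) => /=; first by rewrite mulr1; ring.
  by rewrite mulr0 sub0r.
have psi1 y : `|psi y| <= 1.
  by rewrite psiE; case: ifP => _; rewrite ?normrN normr1.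
have psiW y : psi y * W b j y = `|W b j y|.
  rewrite psiE; case: ifPn => h; first by rewrite mul1r ger0_norm.
  by rewrite mulN1r ltr0_norm// ltNge.
have psi2 : square_Rintegrable m (fun p => psi (channel b p).2).
  apply: (@square_Rintegrable_bounded _ _ _ _ _ 1).
    exact: (measurableT_comp mpsi (measurable_Y b)).
  by move=> p; exact: psi1.
have -> : \int[m]_p `|W b j (channel b p).2| =
    \int[m]_p (psi (channel b p).2 * p.2 0 j).
  by rewrite -W_duality//; apply: eq_Rintegral_setT => p; rewrite psiW.
(* Rescaled so that [z + b *: x] lies in [B] exactly when [sqrt t x + sqrt (1 - t) z] lies in [A],
   the form required by the hypothesis. *)
pose A := [set y : 'rV[R]_d | B (Num.sqrt w *: y)].
have mA : measurable A.
  rewrite -[X in measurable X]setTI.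
  have := measurable_rV_affine (Num.sqrt w) (0 : 'rV[R]_d).
  by under eq_fun do rewrite addr0; move/(_ measurableT B mB).
pose T z := (fun y : 'rV[R]_d => Num.sqrt t *: y + Num.sqrt (1 - t) *: z) @^-1` A.
have mT z : measurable (T z).
  rewrite -[X in measurable X]setTI.
  exact: (measurable_rV_affine (Num.sqrt t) (Num.sqrt (1 - t) *: z) measurableT mA).
have b0 : 0 <= b by lra.
have pt (z x : 'rV[R]_d) :
    Num.sqrt w *: (Num.sqrt t *: x + Num.sqrt (1 - t) *: z) = z + b *: x.
  rewrite addrC scalerDr !scalerA t1 sqrtrV ?ltW// divff ?gt_eqF ?sqrtr_gt0//.
  rewrite scale1r -sqrtrM ?ltW// /t mulrC divfK ?gt_eqF// sqrtr_sqr ger0_norm//.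
have psiT z x : psi (z + b *: x) = 2 * \1_(T z) x - 1.
  by rewrite -(pt z x) /psi !indicE; congr (2 * _%:R - 1); congr nat_of_bool.
have i1 := square_RintegrableM psi2 (Z2 j).
have s1 z : Rintegrable mu (fun x => psi (z + b *: x) * z 0 j).
  have h := (Rintegral_indic_fine (mT z)).1.
  have := RintegrableZ (z 0 j) (RintegrableB (RintegrableZ 2 h) (Rintegrable_cst mu 1)).
  by congr Rintegrable; apply/funext => x; rewrite psiT mulrC.
have e1 z : \int[mu]_x (psi (z + b *: x) * z 0 j) = z 0 j * (2 * fine (mu (T z)) - 1).
  have [h h'] := Rintegral_indic_fine (mT z).
  have h2 := RintegrableZ 2 h.
  rewrite -h' -(RintegralZ_setT 2 h) -[X in _ - X](Rintegral_cst1 mu).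
  rewrite -(RintegralB_setT h2 (Rintegrable_cst mu 1)) -RintegralZ_setT.
    by apply: eq_Rintegral_setT => x; rewrite psiT mulrC.
  exact: RintegrableB h2 (Rintegrable_cst mu 1).
have [k1 ->] := Rintegral_fubini21 i1 s1.
have k2 : Rintegrable gam (fun z => z 0 j * (2 * fine (mu (T z)) - 1)).
  by apply: eq_Rintegrable k1.
apply: (@le_trans _ _ (\int[gam]_z (z 0 j * (2 * fine (mu (T z)) - 1)))).
  by rewrite le_eqVlt; apply/orP; left; apply/eqP; apply: eq_Rintegral_setT => z; exact: e1.
have iz := square_RintegrableW (square_Rintegrable_coord Cp gamE j).
have iz' := RintegrableZ (2 * fine (mu A) - 1) iz.
(* The noise is centred, so a constant may be subtracted from its factor; taking the value for the
   unperturbed law brings in the total variation distance. *)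
have -> : \int[gam]_z (z 0 j * (2 * fine (mu (T z)) - 1)) =
    \int[gam]_z (z 0 j * (2 * fine (mu (T z)) - 1) - (2 * fine (mu A) - 1) * z 0 j).
  by rewrite (RintegralB_setT k2 iz') (RintegralZ_setT _ iz) (gaussian_mean Cp gamE) mulr0 subr0.
have iw := RintegrableZ (2 * kappa * w^-1 `^ alpha) Rintegrable_noise_weight.
rewrite (_ : noise_weight * _ = 2 * kappa * w^-1 `^ alpha *
    \int[gam]_z (l1_norm z * (1 + l1_norm z))); last by rewrite /noise_weight; ring.
rewrite -(RintegralZ_setT _ Rintegrable_noise_weight).
apply: le_Rintegral_setT iw _; first exact: RintegrableB k2 iz'.
move=> z; apply: le_trans (ler_norm _) _.
rewrite (_ : _ - _ = 2 * z 0 j * (fine (mu (T z)) - fine (mu A))); last by ring.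
rewrite !normrM (ger0_norm (_ : 0 <= 2 :> R))//.
have := tv z mA t12; rewrite -/(T z) t1 => tvz.
have l0 := l1_norm_ge0 z.
rewrite (_ : 2 * kappa * _ * _ = 2 * l1_norm z * (kappa * (1 + l1_norm z) * w^-1 `^ alpha));
  last by move: (_ `^ _) => y; ring.
apply: ler_pM; [by rewrite mulr_ge0|exact: normr_ge0| |exact: tvz].
by rewrite ler_wpM2l ?le_coord_l1_norm.
Qed.

(** Interpolation with [f = W] and [g] the noise coordinate applies because, by conditioning, the
    mean of [W^2] is also that of [W] times the noise. *)
Lemma posterior_energy_tv (lam : R) b : 1 <= b -> 0 <= lam ->
  (forall x : 'rV[R]_d, q x x <= lam * \sum_i x 0 i ^+ 2) ->
  J b <= d%:R * (1 - (1 + b ^+ 2)^-1) + (1 + b ^+ 2)^-1 * (lam *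
    \sum_j (noise_weight * (1 + b ^+ 2)^-1 `^ alpha) `^ (eta / (eta + 1)) *
      (\int[gam]_z (`|z 0 j| `^ (eta + 2))) `^ (eta + 1)^-1).
Proof.
move=> b1 lam0 lamP; set w := 1 + b ^+ 2.
have w0 : 0 < w by rewrite ltr_pwDl// sqr_ge0.
have p0 : 0 < eta + 2 by rewrite addr_gt0.
have [V2 eV] := residual_energy Cp gamE mu2 mu_mean mu_cov b 1.
set V := fun p => _ in V2 eV.
have VE p j : V p 0 j = W b j (channel b p).2 by rewrite /V /W !mxE mul1r.
set S := \sum_j _.
have h1 : \int[m]_p q (V p) (V p) <= lam * S.
  have [iq _] := Rintegral_bform (invmx C) V2 V2.
  have isum : Rintegrable m (fun p => \sum_j V p 0 j ^+ 2).
    by apply: Rintegrable_sum => j; exact: (V2 j).2.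
  apply: (@le_trans _ _ (\int[m]_p (lam * \sum_j V p 0 j ^+ 2))).
    by apply: (le_Rintegral_setT iq (RintegrableZ lam isum)) => p; exact: lamP.
  rewrite (RintegralZ_setT lam isum) ler_wpM2l// Rintegral_sum; last by move=> j; exact: (V2 j).2.
  apply: ler_sum => j _.
  have W2 := square_Rintegrable_W b j.
  apply: (@le_trans _ _ (\int[m]_p W b j (channel b p).2 ^+ 2)).
    by rewrite le_eqVlt; apply/orP; left; apply/eqP; apply: eq_Rintegral_setT => p; rewrite VE.
  have [ig eg] := Rintegral_snd mu (Rintegral_coord_powR j p0).
  apply: (Rintegral_interpolation eta0 W2 (Z2 j).1 ig).
  - apply: mulr_gt0; first exact: (noise_weight_gt0 j).
    by apply: powR_gt0; rewrite invr_gt0; exact: w0.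
  - exact: noise_moment_gt0.
  - exact: W_L1_le.
  - by rewrite eg.
  - by [].
  - rewrite -(W_duality j (measurable_W b j) W2).
    by apply: eq_Rintegral_setT => p; rewrite expr2.
have := posterior_energy_le Cp gamE mu2 mu_mean mu_cov b.
move: h1; rewrite eV -/w; move: (J b) => u h1 ud.
have h2 : w^-1 * (w * d%:R - 2 * b ^+ 2 * d%:R + b ^+ 2 * u) <= w^-1 * (lam * S).
  by rewrite ler_pM2l ?invr_gt0//; move: h1; rewrite expr1n mul1r mulr1.
apply: le_trans (lerD (lexx (d%:R * (1 - w^-1))) h2).
(* With [r = 1] the residual energy does not isolate the excess of [J]; the leftover is
   [(d - J) / w], whose sign is favourable. *)
rewrite -subr_ge0 (_ : _ - _ = w^-1 * (d%:R - u)).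
  by rewrite mulr_ge0 ?invr_ge0 ?(ltW w0)// subr_ge0.
by rewrite /w; field; rewrite gt_eqF.
Qed.

End total_variation_bound.

(** * Integration along the channel and duality *)

Section riemann_sum.
Context {R : realType}.
Implicit Types (f g : R -> R) (x y b c K : R).

(* Riemann sums: errors of second order in the step vanish under refinement. *)
Lemma increment_le_quadratic f g b c K : b <= c -> 0 <= K ->
  (forall x y, b <= x -> x <= y -> y <= c -> f y - f x <= g y - g x + K * (y - x) ^+ 2) ->
  f c - f b <= g c - g b.
Proof.
move=> bc K0 fg; apply/ler_addgt0Pl => e e0.
set L := K * (c - b) ^+ 2; have L0 : 0 <= L by rewrite mulr_ge0 ?sqr_ge0.
pose N := (Num.truncn (L / e)).+1.
have N0 : 0 < N%:R :> R by rewrite ltr0n.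
have LN : L / N%:R <= e.
  rewrite ler_pdivrMr// mulrC -ler_pdivrMr//; apply/ltW.
  by rewrite /N; apply: truncnS_gt.
pose h := (c - b) / N%:R; have h0 : 0 <= h by rewrite divr_ge0 ?subr_ge0// ltW.
have hN : N%:R * h = c - b by rewrite /h mulrC divfK// gt_eqF.
have H n : (n <= N)%N -> f (b + n%:R * h) - f b <= g (b + n%:R * h) - g b + n%:R * (K * h ^+ 2).
  elim: n => [|n IH] nN; first by rewrite !mul0r addr0 !subrr addr0.
  have {}IH := IH (ltnW nN).
  have x1 : b <= b + n%:R * h by rewrite lerDl mulr_ge0.
  have x2 : b + n%:R * h <= b + n.+1%:R * h by rewrite lerD2l ler_wpM2r// ler_nat.
  have x3 : b + n.+1%:R * h <= c.
    by rewrite -lerBrDl -hN ler_wpM2r// ler_nat.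
  have := fg _ _ x1 x2 x3.
  rewrite (_ : b + n.+1%:R * h - (b + n%:R * h) = h); last by rewrite -natr1; ring.
  have -> : n.+1%:R * (K * h ^+ 2) = n%:R * (K * h ^+ 2) + K * h ^+ 2.
    by rewrite -natr1 mulrDl mul1r.
  move: (f _) (f _) (g _) (g _) IH => u1 u2 v1 v2; lra.
have := H N (leqnn N); rewrite hN (_ : b + (c - b) = c); last by ring.
have -> : N%:R * (K * h ^+ 2) = L / N%:R.
  by rewrite /h /L; field; rewrite gt_eqF.
by move: LN; lra.
Qed.

End riemann_sum.

(** * From energy bounds to entropy bounds *)

Section entropy_integration.
Context {R : realType}.
Variables (phi J : R -> R) (d : R).
Hypothesis d0 : 0 <= d.
Hypothesis phi_step : forall b c, 0 <= c -> phi c - phi b <= (c - b) * c * J c.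
Hypothesis J_le : forall b, J b <= d.

(* The relative entropy of [(Z + b *: F) / sqrt (1 + b ^+ 2)] with respect to
   [Z]: the last two terms account for the rescaling. *)
Definition channel_entropy b := phi b - b ^+ 2 * d / 2 + d / 2 * ln (1 + b ^+ 2).
Local Notation e := channel_entropy.

Lemma ln_ratio_le (w w' : R) : 0 < w -> 0 < w' -> ln w' - ln w <= (w' - w) / w.
Proof.
move=> w0 w'0; rewrite mulrBl divff ?gt_eqF//.
have := expR_ge1Dx (ln w' - ln w); rewrite expRB !lnK ?posrE//; lra.
Qed.

(** [zeta] bounds the excess energy over the Gaussian value and [Xi] plays the role of its primitive
    in the variable [1 + b^2]. Up to errors of second order in the step, the Gaussian part cancels
    against the two rescaling terms of [e]. *)
Lemma channel_entropy_le (zeta Xi : R -> R) b c : 0 <= b -> b <= c ->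
  (forall x, b <= x -> 0 < x -> x <= c ->
    J x <= d * (1 - (1 + x ^+ 2)^-1) + zeta (1 + x ^+ 2)) ->
  (forall w w', 1 <= w -> w <= w' -> zeta w' * (w' - w) <= Xi w' - Xi w) ->
  e c - e b <= (Xi (1 + c ^+ 2) - Xi (1 + b ^+ 2)) / 2.
Proof.
move=> b0 bc JP zX.
have c0 : 0 <= c by exact: le_trans bc.
have K0 : 0 <= d / 2 * (1 + 4 * c ^+ 2).
  by rewrite mulr_ge0 ?divr_ge0// addr_ge0// mulr_ge0// sqr_ge0.
suff h : e c - e b <= Xi (1 + c ^+ 2) / 2 - Xi (1 + b ^+ 2) / 2.
  by rewrite mulrBl.
apply: (@increment_le_quadratic _ e (fun x => Xi (1 + x ^+ 2) / 2) b c _ bc K0).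
move=> x y bx xy yc.
have [->|yx] := eqVneq y x; first by rewrite !subrr expr0n/= mulr0 addr0.
have {}xy : x < y by rewrite lt_neqAle eq_sym yx.
have x0 : 0 <= x by exact: le_trans bx.
have y0 : 0 < y by exact: le_lt_trans xy.
have by' : b <= y by exact: le_trans bx (ltW xy).
have Jy := JP y by' y0 yc.
set w := 1 + x ^+ 2; set w' := 1 + y ^+ 2.
have w1 : 1 <= w by rewrite lerDl sqr_ge0.
have ww' : w <= w' by rewrite lerD2l lerXn2r ?nnegrE// ltW.
have w0 : 0 < w by exact: lt_le_trans w1.
have w'0 : 0 < w' by exact: lt_le_trans ww'.
have hz := zX w w' w1 ww'.
have hl := ln_ratio_le w0 w'0.
have hs := phi_step x (ltW y0).
have hw : w' - w <= 2 * c * (y - x).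
  rewrite /w /w' (_ : _ - _ = (x + y) * (y - x)); last by ring.
  by rewrite ler_wpM2r ?subr_ge0 ?ltW//; lra.
(* The logarithm is linearised at the left end and the energy bound is taken at the right end; the
   mismatch is of second order. *)
have hi : w^-1 - w'^-1 <= w' - w.
  rewrite (_ : _ - _ = (w' - w) / (w * w')); last by field; rewrite !gt_eqF.
  rewrite ler_piMr ?subr_ge0// invf_le1 ?mulr_gt0// -[leLHS](mulr1 1).
  by rewrite ler_pM//; apply: le_trans ww'.
rewrite /e -/w -/w'.
(* Passage from the variable [b] to [w = 1 + b^2], again up to a second-order term. *)
have hyx : (y - x) * y = (w' - w) / 2 + (y - x) ^+ 2 / 2 by rewrite /w /w'; field.
have hJ1 : (w' - w) / 2 * J y <= (w' - w) / 2 * (d * (1 - w'^-1) + zeta w').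
  by rewrite ler_wpM2l// divr_ge0 ?subr_ge0.
have hJ2 : (y - x) ^+ 2 / 2 * J y <= (y - x) ^+ 2 / 2 * d.
  by rewrite ler_wpM2l// divr_ge0 ?sqr_ge0.
have hd : d / 2 * (ln w' - ln w) <= d / 2 * ((w' - w) / w).
  by rewrite ler_wpM2l// divr_ge0.
have hq : d / 2 * ((w' - w) * (w^-1 - w'^-1)) <= d / 2 * (4 * c ^+ 2 * (y - x) ^+ 2).
  rewrite ler_wpM2l ?divr_ge0//.
  apply: (@le_trans _ _ ((w' - w) * (w' - w))); first by rewrite ler_wpM2l ?subr_ge0.
  rewrite (_ : 4 * _ * _ = (2 * c * (y - x)) * (2 * c * (y - x))); last by ring.
  by rewrite ler_pM ?subr_ge0.
have ey2 : y ^+ 2 = x ^+ 2 + (w' - w) by rewrite /w /w'; ring.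
rewrite ey2.
move: hs; rewrite hyx mulrDl => hs.
set A := w' - w in hJ1 hJ2 hd hq hs hz *.
have r1 : d / 2 * (A / w) = d / 2 * (A * (w^-1 - w'^-1)) + A / 2 * (d / w') by field; rewrite !gt_eqF.
rewrite r1 in hd.
have r2 : A / 2 * (d * (1 - w'^-1) + zeta w') = A / 2 * d - A / 2 * (d / w') + zeta w' * A / 2.
  by field; rewrite gt_eqF.
rewrite r2 in hJ1.
have r3 : d / 2 * (ln w' - ln w) = d / 2 * ln w' - d / 2 * ln w by rewrite mulrBr.
rewrite r3 in hd.
rewrite (_ : d / 2 * (1 + 4 * c ^+ 2) * (y - x) ^+ 2 =
   (y - x) ^+ 2 / 2 * d + d / 2 * (4 * c ^+ 2 * (y - x) ^+ 2)); last by field.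
move: (d / 2 * ln w') (d / 2 * ln w) (phi y) (phi x) hs hd => v1 v2 p1 p2 hs hd.
move: (A / 2 * (d / w')) (zeta w') hJ1 hd hz => v3 z hJ1 hd hz.
move: (d / 2 * (A * _)) (d / 2 * (4 * _ * _)) hq hd => v4 v5 hq hd.
move: (A / 2 * J y) ((y - x) ^+ 2 / 2 * J y) ((y - x) ^+ 2 / 2 * d) hs hJ1 hJ2.
move=> a1 a2 a3 hs hJ1 hJ2.
move: (Xi w) (Xi w') hz => x1 x2 hz.
rewrite (_ : (x ^+ 2 + A) * d / 2 = x ^+ 2 * d / 2 + A / 2 * d); last by field.
move: (x ^+ 2 * d / 2) (A / 2 * d) hJ1 => a4 a5 hJ1.
rewrite -[z * A / 2]mulrC in hJ1.
move: (z * A) hz hJ1 => zA hz hJ1.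
lra.
Qed.

(** Convexity of the power with exponent [- beta], in tangent form at the right end, where
    [channel_entropy_le] evaluates the integrand. *)
Lemma powR_tangent (beta w w' : R) : 0 < beta -> 0 < w -> w <= w' ->
  beta * (w' `^ (- beta) / w') * (w' - w) <= w `^ (- beta) - w' `^ (- beta).
Proof.
move=> be0 w0 ww'; have w'0 : 0 < w' by exact: lt_le_trans ww'.
have -> : w `^ (- beta) = w' `^ (- beta) * expR (beta * (ln w' - ln w)).
  by rewrite /powR !gt_eqF// -expRD; congr expR; ring.
have P0 : 0 <= w' `^ (- beta) by exact: powR_ge0.
have h1 := expR_ge1Dx (beta * (ln w' - ln w)).
have h2 := ln_ratio_le w'0 w0.
have h3 : beta * ((w' - w) / w') <= beta * (ln w' - ln w).
  rewrite ler_pM2l//; rewrite -opprB -[leRHS]opprB mulNr lerN2; exact: h2.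
move: (w' `^ _) P0 => P P0.
rewrite (_ : _ * _ * _ = P * (beta * ((w' - w) / w'))); last by ring.
rewrite (_ : P * expR _ - P = P * (expR (beta * (ln w' - ln w)) - 1)); last by ring.
by rewrite ler_wpM2l//; move: h1 h3; lra.
Qed.

Variables (L1 L2 beta : R).
Hypotheses (L10 : 0 <= L1) (L20 : 0 <= L2) (beta0 : 0 < beta).
Hypothesis phi0 : phi 0 = 0.
Hypothesis J1 : forall b, 0 < b -> J b <= d * (1 - (1 + b ^+ 2)^-1) + L1 / (1 + b ^+ 2).
Hypothesis J2 : forall b, 1 <= b ->
  J b <= d * (1 - (1 + b ^+ 2)^-1) + L2 * ((1 + b ^+ 2) `^ (- beta) / (1 + b ^+ 2)).

Lemma channel_entropy_le1 c : 0 <= c -> e c <= L1 * ln (1 + c ^+ 2) / 2.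
Proof.
move=> c0.
have e0 : e 0 = 0 by rewrite /e phi0 expr0n/= !mul0r addr0 ln1 mulr0 subr0 addr0.
have := @channel_entropy_le (fun w => L1 / w) (fun w => L1 * ln w) 0 c (lexx 0) c0.
rewrite e0 subr0 expr0n/= addr0 ln1 mulr0 subr0; apply.
  by move=> x _ x0 _; exact: J1.
move=> w w' w1 ww'; have w0 : 0 < w by exact: lt_le_trans w1.
have w'0 : 0 < w' by exact: lt_le_trans ww'.
rewrite -mulrBr -mulrA ler_wpM2l//.
have := ln_ratio_le w'0 w0.
by rewrite (_ : (w - w') / w' = - (w'^-1 * (w' - w))); [lra|ring].
Qed.

(** The first regime is used up to [b] and the second beyond. The latter has an integrable tail, so
    the contribution at [c] is dropped and the bound is uniform in [c]. *)
Lemma channel_entropy_le2 b c : 1 <= b -> b <= c ->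
  e c <= (L1 * ln (1 + b ^+ 2) + L2 / beta * (1 + b ^+ 2) `^ (- beta)) / 2.
Proof.
move=> b1 bc; have b0 : 0 <= b by exact: le_trans b1.
have h1 := channel_entropy_le1 b0.
have h := @channel_entropy_le (fun w => L2 * (w `^ (- beta) / w))
  (fun w => - (L2 / beta * w `^ (- beta))) b c b0 bc.
have {}h : e c - e b <= (- (L2 / beta * (1 + c ^+ 2) `^ (- beta)) -
    - (L2 / beta * (1 + b ^+ 2) `^ (- beta))) / 2.
  apply: h.
    by move=> x bx _ _; apply: J2; exact: le_trans bx.
  move=> w w' w1 ww'; have w0 : 0 < w by exact: lt_le_trans w1.
  have := powR_tangent beta0 w0 ww'.
  move: (w `^ _) (w' `^ _) => P P' hP.
  rewrite (_ : - _ - - _ = L2 / beta * (P - P')); last by ring.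
  rewrite (_ : _ * _ * _ = L2 / beta * (beta * (P' / w') * (w' - w))).
    by rewrite ler_wpM2l// divr_ge0// ltW.
  by field; rewrite !gt_eqF//; exact: lt_le_trans ww'.
have h3 : 0 <= L2 / beta * (1 + c ^+ 2) `^ (- beta).
  by rewrite mulr_ge0 ?powR_ge0// divr_ge0// ltW.
by move: (_ * (1 + c ^+ 2) `^ _) (_ * (1 + b ^+ 2) `^ _) (L1 * ln _) h h1 h3 => u v w; lra.
Qed.

End entropy_integration.

(** * Integrals of bounded functions under total variation *)

Section bounded_total_variation.
Context {R : realType}.

(** A staircase above [y], exact up to one step [e] as long as [y] does not exceed [N e]. Composed
    with a function it is a combination of indicators of level sets. *)
Let layers (e y : R) N : R := \sum_(k < N) e * ((k%:R * e < y)%R%:R : R).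

Lemma layers_bounds e y N : 0 <= e -> 0 <= y ->
  Num.min y (N%:R * e) <= layers e y N <= y + e /\ layers e y N <= N%:R * e.
Proof.
move=> e0 y0; elim: N => [|N [/andP[IH1 IH2] IH3]].
  by rewrite /layers big_ord0 mul0r ge_min lexx orbT addr_ge0.
rewrite /layers big_ord_recr/= -/(layers e y N); move: (layers e y N) IH1 IH2 IH3 => S.
have -> : N.+1%:R * e = N%:R * e + e by rewrite -natr1 mulrDl mul1r.
have [hy|hy] := ltP (N%:R * e) y => /=.
  rewrite mulr1 ge_min => IH1 IH2 IH3.
  by split; last lra; apply/andP; split; [apply/orP; right; lra|lra].
rewrite mulr0 addr0 => IH1 IH2 IH3.
by rewrite ge_min IH1 IH2/=; split => //; lra.
Qed.

(** Layer-cake argument: [g + K] takes values in an interval of length [2 K], cut into [N] layers of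
    height [h]. Each layer costs at most [h e], and the rounding error [h] is arbitrarily small. *)
Lemma Rintegral_tv_le d1 d2 (T : measurableType d1) (T' : measurableType d2)
    (m : probability T R) (X Y : T -> T') (g : T' -> R) (e K : R) :
  measurable_fun setT X -> measurable_fun setT Y ->
  (forall A, measurable A -> `|fine (m (X @^-1` A)) - fine (m (Y @^-1` A))| <= e) ->
  measurable_fun setT g -> (forall x, `|g x| <= K) ->
  \int[m]_x g (X x) <= \int[m]_x g (Y x) + 2 * K * e.
Proof.
move=> mX mY XY mg gK.
have K0 : 0 <= K by exact: le_trans (gK point).
have iX : Rintegrable m (fun x => g (X x)).
  apply: Rintegrable_le (Rintegrable_cst m K) => //; exact: measurableT_comp mg mX.
have iY : Rintegrable m (fun x => g (Y x)).
  apply: Rintegrable_le (Rintegrable_cst m K) => //; exact: measurableT_comp mg mY.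
apply/ler_addgt0Pl => r r0.
pose N := (Num.truncn (2 * K / r)).+1; pose h := 2 * K / N%:R.
have N0 : 0 < N%:R :> R by rewrite ltr0n.
have h0 : 0 <= h by rewrite divr_ge0// mulr_ge0.
have hr : h <= r.
  by rewrite ler_pdivrMr// [leRHS]mulrC -ler_pdivrMr//; apply/ltW; rewrite /N; apply: truncnS_gt.
have Nh : N%:R * h = 2 * K by rewrite /h [LHS]mulrC divfK// gt_eqF.
pose A k := [set x | k%:R * h < g x + K].
have mA k : measurable (A k).
  have -> : A k = (fun x => g x + K) @^-1` [set` `]k%:R * h, +oo[ ].
    by apply/seteqP; split => x /=; rewrite /A in_itv/= andbT.
  rewrite -[X in measurable X]setTI.
  by apply: (measurable_funD mg (measurable_cst K)) => //; exact: measurable_itv.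
have mXA (W : T -> T') k : measurable_fun setT W -> measurable (W @^-1` A k).
  by move=> mW; rewrite -[X in measurable X]setTI; apply: mW; [exact: measurableT|exact: mA].
have ind (W : T -> T') k : measurable_fun setT W ->
    Rintegrable m (fun x => (k%:R * h < g (W x) + K)%R%:R : R) /\
    \int[m]_x ((k%:R * h < g (W x) + K)%R%:R : R) = fine (m (W @^-1` A k)).
  move=> mW; have e1 : (fun x => (k%:R * h < g (W x) + K)%R%:R : R) = \1_(W @^-1` A k).
    apply/funext => x; rewrite indicE; congr (_%:R : R); congr nat_of_bool.
    by apply/idP/idP; rewrite inE.
  rewrite e1; split; first by apply: integrable_indic => //; exact: mXA.
  by rewrite /Rintegral integral_indic ?setIT//; exact: mXA.
have lay (W : T -> T') : measurable_fun setT W ->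
    Rintegrable m (fun x => layers h (g (W x) + K) N) /\
    \int[m]_x layers h (g (W x) + K) N = \sum_(k < N) h * fine (m (W @^-1` A k)).
  move=> mW; have i k := (ind W k mW).1.
  split; first by apply: Rintegrable_sum => k; apply: RintegrableZ; exact: i.
  rewrite Rintegral_sum; last by move=> k; apply: RintegrableZ; exact: i.
  by apply: eq_bigr => k _; rewrite RintegralZ_setT ?(ind W k mW).2//; exact: i.
have gK0 x : 0 <= g x + K by have := gK x; rewrite ler_norml; lra.
have bnd x : g x + K <= layers h (g x + K) N <= g x + K + h.
  have [/andP[l1 l2] _] := layers_bounds N h0 (gK0 x).
  move: l1 l2; rewrite Nh min_l; first by move=> -> ->.
  by have := gK x; rewrite ler_norml; lra.
have [iLX eLX] := lay X mX; have [iLY eLY] := lay Y mY.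
have h1 : \int[m]_x g (X x) + K <= \sum_(k < N) h * fine (m (X @^-1` A k)).
  rewrite -eLX -[X in _ + X](Rintegral_cst1 m) -RintegralD_setT//; last exact: Rintegrable_cst.
  apply: le_Rintegral_setT => //; first exact: RintegrableD iX (Rintegrable_cst m K).
  by move=> x; case/andP: (bnd (X x)).
have h2 : \sum_(k < N) h * fine (m (Y @^-1` A k)) <= \int[m]_x g (Y x) + (K + h).
  rewrite -eLY -[X in _ + X](Rintegral_cst1 m) -RintegralD_setT//; last exact: Rintegrable_cst.
  apply: le_Rintegral_setT => //; first exact: RintegrableD iY (Rintegrable_cst m (K + h)).
  by move=> x; case/andP: (bnd (Y x)); rewrite addrA.
have h3 : \sum_(k < N) h * fine (m (X @^-1` A k)) <=
    \sum_(k < N) h * fine (m (Y @^-1` A k)) + 2 * K * e.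
  rewrite -Nh -lerBlDl -sumrB.
  apply: (@le_trans _ _ (\sum_(k < N) h * e)).
    apply: ler_sum => k _; rewrite -mulrBr ler_wpM2l//.
    exact: le_trans (ler_norm _) (XY _ (mA k)).
  by rewrite sumr_const card_ord -[leRHS]mulrA [leRHS]mulr_natl lexx.
move: h1 h2 h3 hr.
move: (\sum_(k < N) _) (\sum_(k < N) _) (\int[m]_x _) (\int[m]_x _) => a1 a2 a3 a4; lra.
Qed.

End bounded_total_variation.

(** * The largest eigenvalue as a maximal Rayleigh quotient *)

Section rayleigh_quotient.
Context {R : realType} {d : nat}.
Implicit Types (A : 'M[R]_d) (x y : 'rV[R]_d).

Lemma continuous_bform A : continuous (fun x => bform A x x).
Proof.
have sumc (h : 'I_d -> 'rV[R]_d -> R) : (forall i, continuous (h i)) ->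
    continuous (fun x => \sum_i h i x).
  move=> hc; rewrite (_ : (fun x => _) = \sum_i h i); last first.
    by apply/funext => x; rewrite fct_sumE.
  elim/big_ind : _ => [|f g fc gc x|i _].
  - exact: (@cst_continuous _ R 0).
  - exact: (cvgD (fc x) (gc x)).
  - exact: hc.
under eq_fun do rewrite bformE.
apply: (sumc) => j; apply: sumc => i x.
have ci k := @coord_continuous R 1 d 0 k x.
exact: (cvgM (cvgM (ci i) (cvg_cst (A i j : R))) (ci j)).
Qed.

Lemma bform1 x : bform 1%:M x x = \sum_i x 0 i ^+ 2.
Proof. by rewrite /bform mulmx1 mxE; apply: eq_bigr => i _; rewrite mxE expr2. Qed.

Lemma bform1_gt0 x : x != 0 -> 0 < bform 1%:M x x.
Proof.
move=> x0; rewrite bform1 lt_neqAle sumr_ge0 ?andbT; last by move=> i _; exact: sqr_ge0.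
apply: contra x0; rewrite eq_sym psumr_eq0; last by move=> i _; exact: sqr_ge0.
by move=> /allP h; apply/eqP/rowP => i; have := h i (mem_index_enum _); rewrite /= sqrf_eq0 mxE => /eqP.
Qed.

(* A negative semidefinite form vanishes on every line through an isotropic
   vector: otherwise the form along the line would be linear at first order. *)
Lemma bform_isotropic A x y : A^T = A -> (forall x, bform A x x <= 0) ->
  bform A x x = 0 -> bform A x y = 0.
Proof.
move=> AT A0 x0; apply/eqP; apply: contraT => xy.
set a := bform A x y in xy; set b := bform A y y.
have D0 : 0 < 1 + `|b| by rewrite ltr_pwDl.
have := A0 (x + (a / (1 + `|b|)) *: y).
rewrite bform_sqrD// x0 bformZl !bformZr -/a -/b add0r => h.
have a20 : 0 < a ^+ 2 by rewrite lt_neqAle sqr_ge0 eq_sym sqrf_eq0 xy.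
have : a ^+ 2 * (2 * (1 + `|b|) + b) <= 0.
  rewrite -(pmulr_lle0 (x := ((1 + `|b|) ^+ 2)^-1)) ?invr_gt0 ?exprn_gt0//.
  apply: le_trans h; rewrite le_eqVlt; apply/orP; left; apply/eqP.
  by field; rewrite gt_eqF.
rewrite pmulr_rle0// => h2; have := ler_norm (- b); have := normr_ge0 b; rewrite normrN; lra.
Qed.

(** The form attains its maximum [M] on the unit sphere at some [c]. Then [A - M] is negative
    semidefinite and isotropic at [c], so [c] is an eigenvector for [M]. *)
Lemma bform_le_lambda_max A x : A^T = A ->
  bform A x x <= lambda_max A * \sum_i x 0 i ^+ 2.
Proof.
move=> AT; rewrite -bform1.
have [->|x0] := eqVneq x 0; first by rewrite /bform !mul0mx mxE mulr0.
pose S : set 'rV[R]_d := [set y | bform 1%:M y y = 1].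
have normalize y : y != 0 -> S ((Num.sqrt (bform 1%:M y y))^-1 *: y).
  move=> y0; have n0 := bform1_gt0 y0; rewrite /S/= bformZl bformZr mulrA -invfM -expr2.
  by rewrite sqr_sqrtr ?(ltW n0)// mulVf// gt_eqF.
have Sc : compact S.
  apply: bounded_closed_compact; last first.
    rewrite (_ : S = (fun y => bform 1%:M y y) @^-1` [set 1])//.
    apply: preimage_closed; last exact: closed_eq.
    by move=> y _; exact: continuous_bform.
  exists 1; split=> // M M1 y; rewrite /S/= bform1 => Sy.
  apply: le_trans (ltW M1); rewrite /Num.norm/= mx_normrE.
  apply/bigmax_leP; split => // -[i j] _; rewrite ord1/=.
  rewrite -(@expr_le1 _ 2%N)// real_normK ?num_real// -Sy (bigD1 j)//= lerDl sumr_ge0//.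
  by move=> k _; exact: sqr_ge0.
have [c /set_mem cS cM] := EVT_max_rV (ex_intro _ _ (normalize _ x0)) Sc
  (continuous_subspaceT (continuous_bform (A := A))).
set M := bform A c c in cM.
have AM y : bform A y y <= M * bform 1%:M y y.
  have [->|y0] := eqVneq y 0; first by rewrite /bform !mul0mx !mxE mulr0.
  have n0 := bform1_gt0 y0.
  have := cM _ (mem_set (normalize _ y0)); rewrite bformZl bformZr mulrA -invfM -expr2.
  by rewrite sqr_sqrtr ?(ltW n0)// ler_pdivrMl// mulrC.
pose B := A - M%:M.
have BE y z : bform B y z = bform A y z - M * bform 1%:M y z.
  by rewrite /bform /B mulmxBr mulmxBl mxE [X in _ + X]mxE mul_mx_scalar mulmx1 -scalemxAl [X in _ - X]mxE.
have BT : B^T = B by rewrite /B linearB/= AT tr_scalar_mx.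
have B0 y : bform B y y <= 0 by rewrite BE subr_le0.
have Bc : bform B c c = 0 by rewrite BE cS mulr1 subrr.
have cA : c *m A = M *: c.
  apply/rowP => j; have := bform_isotropic (delta_mx 0 j) BT B0 Bc.
  rewrite BE /bform mulmx1 trmx_delta -!colE !mxE => /eqP.
  by rewrite subr_eq0 => /eqP.
have c0 : c != 0.
  by apply: contra_eq_neq cS => ->; rewrite /bform !mul0mx mxE eq_sym oner_eq0.
have eM : eigenvalue A M by apply/eigenvalueP; exists c.
apply: le_trans (AM x) _; rewrite ler_wpM2r ?(ltW (bform1_gt0 x0))//.
(* A supremum in the reals dominates its elements only when the set is bounded; here [M] bounds
   every eigenvalue. *)
apply: ub_le_sup => //; exists M => a /eigenvalueP[v vA v0].
have e : bform A v v = a * bform 1%:M v v by rewrite /bform vA mulmx1 -scalemxAl mxE.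
by have := AM v; rewrite e ler_pM2r// bform1_gt0.
Qed.

Lemma lambda_max_ge0 A : (0 < d)%N -> A^T = A -> (forall x, 0 <= bform A x x) ->
  0 <= lambda_max A.
Proof.
move=> d0 AT A0; have := bform_le_lambda_max (delta_mx 0 (Ordinal d0)) AT.
move=> /(le_trans (A0 _)); rewrite pmulr_lge0// -bform1 bform1_gt0//.
by apply/eqP => /rowP/(_ (Ordinal d0))/eqP; rewrite !mxE !eqxx oner_eq0.
Qed.

End rayleigh_quotient.

(** * Passage to the limit in the variational bound *)

Section variational_entropy_bound.
Context {R : realType} {d : nat} {C : 'M[R]_d}.
Variables (mu gam : probability 'rV[R]_d R).
Hypothesis Cp : posdefmx C.
Hypothesis gamE : forall A, measurable A ->
  gam A = (\int[lebesgue_rV d]_(x in A) (gaussian_pdf C x)%:E)%E.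
Hypothesis mu2 : square_Rintegrable_rV mu (@id 'rV[R]_d).
Hypothesis mu_mean : forall i, \int[mu]_x x 0 i = 0.
Hypothesis mu_cov : forall i j, \int[mu]_x (x 0 i * x 0 j) = C i j.
Let q := bform (invmx C).
Local Notation m := (mu \x gam)%E.
Local Notation phi := (@log_evidence_mean _ _ C mu gam).
Local Notation J := (@posterior_energy _ _ C mu gam).

Variables (kappa alpha : R).
Hypothesis alpha0 : 0 < alpha.
Hypothesis tv : forall (A : set 'rV[R]_d) (z : 'rV[R]_d) (t : R), measurable A ->
  1 / 2 <= t <= 1 ->
  `|fine (mu ((fun y => Num.sqrt t *: y + Num.sqrt (1 - t) *: z) @^-1` A)) - fine (mu A)|
    <= kappa * (1 + l1_norm z) * (1 - t) `^ alpha.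

(** For a fixed noise value [z] the rescaled observation is [sqrt t x + sqrt (1 - t) z], so the
    hypothesis applies section by section and its error is averaged over the noise. *)
Lemma channel_total_variation b (g : 'rV[R]_d -> R) (K : R) : 1 <= b ->
  measurable_fun setT g -> (forall z, `|g z| <= K) ->
  \int[mu]_x g x <= \int[m]_p g ((Num.sqrt (1 + b ^+ 2))^-1 *: (channel b p).2) +
    2 * K * kappa * \int[gam]_z (1 + l1_norm z) * (1 + b ^+ 2)^-1 `^ alpha.
Proof.
move=> b1 mg gK; set w := 1 + b ^+ 2; have w0 : 0 < w.
  by rewrite ltr_pwDl// sqr_ge0.
have b21 : 1 <= b ^+ 2 by rewrite -(expr1n _ 2%N) lerXn2r ?nnegrE// (le_trans ler01).
pose c := (Num.sqrt w)^-1; have c0 : 0 < c by rewrite invr_gt0 sqrtr_gt0.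
have c2 : c ^+ 2 = w^-1 by rewrite /c exprVn sqr_sqrtr// ltW.
pose t := b ^+ 2 / w; have t1 : 1 - t = w^-1 by rewrite /t /w; field; rewrite gt_eqF.
have t12 : 1 / 2 <= t <= 1.
  by rewrite /t ler_pdivlMr// ler_pdivrMr// /w; lra.
have st : Num.sqrt t = c * b.
  by rewrite /t sqrtrM ?sqr_ge0// sqrtr_sqr ger0_norm ?(le_trans ler01)// sqrtrV ?ltW// mulrC.
have s1 : Num.sqrt (1 - t) = c by rewrite t1 sqrtrV// ltW.
have maff v : measurable_fun setT (fun x : 'rV[R]_d => Num.sqrt t *: x + v).
  exact: measurable_rV_affine.
have bound (h : 'rV[R]_d -> R) : measurable_fun setT h -> (forall x, `|h x| <= K) ->
    Rintegrable mu h.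
  by move=> mh hK; exact: Rintegrable_le mh hK (Rintegrable_cst mu K).
have mY : measurable_fun setT (fun p : 'rV[R]_d * 'rV[R]_d => c *: (channel b p).2).
  have := measurable_rV_affine c (0 : 'rV[R]_d).
  under [X in measurable_fun _ X -> _]eq_fun do rewrite addr0.
  by move=> h; exact: (measurableT_comp h (measurable_shift b)).
have im : Rintegrable m (fun p => g (c *: (channel b p).2)).
  apply: Rintegrable_le (Rintegrable_cst _ K).
    exact: (measurableT_comp mg mY).
  by move=> p; exact: gK.
have e1 z x : g (c *: (channel b (x, z)).2) = g (Num.sqrt t *: x + Num.sqrt (1 - t) *: z).
  by rewrite /channel/= st s1 scalerDr scalerA addrC.
have iz z : Rintegrable mu (fun x => g (c *: (channel b (x, z)).2)).
  under eq_fun do rewrite e1.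
  by apply: bound => // ; exact: (measurableT_comp mg (maff _)).
have [i2 ->] := Rintegral_fubini21 im iz.
have il : Rintegrable gam (fun z => 1 + l1_norm z).
  apply: RintegrableD; first exact: Rintegrable_cst.
  apply: (@Rintegrable_l1_bound _ _ _ _ Cp gamE _ 1 1) => //.
    exact: measurable_l1_norm.
  by move=> z; rewrite !mul1r ger0_norm ?l1_norm_ge0//; have := le_l1_expR z; lra.
have il2 := RintegrableZ (2 * K * kappa * w^-1 `^ alpha) il.
rewrite [X in _ + X](_ : _ = (2 * K * kappa * w^-1 `^ alpha) * \int[gam]_z (1 + l1_norm z)); last by ring.
rewrite -(RintegralZ_setT _ il) -(RintegralD_setT i2 il2) -[leLHS](Rintegral_cst1 gam).
apply: le_Rintegral_setT; [exact: Rintegrable_cst|exact: RintegrableD|move=> z].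
under [X in _ <= X + _]eq_Rintegral_setT do rewrite e1.
have := @Rintegral_tv_le _ _ _ _ _ mu id
  (fun x => Num.sqrt t *: x + Num.sqrt (1 - t) *: z) g (kappa * (1 + l1_norm z) * w^-1 `^ alpha) K.
rewrite (_ : 2 * K * (_ * _) = 2 * K * kappa * w^-1 `^ alpha * (1 + l1_norm z)); last by ring.
apply => //.
by move=> A mA; rewrite distrC -t1; exact: tv.
Qed.

(* The law of the rescaled channel output tends to [mu] in total variation as
   the signal-to-noise ratio grows. *)
Lemma donsker_varadhan_limit (E b0 : R) (g : 'rV[R]_d -> R) (K r : R) :
  measurable_fun setT g -> (forall z, `|g z| <= K) ->
  (\int[gam]_z (expR (g z))%:E = r%:E)%E ->
  (forall b, b0 <= b -> channel_entropy phi d%:R b <= E) ->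
  \int[mu]_x g x <= E + r - 1.
Proof.
move=> mg gK er eE; apply/ler_addgt0Pl => e e0.
set Q := 2 * K * kappa * \int[gam]_z (1 + l1_norm z).
(* Solves for the level beyond which the total variation error, [Q] times a power of [1 + b^2], is
   at most [e]. *)
pose v := ((1 + `|Q|) / e) `^ alpha^-1.
have v0 : 0 < v by rewrite powR_gt0// divr_gt0// ltr_pwDl.
pose b := 1 + `|b0| + v.
have b1 : 1 <= b by rewrite /b -addrA lerDl addr_ge0// ltW.
have bb0 : b0 <= b by rewrite /b; have := ler_norm b0; lra.
have w0 : 0 < 1 + b ^+ 2 by rewrite ltr_pwDl// sqr_ge0.
have vb : v <= 1 + b ^+ 2.
  have : b * 1 <= b * b by rewrite ler_wpM2l// (le_trans ler01).
  by have := normr_ge0 b0; rewrite expr2 /b; lra.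
have := channel_total_variation b1 mg gK; rewrite -/Q.
have := donsker_varadhan Cp gamE mu2 mu_mean mu_cov (le_trans ler01 b1) mg gK er.
have := eE b bb0; rewrite /channel_entropy.
have : Q * (1 + b ^+ 2)^-1 `^ alpha <= e.
  have h : (1 + b ^+ 2)^-1 `^ alpha <= e / (1 + `|Q|).
    apply: (@le_trans _ _ (v^-1 `^ alpha)).
      by rewrite ge0_ler_powR ?nnegrE ?invr_ge0 ?(ltW v0) ?(ltW w0) ?(ltW alpha0)// lef_pV2.
    have va : v `^ alpha = (1 + `|Q|) / e.
      by rewrite /v -powRrM mulVf ?gt_eqF// powRr1// divr_ge0 ?(ltW e0)// addr_ge0.
    have va0 : 0 < v `^ alpha by exact: powR_gt0.
    rewrite -invf_div -va -[leRHS]mul1r ler_pdivlMr// -powRM ?invr_ge0 ?(ltW v0)//.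
    by rewrite mulVf ?gt_eqF// powR1.
  have D0 : 0 < 1 + `|Q| by rewrite ltr_pwDl.
  apply: (@le_trans _ _ (`|Q| * (e / (1 + `|Q|)))).
    apply: (@le_trans _ _ (`|Q| * (1 + b ^+ 2)^-1 `^ alpha)).
      by rewrite ler_wpM2r ?powR_ge0// ler_norm.
    by rewrite ler_wpM2l.
  by rewrite mulrCA ler_piMr ?(ltW e0)// ler_pdivrMr// mul1r lerDr.
move: (Q * _) (phi b) (\int[m]_p _) (\int[mu]_x _) => u1 u2 u3 u4; lra.
Qed.

End variational_entropy_bound.

Section stein_entropy_bound.
Context {R : realType} {d : nat} {C : 'M[R]_d}.
Variables (mu gam : probability 'rV[R]_d R).
Hypothesis Cp : posdefmx C.
Hypothesis gamE : forall A, measurable A ->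
  gam A = (\int[lebesgue_rV d]_(x in A) (gaussian_pdf C x)%:E)%E.
Hypothesis mu2 : square_Rintegrable_rV mu (@id 'rV[R]_d).
Hypothesis mu_mean : forall i, \int[mu]_x x 0 i = 0.
Hypothesis mu_cov : forall i j, \int[mu]_x (x 0 i * x 0 j) = C i j.
Let q := bform (invmx C).
Local Notation m := (mu \x gam)%E.
Local Notation phi := (@log_evidence_mean _ _ C mu gam).
Local Notation J := (@posterior_energy _ _ C mu gam).

Variables (kappa alpha eta : R).
Hypotheses (kappa0 : 0 < kappa) (alpha0 : 0 < alpha) (eta0 : 0 < eta).
Hypothesis tv : forall (A : set 'rV[R]_d) (z : 'rV[R]_d) (t : R), measurable A ->
  1 / 2 <= t <= 1 ->
  `|fine (mu ((fun y => Num.sqrt t *: y + Num.sqrt (1 - t) *: z) @^-1` A)) - fine (mu A)|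
    <= kappa * (1 + l1_norm z) * (1 - t) `^ alpha.

Variable tau : 'rV[R]_d -> 'M[R]_d.
Hypothesis tau1 : forall i j, Rintegrable mu (fun x => tau x i j).
Hypothesis stein : forall (i : 'I_d) (g : 'rV[R]_d -> R),
  (forall x, differentiable g x) ->
  Rintegrable mu (fun x => x 0 i * g x) ->
  (forall j, Rintegrable mu (fun x => tau x i j * 'D_(delta_mx 0 j) g x)) ->
  \int[mu]_x (x 0 i * g x) =
  \sum_j \int[mu]_x (tau x i j * 'D_(delta_mx 0 j) g x).
Hypothesis tau2 : forall i j, square_Rintegrable mu (fun x => C i j - tau x i j).

Variables (lam M2 : R).
Hypothesis lamP : forall x : 'rV[R]_d, q x x <= lam * \sum_i x 0 i ^+ 2.
Hypothesis lam0 : 0 <= lam.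
Hypothesis M2_ge0 : 0 <= M2.
Hypothesis M2P : forall j, \int[gam]_z dual_noise (C := C) j z ^+ 2 <= M2.

Definition noise_moment j := \int[gam]_z `|z 0 j| `^ (eta + 2).

(** Up to [lam], the constant in front of the decaying bound on the excess energy in the second
    regime. *)
Definition entropy_weight :=
  \sum_j noise_weight gam kappa `^ (eta / (eta + 1)) * noise_moment j `^ (eta + 1)^-1.

Let D := \sum_j \sum_l \int[mu]_x (C j l - tau x j l) ^+ 2.
Let beta := alpha * (eta / (eta + 1)).

Let step b c : 0 <= c -> phi c - phi b <= (c - b) * c * J c.
Proof. exact: log_evidence_mean_step Cp gamE mu2 mu_mean mu_cov b c. Qed.

Let J1 b : 0 < b ->
  J b <= d%:R * (1 - (1 + b ^+ 2)^-1) + lam * (d%:R * M2 * D) / (1 + b ^+ 2).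
Proof.
exact: (posterior_energy_stein Cp gamE mu2 mu_mean mu_cov tau1 stein tau2 lamP lam0 M2_ge0 M2P).
Qed.

Let D_ge0 : 0 <= D.
Proof.
apply: sumr_ge0 => j _; apply: sumr_ge0 => l _.
by apply: Rintegral_ge0 => x _; exact: sqr_ge0.
Qed.

Let L1_ge0 : 0 <= lam * (d%:R * M2 * D).
Proof. by rewrite !mulr_ge0. Qed.

Let weight_ge0 : 0 <= entropy_weight.
Proof. by apply: sumr_ge0 => j _; rewrite mulr_ge0 ?powR_ge0. Qed.

Let beta_gt0 : 0 < beta.
Proof. by rewrite mulr_gt0// divr_gt0// addr_gt0. Qed.

Let J2 b : 1 <= b -> J b <= d%:R * (1 - (1 + b ^+ 2)^-1) +
  lam * entropy_weight * ((1 + b ^+ 2) `^ (- beta) / (1 + b ^+ 2)).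
Proof.
move=> b1; have w0 : 0 < 1 + b ^+ 2 by rewrite ltr_pwDl// sqr_ge0.
apply: le_trans (posterior_energy_tv Cp gamE mu2 mu_mean mu_cov kappa0 eta0 tv b1 lam0 lamP) _.
rewrite lerD2l le_eqVlt; apply/orP; left; apply/eqP.
rewrite [LHS]mulrC [RHS]mulrA; congr (_ / _); rewrite -mulrA; congr (_ * _).
rewrite mulr_suml; apply: eq_bigr => j _; rewrite powRM ?powR_ge0//; last first.
  exact: (ltW (noise_weight_gt0 Cp gamE kappa0 j)).
rewrite mulrAC -powRrM -/beta; congr (_ * _ * _).
by rewrite -[(1 + b ^+ 2)^-1]powR_inv1 ?(ltW w0)// -powRrM mulN1r.
Qed.

(** No switch takes place: the first regime bounds the entropy by 0 at every [b]. *)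
Lemma stein_entropy_le0 (g : 'rV[R]_d -> R) (K r : R) : D = 0 ->
  measurable_fun setT g -> (forall z, `|g z| <= K) ->
  (\int[gam]_z (expR (g z))%:E = r%:E)%E -> \int[mu]_x g x <= r - 1.
Proof.
move=> D0 mg gK er; rewrite -[leRHS]add0r addrA.
apply: (@donsker_varadhan_limit _ _ _ _ _ Cp gamE mu2 mu_mean mu_cov _ _ alpha0 tv 0 0 _ K) => // b b0.
have := channel_entropy_le1 (ler0n _ d) step (posterior_energy_le Cp gamE mu2 mu_mean mu_cov)
  L1_ge0 (log_evidence_mean0 mu gam) J1 b0.
by rewrite D0 !mulr0 !mul0r.
Qed.

(** The free parameter [w] is the switching time; [2 <= w] means [b0 >= 1], where the total
    variation bound is available. *)
Lemma stein_entropy_le (w : R) (g : 'rV[R]_d -> R) (K r : R) : 2 <= w ->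
  measurable_fun setT g -> (forall z, `|g z| <= K) ->
  (\int[gam]_z (expR (g z))%:E = r%:E)%E ->
  \int[mu]_x g x <= (lam * (d%:R * M2 * D) * ln w +
    lam * entropy_weight / beta * w `^ (- beta)) / 2 + r - 1.
Proof.
move=> w2 mg gK er.
pose b0 := Num.sqrt (w - 1).
have b01 : 1 <= b0 by rewrite -sqrtr1 ler_sqrt; lra.
have wE : w = 1 + b0 ^+ 2 by rewrite sqr_sqrtr; lra.
apply: (@donsker_varadhan_limit _ _ _ _ _ Cp gamE mu2 mu_mean mu_cov _ _ alpha0 tv _ b0 _ K) => // b b0b.
rewrite wE.
exact: (channel_entropy_le2 (ler0n _ d) step (posterior_energy_le Cp gamE mu2 mu_mean mu_cov)
  L1_ge0 (mulr_ge0 lam0 weight_ge0) beta_gt0 (log_evidence_mean0 mu gam) J1 J2 b01 b0b).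
Qed.

End stein_entropy_bound.

(** * Relative entropy recovered from its dual bounds *)

Section relative_entropy_duality.
Context dT (T : measurableType dT) {R : realType}.
Variables (nu : {measure set T -> \bar R}) (mu gam : probability T R) (f p : T -> R).
Hypotheses (mf : measurable_fun setT f) (f0 : forall x, 0 <= f x).
Hypotheses (mp : measurable_fun setT p) (p0 : forall x, 0 < p x).
Hypothesis muE : forall A, measurable A -> (mu A = \int[nu]_(x in A) (f x)%:E)%E.
Hypothesis gamE : forall A, measurable A -> (gam A = \int[nu]_(x in A) (p x)%:E)%E.

Variable E : R.
Hypothesis dual : forall (g : T -> R) (K r : R), measurable_fun setT g ->
  (forall x, `|g x| <= K) -> (\int[gam]_x (expR (g x))%:E = r%:E)%E ->
  \int[mu]_x g x <= E + r - 1.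

Let t x := f x / p x.
Let t0 x : 0 <= t x. Proof. by rewrite divr_ge0// ltW. Qed.

Let mt : measurable_fun setT t.
Proof.
rewrite (_ : t = fun x => f x * expR (- ln (p x))); last first.
  by apply/funext => x; rewrite -lnV ?posrE// lnK ?posrE ?invr_gt0.
apply: measurable_funM => //; apply: measurableT_comp => //; apply: measurable_funN.
exact: measurableT_comp.
Qed.

Let clip (a b x : R) := Num.max a (Num.min x b).

(** The integrand is not known to be integrable beforehand, so its positive and negative parts are
    treated apart. *)
Let pos x := f x * ln (Num.max 1 (t x)).
Let neg x := f x * - ln (Num.min 1 (t x)).

Let posneg x : f x * ln (t x) = pos x - neg x.
Proof.
rewrite /pos /neg mulrN opprK -mulrDr; have [t1|t1] := leP 1 (t x).
  by rewrite ln1 addr0.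
by rewrite ln1 add0r.
Qed.

Let neg_ge0 x : 0 <= neg x.
Proof.
rewrite /neg mulr_ge0// oppr_ge0 ln_le0//.
by rewrite ge_min lexx.
Qed.

(** Because [- ln t <= 1 / t]; the negative part is thus integrable whatever the entropy is. *)
Let neg_le x : neg x <= p x.
Proof.
rewrite /neg; have [t1|t1] := leP 1 (t x); first by rewrite ln1 oppr0 mulr0 ltW.
have [fx0|fx0] := eqVneq (f x) 0; first by rewrite fx0 mul0r ltW.
have tx0 : 0 < t x by rewrite divr_gt0// lt_neqAle eq_sym fx0 f0.
rewrite (_ : f x = t x * p x); last by rewrite /t divfK// gt_eqF.
have h : - ln (t x) <= (t x)^-1.
  rewrite -lnV ?posrE//; have := expR_ge1Dx (ln (t x)^-1).
  by rewrite lnK ?posrE ?invr_gt0//; lra.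
apply: (@le_trans _ _ (t x * p x * (t x)^-1)).
  by rewrite ler_wpM2l// mulr_ge0// ltW.
by rewrite mulrAC mulfV ?mul1r// gt_eqF.
Qed.

Let mpos : measurable_fun setT pos.
Proof.
apply: measurable_funM => //; apply: measurableT_comp; first exact: measurable_ln.
exact: measurable_maxr.
Qed.

Let mneg : measurable_fun setT neg.
Proof.
apply: measurable_funM => //; apply: measurable_funN.
apply: measurableT_comp; first exact: measurable_ln.
exact: measurable_minr.
Qed.

Let int_f : (\int[nu]_x (f x)%:E = 1)%E.
Proof. by rewrite -muE// probability_setT. Qed.

Let int_p : (\int[nu]_x (p x)%:E = 1)%E.
Proof. by rewrite -gamE// probability_setT. Qed.

Let ineg : Rintegrable nu neg.
Proof.
apply: (@Rintegrable_le _ _ _ _ neg p) => //.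
  by move=> x; rewrite ger0_norm ?neg_ge0.
apply: ge0_Rintegrable => //; first by move=> x; exact: ltW.
by rewrite int_p ltry.
Qed.

Let I := \int[nu]_x neg x.

Let mclip a b : measurable_fun setT (fun x => ln (clip a b (t x))).
Proof.
apply: measurableT_comp; first exact: measurable_ln.
by apply: measurable_maxr => //; exact: measurable_minr.
Qed.

Let clip_bound a b x : 0 < a -> a <= 1 -> 1 <= b -> `|ln (clip a b x)| <= ln b - ln a.
Proof.
move=> a0 a1 b1.
have ac : a <= clip a b x by rewrite le_max lexx.
have cb : clip a b x <= b by rewrite ge_max (le_trans a1)//= ge_min lexx orbT.
have c0 : 0 < clip a b x by exact: lt_le_trans ac.
have h1 : ln a <= ln (clip a b x) by rewrite ler_ln ?posrE.
have h2 : ln (clip a b x) <= ln b by rewrite ler_ln ?posrE//; exact: lt_le_trans cb.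
have h3 : ln a <= 0 by exact: ln_le0.
have h4 : 0 <= ln b by exact: ln_ge0.
by rewrite ler_norml; apply/andP; split; lra.
Qed.

(** The test function is the log-likelihood clipped to [[a, b]]: bounded, with exponential at most
    [t + a], hence [r <= 1 + a]. Raising the lower clip from [a] to 1 adds [v], whose mean is at
    most that of the negative part. *)
Let clip_le a b : 0 < a -> a <= 1 -> 1 <= b ->
  (\int[nu]_x (f x * ln (clip 1 b (t x)))%:E <= (E + a + I)%:E)%E.
Proof.
move=> a0 a1 b1.
pose g x := ln (clip a b (t x)); pose v x := - ln (clip a 1 (t x)).
have gv x : ln (clip 1 b (t x)) = g x + v x.
  rewrite /g /v /clip; move: (t x) (t0 x) => y y0.
  case/orP: (le_total y 1) => y1.
    by rewrite (min_l (le_trans y1 b1)) (max_l y1) (min_l y1) ln1 subrr.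
  have z1 : 1 <= Num.min y b by rewrite le_min y1.
  by rewrite (min_r y1) (max_r a1) ln1 subr0 (max_r z1) max_r// (le_trans a1).
have mv : measurable_fun setT v by exact: measurable_funN.
have v0 x : 0 <= v x.
  rewrite /v oppr_ge0 ln_le0// ge_max a1 ge_min lexx orbT//.
have mg : measurable_fun setT g by exact: mclip.
have gK x : `|g x| <= ln b - ln a by exact: clip_bound.
have vK x : `|v x| <= ln 1 - ln a by rewrite normrN; exact: clip_bound.
have [ig iv] : Rintegrable mu g /\ Rintegrable mu v.
  by split; [exact: Rintegrable_le mg gK (Rintegrable_cst mu _)|
    exact: Rintegrable_le mv vK (Rintegrable_cst mu _)].
have [r er ra] : exists2 r, (\int[gam]_x (expR (g x))%:E = r%:E)%E & r <= 1 + a.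
  have h : (\int[gam]_x (expR (g x))%:E <= (1 + a)%:E)%E.
    have mexp : measurable_fun setT (fun x => (expR (g x))%:E).
      by apply/measurable_EFinP; exact: measurableT_comp.
    have exp0 x : (0 <= (expR (g x))%:E)%E by rewrite lee_fin expR_ge0.
    rewrite (ge0_integral_density mp (fun x => ltW (p0 x)) gamE mexp exp0).
    apply: (@le_trans _ _ (\int[nu]_x ((f x)%:E + (a * p x)%:E))%E).
      apply: ge0_le_integral => //.
      - by move=> x _; rewrite -EFinM lee_fin mulr_ge0 ?expR_ge0// ltW.
      - under eq_fun do rewrite -EFinM.
        by apply/measurable_EFinP; apply: measurable_funM => //; exact: measurableT_comp.
      - by apply/measurable_EFinP; apply: measurable_funD => //; exact: measurable_funM.
      - move=> x _; rewrite -EFinM -EFinD lee_fin /g lnK ?posrE; last first.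
          by rewrite lt_max a0.
        rewrite (_ : f x = t x * p x); last by rewrite /t divfK// gt_eqF.
        rewrite -mulrDl ler_wpM2r ?(ltW (p0 x))// ge_max lerDr t0/=.
        by rewrite (@le_trans _ _ (t x))// ?ge_min ?lexx// lerDl ltW.
    have f0' x : setT x -> (0 <= (f x)%:E)%E by rewrite lee_fin.
    have mf' : measurable_fun setT (fun x => (f x)%:E) by exact/measurable_EFinP.
    have ap0 x : setT x -> (0 <= (a * p x)%:E)%E by rewrite lee_fin mulr_ge0// ltW.
    have map : measurable_fun setT (fun x => (a * p x)%:E).
      by apply/measurable_EFinP; exact: measurable_funM.
    rewrite (ge0_integralD _ _ f0' mf' ap0 map)//.
    rewrite int_f; under eq_integral do rewrite EFinM.
    rewrite ge0_integralZl//; last 3 first.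
    - exact/measurable_EFinP.
    - by move=> x _; rewrite lee_fin ltW.
    - by rewrite lee_fin ltW.
    by rewrite int_p mule1.
  have h0 : (0 <= \int[gam]_x (expR (g x))%:E)%E.
    by apply: integral_ge0 => x _; rewrite lee_fin expR_ge0.
  move: h h0; case: (\int[gam]_x _)%E => // r h h0.
  by exists r => //; move: h; rewrite lee_fin.
have hg := dual mg gK er.
have hv : \int[mu]_x v x <= I.
  rewrite -lee_fin -EFin_Rintegral// /I -EFin_Rintegral//.
  rewrite (ge0_integral_density mf f0 muE)//; last first.
    exact/measurable_EFinP.
  apply: ge0_le_integral => //.
  - by move=> x _; rewrite -EFinM lee_fin mulr_ge0.
  - by under eq_fun do rewrite -EFinM; apply/measurable_EFinP; exact: measurable_funM.
  - exact/measurable_EFinP.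
  - move=> x _; rewrite -EFinM lee_fin mulrC /neg.
    have [fx0|fx0] := eqVneq (f x) 0; first by rewrite fx0 !mul0r.
    have tx0 : 0 < t x by rewrite divr_gt0// lt_neqAle eq_sym fx0 f0.
    rewrite ler_wpM2l// /v lerN2 /clip minC.
    have m0 : 0 < Num.min 1 (t x) by rewrite lt_min ltr01.
    by rewrite minC ler_ln ?posrE ?lt_max ?a0 ?m0// le_max lexx orbT.
apply: (@le_trans _ _ (\int[mu]_x (g x + v x))%:E); last first.
  rewrite lee_fin RintegralD_setT//; move: hg hv ra.
  by move: (\int[mu]_x g x) (\int[mu]_x v x) => u1 u2; lra.
rewrite -EFin_Rintegral; last exact: RintegrableD.
rewrite (ge0_integral_density mf f0 muE)//.
- by under eq_integral do rewrite gv mulrC EFinM.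
- by apply/measurable_EFinP; exact: measurable_funD.
- by move=> x; rewrite -gv lee_fin ln_ge0// le_max lexx.
Qed.

(** The floor [a] is taken below any tolerance, and the ceiling tends to infinity by monotone
    convergence. *)
Let pos_le : (\int[nu]_x (pos x)%:E <= (E + I)%:E)%E.
Proof.
have a01 (e : R) : 0 < e -> exists a : R, [/\ 0 < a, a <= 1 & a <= e].
  move=> e0; exists (Num.min 1 e).
  split; first by rewrite lt_min ltr01.
    by rewrite ge_min lexx.
  by rewrite ge_min lexx orbT.
apply/lee_addgt0Pr => e e0; have [a [a0 a1 ae]] := a01 _ e0.
apply: (@le_trans _ _ (E + a + I)%:E); last by rewrite -EFinD lee_fin; lra.
pose U (n : nat) x := (f x * ln (clip 1 n.+1%:R (t x)))%:E.
have n1 n : 1 <= n.+1%:R :> R by rewrite ler1n.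
have limU x : U n x @[n --> \oo] --> (pos x)%:E.
  apply: cvg_near_cst; near=> n; rewrite /U /pos /clip (_ : Num.min (t x) _ = t x)//.
  apply: min_l; near: n; exists (Num.truncn (t x)) => // n /= hn.
  by apply: ltW; apply: (lt_le_trans (truncnS_gt _)); rewrite ler_nat ltnS.
have mono : (\int[nu]_x U n x @[n --> \oo] --> \int[nu]_x (pos x)%:E)%E.
  have -> : (fun x => (pos x)%:E) = (fun x => limn (U ^~ x)).
    by apply/funext => x; apply/esym/cvg_lim.
  apply: cvg_monotone_convergence => //.
  - by move=> n; apply/measurable_EFinP; apply: measurable_funM => //; exact: mclip.
  - by move=> n x _; rewrite lee_fin mulr_ge0// ln_ge0// le_max lexx.
  - move=> x _ m n mn; rewrite lee_fin ler_wpM2l// ler_ln ?posrE ?lt_max ?ltr01//.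
    have h : Num.min (t x) m.+1%:R <= Num.min (t x) n.+1%:R.
      by rewrite le_min ge_min lexx/= ge_min ler_nat ltnS mn orbT.
    by rewrite /clip ge_max le_max lexx/= le_max h orbT.
rewrite -(cvg_lim _ mono)//; apply: lime_le; first by apply/cvg_ex; eexists; exact: mono.
by apply: nearW => n; exact: clip_le.
Unshelve. all: by end_near. Qed.

Lemma relative_entropy_le :
  (\int[nu]_x (f x * ln (f x / p x))%:E <= E%:E)%E.
Proof.
have ipos : Rintegrable nu pos.
  apply: ge0_Rintegrable => //; last by apply: le_lt_trans pos_le _; rewrite ltry.
  by move=> x; rewrite mulr_ge0// ln_ge0// le_max lexx.
under eq_integral do rewrite -/(t _) posneg.
rewrite EFin_Rintegral; last exact: RintegrableB.
rewrite RintegralB_setT// lee_fin lerBlDr -lee_fin -EFin_Rintegral//.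
Qed.

End relative_entropy_duality.

(** * Constants *)

Section powR_sum.
Context {R : realType}.
Implicit Types (x y r p : R).

Lemma powR_subadditive x y r : 0 <= x -> 0 <= y -> 0 <= r -> r <= 1 ->
  (x + y) `^ r <= x `^ r + y `^ r.
Proof.
move=> x0 y0 r0 r1; have [xy0|xy0] := eqVneq (x + y) 0.
  move: xy0 => /eqP; rewrite paddr_eq0// => /andP[/eqP -> /eqP ->].
  by rewrite addr0 lerDl powR_ge0.
have {}xy0 : 0 < x + y by rewrite lt_neqAle eq_sym xy0 addr_ge0.
have h z : 0 <= z -> z <= x + y -> z / (x + y) * (x + y) `^ r <= z `^ r.
  move=> z0 zxy; have [->|zn0] := eqVneq z 0; first by rewrite !mul0r powR_ge0.
  have zgt0 : 0 < z by rewrite lt_neqAle eq_sym zn0.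
  have q1 : 0 < z / (x + y) <= 1 by rewrite divr_gt0//= ler_pdivrMr// mul1r.
  apply: (@le_trans _ _ ((z / (x + y)) `^ r * (x + y) `^ r)).
    by rewrite ler_wpM2r ?powR_ge0// ger1_powR.
  by rewrite -powRM ?divfK ?gt_eqF// ?divr_ge0// ltW.
apply: le_trans (lerD (h x x0 _) (h y y0 _)); rewrite ?lerDl ?lerDr//.
by rewrite -mulrDl -mulrDl divff ?mul1r// gt_eqF.
Qed.

Lemma powR_sum_le (I : Type) (s : seq I) (F : I -> R) r : (forall i, 0 <= F i) ->
  0 < r -> r <= 1 -> (\sum_(i <- s) F i) `^ r <= \sum_(i <- s) F i `^ r.
Proof.
move=> F0 r0 r1; elim: s => [|i s IH]; first by rewrite !big_nil powR0 ?gt_eqF.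
rewrite !big_cons; apply: le_trans (lerD (lexx _) IH).
by rewrite powR_subadditive ?sumr_ge0// ltW.
Qed.

(** Some term is at least the average in absolute value; this works for all [p > 0], without
    convexity. *)
Lemma powR_norm_sum_le d (a : 'I_d -> R) p : 0 < p ->
  `|\sum_k a k| `^ p <= d%:R `^ p * \sum_k `|a k| `^ p.
Proof.
move=> p0; set x := \sum_k a k.
have S0 : 0 <= d%:R `^ p * \sum_k `|a k| `^ p.
  by rewrite mulr_ge0 ?powR_ge0// sumr_ge0// => k _; exact: powR_ge0.
have [x0|x0] := eqVneq x 0; first by rewrite x0 normr0 powR0 ?gt_eqF.
have [k hk] : exists k, `|x| <= d%:R * `|a k|.
  apply: contrapT => /forallNP h.
  have h1 k : d%:R * `|a k| < `|x| by rewrite ltNge; apply/negP; exact: h.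
  have d0 : (0 < d)%N.
    by case: d a @x x0 S0 h h1 => // a x; rewrite /x big_ord0 eqxx.
  have : d%:R * `|x| <= \sum_k d%:R * `|a k|.
    by rewrite -mulr_sumr ler_wpM2l// ler_norm_sum.
  apply/negP; rewrite -ltNge.
  apply: (@lt_le_trans _ _ (\sum_(k < d) `|x|)); last first.
    by rewrite sumr_const card_ord [leRHS]mulr_natl lexx.
  apply: ltr_sum; last by move=> k _; exact: h1.
  by apply/hasP; exists (Ordinal d0); rewrite ?mem_index_enum.
apply: (@le_trans _ _ ((d%:R * `|a k|) `^ p)).
  by rewrite ge0_ler_powR ?nnegrE ?mulr_ge0// ltW.
by rewrite powRM// ler_wpM2l ?powR_ge0// (bigD1 k)//= lerDl sumr_ge0.
Qed.

Lemma ln2_ge_half : 1 / 2 <= ln 2 :> R.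
Proof.
have h1 := expR_ge1Dx (- (1 / 2) : R); have h0 := expR_gt0 (1 / 2 : R).
have : expR (1 / 2) * expR (- (1 / 2)) = 1 :> R by rewrite -expRD subrr expR0.
move=> h2; have : expR (1 / 2) * (1 / 2) <= expR (1 / 2) * expR (- (1 / 2)) :> R.
  by rewrite ler_pM2l//; lra.
rewrite h2 => h3; rewrite -[leLHS]expRK ler_ln ?posrE//; lra.
Qed.

(** The left side is the constant of [noise_moment_le]. The base obeys [1 + eta / 2 <= 2^eta], and
    the exponent on the right is tailored to cancel a power of [2 ^ (- (eta + 1))]. *)
Lemma half_powR_le (eta : R) : 0 < eta ->
  ((eta + 2) / 2) `^ (eta + 2) * 4 <= 2 `^ (2 * (eta + 1) ^+ 2).
Proof.
move=> eta0; have p0 : 0 < eta + 2 by rewrite addr_gt0.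
have h : (eta + 2) / 2 <= 2 `^ eta.
  have : 1 + eta * ln 2 <= 2 `^ eta by rewrite /powR gt_eqF// expR_ge1Dx.
  have : eta * (1 / 2) <= eta * ln 2 by rewrite ler_wpM2l ?(ltW eta0)// ln2_ge_half.
  by move: (ln 2) (2 `^ eta) => l u; lra.
have -> : 4 = 2 `^ 2 :> R by rewrite powR_mulrn//; ring.
apply: (@le_trans _ _ (2 `^ (eta * (eta + 2)) * 2 `^ 2)).
  rewrite ler_wpM2r ?powR_ge0// powRrM ge0_ler_powR ?nnegrE ?powR_ge0 ?divr_ge0//; exact: ltW.
rewrite -powRD ?pnatr_eq0 ?implybT//; apply: ler_powR; first by lra.
rewrite -subr_ge0 (_ : _ - _ = eta ^+ 2 + 2 * eta); last by ring.
by rewrite addr_ge0 ?sqr_ge0// mulr_ge0// ltW.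
Qed.

End powR_sum.

(** * Comparison of the entropy weight with the stated constant *)

Section entropy_weight_bound.
Context {R : realType} {d : nat} {C : 'M[R]_d} (gam : probability 'rV[R]_d R).
Hypothesis Cp : posdefmx C.
Hypothesis gamE : forall A, measurable A ->
  gam A = (\int[lebesgue_rV d]_(x in A) (gaussian_pdf C x)%:E)%E.
Variables (kappa eta : R).
Hypotheses (kappa0 : 0 < kappa) (eta0 : 0 < eta).
Let p := eta + 2.
Let p0 : 0 < p. Proof. by rewrite addr_gt0. Qed.
Let e1 : 0 < eta + 1. Proof. by rewrite addr_gt0. Qed.
Local Notation Zt := (dual_noise (C := C)).
Local Notation mom := (noise_moment gam eta).
Local Notation nw := (noise_weight gam kappa).

Lemma Rintegrable_dual_noise_powR k : Rintegrable gam (fun z => `|Zt k z| `^ p).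
Proof.
set c := (\sum_j \sum_i `|invmx C i j|) * `|delta_mx 0 k : 'rV[R]_d|.
have c0 : 0 <= c by rewrite mulr_ge0// sumr_ge0// => j _; rewrite sumr_ge0.
apply: (@Rintegrable_l1_bound _ _ _ _ Cp gamE _ ((p / 2) `^ p) c) => //.
  apply: (measurableT_comp (measurable_powR p)); apply: measurableT_comp => //.
  exact: measurable_bform.
move=> z; rewrite ger0_norm ?powR_ge0//.
apply: le_trans (powR_le_expR _ p0) _ => //.
by rewrite ler_wpM2l ?powR_ge0// ler_expR bform_le.
Qed.

Lemma noise_moment_le_dual j :
  mom j <= d%:R `^ p * \sum_k `|C j k| `^ p * \int[gam]_z `|Zt k z| `^ p.
Proof.
have ik k := Rintegrable_dual_noise_powR k.
have iCk k := RintegrableZ (`|C j k| `^ p) (ik k).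
apply: (@le_trans _ _ (\int[gam]_z (d%:R `^ p * \sum_k `|C j k| `^ p * `|Zt k z| `^ p))).
  apply: le_Rintegral_setT; first exact: (Rintegral_coord_powR Cp gamE j p0).
    by apply: RintegrableZ; exact: Rintegrable_sum.
  move=> z; rewrite (noise_dual_noise Cp).
  apply: le_trans (powR_norm_sum_le _ p0) _.
  rewrite le_eqVlt; apply/orP; left; apply/eqP; congr (_ * _).
  by apply: eq_bigr => k _; rewrite normrM powRM.
rewrite RintegralZ_setT; last exact: Rintegrable_sum.
rewrite Rintegral_sum// le_eqVlt; apply/orP; left; apply/eqP; congr (_ * _).
by apply: eq_bigr => k _; rewrite RintegralZ_setT.
Qed.

(** Exponential moments at the scale of the standard deviation [s]: each of the two exponentials has
    mean at most 2, whence the 4. *)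
Lemma noise_moment_le j (s : R) : 0 < s -> C j j = s ^+ 2 ->
  mom j <= s `^ p * ((p / 2) `^ p * 4).
Proof.
move=> s0 Cs.
have [i1 h1] := gaussian_expR_coord Cp gamE s^-1 j.
have [i2 h2] := gaussian_expR_coord Cp gamE (- s^-1) j.
have E1 : expR (s^-1 ^+ 2 * C j j / 2) <= 2 :> R.
  rewrite Cs exprVn mulVf ?gt_eqF ?exprn_gt0//.
  by rewrite -[leRHS]lnK ?posrE// ler_expR; exact: ln2_ge_half.
apply: (@le_trans _ _ (\int[gam]_z (s `^ p * ((p / 2) `^ p *
    (expR (s^-1 * z 0 j) + expR (- s^-1 * z 0 j)))))).
  apply: le_Rintegral_setT; first exact: (Rintegral_coord_powR Cp gamE j p0).
    by do 2 apply: RintegrableZ; exact: RintegrableD.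
  move=> z; have zs : `|z 0 j| = s * `|s^-1 * z 0 j|.
    by rewrite normrM gtr0_norm ?invr_gt0// mulVKf// gt_eqF.
  rewrite zs powRM ?(ltW s0)// ler_wpM2l ?powR_ge0//.
  apply: le_trans (powR_le_expR _ p0) _ => //.
  rewrite ler_wpM2l ?powR_ge0// mulNr; move: (s^-1 * z 0 j) => y.
  have [y0|y0] := leP 0 y; first by rewrite ger0_norm// lerDl expR_ge0.
  by rewrite ltr0_norm// lerDr expR_ge0.
rewrite RintegralZ_setT; last by apply: RintegrableZ; exact: RintegrableD.
rewrite RintegralZ_setT; last exact: RintegrableD.
rewrite RintegralD_setT// h1 h2 sqrrN !ler_wpM2l ?powR_ge0//.
by move: E1; move: (expR _) => u; lra.
Qed.

Variables (s M M2 S : R).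
Hypothesis s0 : 0 <= s.
Hypothesis sP : forall j, Num.sqrt (C j j) <= s.
Hypothesis M0 : 0 <= M.
Hypothesis MP : forall k, (\int[gam]_z `|Zt k z| `^ p) `^ (eta + 1)^-1 <= M.
Hypothesis M2P : forall k, \int[gam]_z Zt k z ^+ 2 <= M2.
Hypothesis SP : \sum_j \sum_k (`|C j k| `^ p) `^ (eta + 1)^-1 <= S.
Hypothesis d0 : (0 < d)%N.

Let A := nw + s.
Let nw0 : 0 < nw. Proof. exact: (noise_weight_gt0 Cp gamE kappa0 (Ordinal d0)). Qed.
Let A0 : 0 < A. Proof. by rewrite ltr_pwDl. Qed.
Let mom0 j : 0 <= mom j. Proof. by apply: Rintegral_ge0 => x _; exact: powR_ge0. Qed.

(** Expanding [Z] as [C] times the dual noise produces the entries of [C] and the dual moments of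
    the stated constant. The power of [d] is at most 2 because [eta + 2 <= 2 (eta + 1)]. *)
Let noise_moment_powR_le j :
  mom j `^ (eta + 1)^-1 <= d%:R ^+ 2 * (M * \sum_k (`|C j k| `^ p) `^ (eta + 1)^-1).
Proof.
have r0 : 0 < (eta + 1)^-1 by rewrite invr_gt0.
have r1 : (eta + 1)^-1 <= 1 by rewrite invf_le1// lerDr ltW.
have Z0 k : 0 <= \int[gam]_z `|Zt k z| `^ p.
  by apply: Rintegral_ge0 => x _; exact: powR_ge0.
have F0 k : 0 <= `|C j k| `^ p * \int[gam]_z `|Zt k z| `^ p by rewrite mulr_ge0 ?powR_ge0.
apply: (@le_trans _ _ ((d%:R `^ p * \sum_k `|C j k| `^ p * \int[gam]_z `|Zt k z| `^ p)
    `^ (eta + 1)^-1)).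
  rewrite ge0_ler_powR ?nnegrE ?(ltW r0)//; last exact: noise_moment_le_dual.
  by rewrite mulr_ge0 ?powR_ge0 ?sumr_ge0.
rewrite powRM ?powR_ge0 ?sumr_ge0// ler_pM ?powR_ge0//.
  rewrite -powRrM -powR_mulrn//; apply: ler_powR; first by rewrite ler1n.
  by rewrite ler_pdivrMr// /p; have := eta0; lra.
apply: le_trans (powR_sum_le _ F0 r0 r1) _.
rewrite mulr_sumr; apply: ler_sum => k _; rewrite powRM ?powR_ge0// mulrC.
by rewrite ler_wpM2r ?powR_ge0.
Qed.

Let theta := eta / (eta + 1).
Let theta1 : theta + (eta + 1)^-1 = 1.
Proof. by rewrite /theta -[X in _ + X]mul1r -mulrDl divff// gt_eqF. Qed.

(** Above this threshold the missing power of [A], of exponent [1 / (eta + 1)], is at least one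
    half. Hence the linear [A], and the leading 2 of the constant. *)
Let entropy_weight_large : 2 `^ (- (eta + 1)) <= A ->
  entropy_weight gam kappa eta <= 2 * d%:R ^+ 2 * A * M * S.
Proof.
move=> hA.
have h1 : 1 / 2 <= A `^ (eta + 1)^-1.
  rewrite (_ : 1 / 2 = (2 `^ (- (eta + 1))) `^ (eta + 1)^-1); last first.
    by rewrite -powRrM mulNr divff ?gt_eqF// powR_inv1// mul1r.
  by rewrite ge0_ler_powR ?nnegrE ?powR_ge0 ?invr_ge0 ?(ltW A0) ?(ltW e1).
have hnw : nw `^ theta <= 2 * A.
  apply: (@le_trans _ _ (A `^ theta)).
    rewrite ge0_ler_powR ?nnegrE ?(ltW nw0) ?(ltW A0)// ?lerDl//.
    by rewrite divr_ge0 ?ltW.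
  have : A `^ theta * A `^ (eta + 1)^-1 = A.
    by rewrite -powRD ?theta1 ?powRr1 ?(ltW A0)// (gt_eqF A0) implybT.
  have := ler_wpM2l (powR_ge0 A theta) h1; move: (_ `^ _) (_ `^ _) => u v; lra.
rewrite /entropy_weight -/theta -mulr_sumr.
apply: (@le_trans _ _ (2 * A * (d%:R ^+ 2 * (M * S)))); last first.
  by rewrite le_eqVlt; apply/orP; left; apply/eqP; ring.
rewrite ler_pM ?powR_ge0//; first by apply: sumr_ge0 => j _; exact: powR_ge0.
apply: (@le_trans _ _ (\sum_j d%:R ^+ 2 * (M * \sum_k (`|C j k| `^ p) `^ (eta + 1)^-1))).
  by apply: ler_sum => j _; exact: noise_moment_powR_le.
by rewrite -mulr_sumr -mulr_sumr ler_wpM2l ?sqr_ge0// ler_wpM2l.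
Qed.

Let diag_sqrt j : [/\ 0 < Num.sqrt (C j j), C j j = Num.sqrt (C j j) ^+ 2
  & Num.sqrt (C j j) <= A].
Proof.
have c0 := posdefmx_diag_gt0 Cp j.
split; first by rewrite sqrtr_gt0.
  by rewrite sqr_sqrtr// ltW.
by rewrite (le_trans (sP j))// lerDr ltW.
Qed.

(** Both the noise weight and the standard deviations are at most [A]; together they give [A] to the
    power [2 (eta + 1)], which cancels the constant of [half_powR_le]. *)
Let entropy_weight_small : A <= 2 `^ (- (eta + 1)) ->
  entropy_weight gam kappa eta <= d%:R.
Proof.
move=> hA.
suff h j : nw `^ theta * mom j `^ (eta + 1)^-1 <= 1.
  apply: (@le_trans _ _ (\sum_(j < d) 1)); first by apply: ler_sum => j _; exact: h.
  by rewrite sumr_const card_ord.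
rewrite /theta powRrM -powRM ?powR_ge0//.
have [sj Cj sA] := diag_sqrt j.
apply: (@le_trans _ _ (1 `^ (eta + 1)^-1)); last by rewrite powR1.
rewrite ge0_ler_powR ?nnegrE ?mulr_ge0 ?powR_ge0 ?invr_ge0 ?(ltW e1)//.
apply: (@le_trans _ _ (A `^ eta * (A `^ p * 2 `^ (2 * (eta + 1) ^+ 2)))).
  rewrite ler_pM ?powR_ge0//.
    by rewrite ge0_ler_powR ?nnegrE ?(ltW nw0) ?(ltW A0) ?(ltW eta0)// lerDl.
  apply: le_trans (noise_moment_le sj Cj) _; rewrite ler_pM ?powR_ge0//.
  - by rewrite mulr_ge0 ?powR_ge0.
  - by rewrite ge0_ler_powR ?nnegrE ?(ltW sj) ?(ltW A0) ?(ltW p0).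
  - exact: half_powR_le.
rewrite mulrA -powRD; last by rewrite (gt_eqF A0) implybT.
apply: (@le_trans _ _ ((2 `^ (- (eta + 1))) `^ (eta + p) * 2 `^ (2 * (eta + 1) ^+ 2))).
  rewrite ler_wpM2r ?powR_ge0// ge0_ler_powR ?nnegrE ?powR_ge0 ?(ltW A0)//.
  by rewrite addr_ge0 ?ltW.
rewrite -powRrM -powRD; last by rewrite pnatr_eq0 implybT.
by rewrite (_ : _ + _ = 0) ?powRr0// /p; ring.
Qed.

(** A noise coordinate and its dual have covariance 1, so a small variance forces a large dual one.
    Young's inequality with weights 2 and 1/8 reads [1 <= 2 C j j + M2 / 8], and here
    [C j j <= 1 / 4]. *)
Let dual_energy_small : A <= 2 `^ (- (eta + 1)) -> 4 <= M2.
Proof.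
move=> hA; pose j := Ordinal d0; have [sj Cj sA] := diag_sqrt j.
have A2 : A <= 1 / 2.
  apply: le_trans hA _; rewrite -[leRHS]mul1r mulrA mul1r mul1r -powR_inv1//.
  by apply: ler_powR; [lra|have := eta0; lra].
have C4 : C j j <= 1 / 4.
  rewrite Cj (_ : 1 / 4 = (1 / 2) ^+ 2); last by field.
  by rewrite lerXn2r ?nnegrE ?(ltW sj) ?(le_trans sA A2)// divr_ge0.
have iz := square_Rintegrable_coord Cp gamE j.
have ik := square_Rintegrable_dual_noise Cp gamE j.
have : \int[gam]_z (z 0 j * Zt j z) <=
    \int[gam]_z (2 * z 0 j ^+ 2 + 8^-1 * Zt j z ^+ 2).
  apply: le_Rintegral_setT; first exact: square_RintegrableM.
    by apply: RintegrableD; apply: RintegrableZ; [exact: iz.2|exact: ik.2].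
  move=> z; have := sqr_ge0 (4 * z 0 j - Zt j z); move: (z 0 j) (Zt j z) => u v.
  by rewrite sqrrB; lra.
have -> : \int[gam]_z (z 0 j * Zt j z) = 1.
  by rewrite (gaussian_coord_form Cp gamE) mxE !eqxx.
rewrite RintegralD_setT; [|exact/RintegrableZ/iz.2|exact/RintegrableZ/ik.2].
rewrite RintegralZ_setT; last exact: iz.2.
rewrite RintegralZ_setT; last exact: ik.2.
have -> : \int[gam]_z z 0 j ^+ 2 = C j j.
  by rewrite -(gaussian_covariance Cp gamE); apply: eq_Rintegral_setT => z; rewrite expr2.
have := M2P j; move: (\int[gam]_z _) (C j j) C4 => u c; lra.
Qed.

(* The time at which the two regimes are glued may be rescaled by [sigma]; the
   choice [sigma = 2] pays off when the noise is so small that the total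
   variation bound is far better than needed. *)
Lemma entropy_weight_le : exists sigma : R, [/\ 1 <= sigma, sigma <= 2 &
  entropy_weight gam kappa eta * sigma - d%:R * M2 * ln sigma <=
    2 * d%:R ^+ 2 * (nw + s) * M * S].
Proof.
have S0 : 0 <= S.
  apply: le_trans SP; apply: sumr_ge0 => j _; apply: sumr_ge0 => k _; exact: powR_ge0.
have [hA|hA] := leP (2 `^ (- (eta + 1))) A.
  exists 1; rewrite lexx ler1n mulr1 ln1 mulr0 subr0.
  by split => //; exact: entropy_weight_large.
(* The left side is then nonpositive: twice the weight is at most [2 d], while [M2 * ln 2] is at
   least 2. *)
exists 2; rewrite lexx ler1n; split => //.
apply: (@le_trans _ _ 0); last first.
  by rewrite !mulr_ge0 ?sqr_ge0// ltW.
have h1 := entropy_weight_small (ltW hA); have h2 := dual_energy_small (ltW hA).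
have h3 : 4 * (1 / 2) <= M2 * ln 2 :> R.
  by rewrite ler_pM// ln2_ge_half.
have h4 : d%:R * (4 * (1 / 2)) <= d%:R * (M2 * ln 2) by rewrite ler_wpM2l.
rewrite -mulrA; move: (_ * ln 2) h4 => u; move: (entropy_weight _ _ _) h1 => y.
move: (d%:R) => x; lra.
Qed.

End entropy_weight_bound.

(** A vanishing normaliser would make the density identically 0, division by 0 being 0, against
    total mass 1. No determinant is computed. *)
Lemma gaussian_pdf_gt0 (R : realType) d (C : 'M[R]_d) (gam : probability 'rV[R]_d R) :
  (forall A, measurable A ->
    gam A = (\int[lebesgue_rV d]_(x in A) (gaussian_pdf C x)%:E)%E) ->
  forall x, 0 < gaussian_pdf C x.
Proof.
move=> gamE x; rewrite divr_gt0 ?expR_gt0// lt_neqAle sqrtr_ge0 andbT eq_sym.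
apply/eqP => h0; have := gamE _ measurableT.
under eq_integral do rewrite /gaussian_pdf h0 invr0 mulr0.
by rewrite integral0 => h; have := probability_setT gam; rewrite h => /eqP; rewrite eq_sym onee_eq0.
Qed.

(** * Choice of the switching time *)

Section stein_relative_entropy.
Context {R : realType} {d : nat} {C : 'M[R]_d}.
Variables (mu gam : probability 'rV[R]_d R).
Hypothesis Cp : posdefmx C.
Hypothesis gamE : forall A, measurable A ->
  gam A = (\int[lebesgue_rV d]_(x in A) (gaussian_pdf C x)%:E)%E.
Hypothesis mu2 : square_Rintegrable_rV mu (@id 'rV[R]_d).
Hypothesis mu_mean : forall i, \int[mu]_x x 0 i = 0.
Hypothesis mu_cov : forall i j, \int[mu]_x (x 0 i * x 0 j) = C i j.
Variable f : 'rV[R]_d -> R.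
Hypotheses (mf : measurable_fun setT f) (f0 : forall x, 0 <= f x).
Hypothesis muE : forall A, measurable A ->
  mu A = (\int[lebesgue_rV d]_(x in A) (f x)%:E)%E.
Variables (kappa alpha eta : R).
Hypotheses (kappa0 : 0 < kappa) (alpha0 : 0 < alpha) (eta0 : 0 < eta).
Hypothesis tv : forall (A : set 'rV[R]_d) (z : 'rV[R]_d) (t : R), measurable A ->
  1 / 2 <= t <= 1 ->
  `|fine (mu ((fun y => Num.sqrt t *: y + Num.sqrt (1 - t) *: z) @^-1` A)) - fine (mu A)|
    <= kappa * (1 + l1_norm z) * (1 - t) `^ alpha.

Variable tau : 'rV[R]_d -> 'M[R]_d.
Hypothesis tau1 : forall i j, Rintegrable mu (fun x => tau x i j).
Hypothesis stein : forall (i : 'I_d) (g : 'rV[R]_d -> R),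
  (forall x, differentiable g x) ->
  Rintegrable mu (fun x => x 0 i * g x) ->
  (forall j, Rintegrable mu (fun x => tau x i j * 'D_(delta_mx 0 j) g x)) ->
  \int[mu]_x (x 0 i * g x) =
  \sum_j \int[mu]_x (tau x i j * 'D_(delta_mx 0 j) g x).
Hypothesis tau2 : forall i j, square_Rintegrable mu (fun x => C i j - tau x i j).

Variables (s M M2 S : R).
Hypothesis s0 : 0 <= s.
Hypothesis sP : forall j, Num.sqrt (C j j) <= s.
Hypothesis M0 : 0 <= M.
Hypothesis MP : forall k,
  (\int[gam]_z `|dual_noise (C := C) k z| `^ (eta + 2)) `^ (eta + 1)^-1 <= M.
Hypothesis M2_ge0 : 0 <= M2.
Hypothesis M2P : forall k, \int[gam]_z dual_noise (C := C) k z ^+ 2 <= M2.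
Hypothesis SP : \sum_j \sum_k (`|C j k| `^ (eta + 2)) `^ (eta + 1)^-1 <= S.
Hypothesis d0 : (0 < d)%N.
Hypothesis alpha_le : alpha <= 1 / 2.

Let D := \sum_j \sum_l \int[mu]_x (C j l - tau x j l) ^+ 2.
Let lam := lambda_max (invmx C).
Hypothesis D_le : D <= 2 `^ (- ((eta + 1) / (alpha * eta))).

Lemma stein_relative_entropy_le :
  (relative_entropy f (gaussian_pdf C) <=
    (lam * (eta + 1) / (2 * alpha * eta) * (d%:R * M2 * (D * `|ln D|) +
      2 * d%:R ^+ 2 * (noise_weight gam kappa + s) * M * S * D))%:E)%E.
Proof.
have Ci := posdefmx_inv_sym Cp.
have lam0 : 0 <= lam.
  by apply: lambda_max_ge0 => // x; exact: bform_inv_ge0.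
have lamP (x : 'rV[R]_d) : bform (invmx C) x x <= lam * \sum_i x 0 i ^+ 2.
  exact: bform_le_lambda_max.
rewrite /relative_entropy; apply: (relative_entropy_le mf f0 measurable_gaussian_pdf (gaussian_pdf_gt0 gamE) muE gamE).
move=> g K r mg gK er.
have [Dz|Dnz] := eqVneq D 0.
  rewrite Dz mul0r !mulr0 addr0 mulr0 add0r.
  exact: (stein_entropy_le0 Cp gamE mu2 mu_mean mu_cov alpha0 tv tau1 stein tau2
    lamP lam0 M2_ge0 M2P Dz mg gK er).
have D0 : 0 < D.
  rewrite lt_neqAle eq_sym Dnz/=; apply: sumr_ge0 => j _; apply: sumr_ge0 => l _.
  by apply: Rintegral_ge0 => x _; exact: sqr_ge0.
have [sg [sg1 sg2 hsg]] := entropy_weight_le Cp gamE kappa0 eta0 s0 sP M0 MP M2P SP d0.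
have sg0 : 0 < sg by exact: lt_le_trans sg1.
have e1 : 0 < eta + 1 by rewrite addr_gt0.
pose beta := alpha * (eta / (eta + 1)).
have beta0 : 0 < beta by rewrite mulr_gt0// divr_gt0.
have betaV : (eta + 1) / (alpha * eta) = beta^-1.
  by rewrite /beta; field; rewrite !gt_eqF.
have beta_le : beta <= 1 / 2.
  apply: le_trans alpha_le; rewrite ler_piMr ?(ltW alpha0)//.
  by rewrite ler_pdivrMr// mul1r lerDl.
have betaV2 : 2 <= beta^-1.
  by rewrite -[leLHS]invrK lef_pV2 ?posrE ?invr_gt0//; lra.
have D1 : D <= 1.
  apply: le_trans D_le _; rewrite betaV -[leRHS](powRr0 2).
  by apply: ler_powR; lra.
have sD0 : 0 < sg * D by rewrite mulr_gt0.
(* The factor [sg <= 2] costs one power of 2, which is affordable since [alpha <= 1 / 2] gives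
   [beta <= 1 / 2] and so [1 - 1 / beta <= - beta]. *)
have sD : sg * D <= 2 `^ (- beta).
  apply: (@le_trans _ _ (2 `^ 1 * 2 `^ (- beta^-1))).
    rewrite powRr1// ler_pM ?(ltW sg0) ?(ltW D0)//.
    by rewrite -betaV.
  by rewrite -powRD ?pnatr_eq0 ?implybT//; apply: ler_powR; lra.
(* The switching time solves [w ^ (- beta) = sg * D]. The second regime then contributes a multiple
   of [D], and the logarithm of the first is [(|ln D| - ln sg) / beta]. *)
pose w := (sg * D) `^ (- beta^-1).
have w2 : 2 <= w.
  rewrite [leLHS](_ : 2 = (2 `^ (- beta)) `^ (- beta^-1)).
    rewrite /w !powRN lef_pV2 ?posrE ?powR_gt0//.
    by rewrite ge0_ler_powR ?nnegrE ?powR_ge0 ?invr_ge0 ?(ltW beta0) ?(ltW sD0)// -powRN.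
  by rewrite -powRrM mulrNN divff ?gt_eqF// powRr1.
have wb : w `^ (- beta) = sg * D.
  by rewrite /w -powRrM mulrNN mulVf ?gt_eqF// powRr1// ltW.
have lw : ln w = beta^-1 * (`|ln D| - ln sg).
  rewrite /w ln_powR lnM ?posrE// ler0_norm ?ln_le0//; ring.
apply: le_trans (stein_entropy_le Cp gamE mu2 mu_mean mu_cov kappa0 alpha0 eta0 tv tau1 stein tau2
    lamP lam0 M2_ge0 M2P w2 mg gK er) _.
rewrite !lerB// lerD2r -/D -/beta wb lw.
have -> : lam * (eta + 1) / (2 * alpha * eta) = lam / (2 * beta).
  by rewrite /beta; field; rewrite !gt_eqF.
rewrite -subr_ge0.
move: hsg; move: (entropy_weight _ _ _) (2 * d%:R ^+ 2 * _ * M * S) => Y EC hY.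
move: (ln sg) (`|ln D|) hY => ls lD hY.
(* The remaining difference is the slack of [entropy_weight_le] times a nonnegative factor. *)
rewrite (_ : _ - _ = lam / (2 * beta) * D * (EC - (Y * sg - d%:R * M2 * ls))).
  by rewrite mulr_ge0 ?subr_ge0// mulr_ge0 ?(ltW D0)// divr_ge0// mulr_ge0 ?(ltW beta0).
by field; rewrite gt_eqF.
Qed.

End stein_relative_entropy.

(** * From random vectors to laws *)

Section law.
Context dT d (T : measurableType dT) (T' : measurableType d) {R : realType}.
Variables (P : probability T R) (X : {RV P >-> T'}).
Implicit Type h : T' -> R.

Lemma Rintegrable_distribution h : measurable_fun setT h ->
  Rintegrable (distribution P X) h <-> (fun w => h (X w)) \in Lfun P 1.
Proof.
move=> mh; rewrite Lfun1_integrable.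
have mhX : measurable_fun setT (fun w => h (X w)) by exact: measurableT_comp.
have e : (\int[distribution P X]_x `|(EFin \o h) x| = \int[P]_w `|(EFin \o (fun w => h (X w))) w|)%E.
  rewrite ge0_integral_distribution//; apply: measurableT_comp => //.
  exact/measurable_EFinP.
split=> /integrableP[_ i]; apply/integrableP; split; try exact/measurable_EFinP.
- by rewrite -e.
- by rewrite e.
Qed.

Lemma expectation_distribution h : measurable_fun setT h ->
  (fun w => h (X w)) \in Lfun P 1 ->
  ('E_P[fun w => h (X w)] = (\int[distribution P X]_x h x)%:E)%E.
Proof.
move=> mh hX; rewrite -EFin_Rintegral; last exact/Rintegrable_distribution.
have iX : P.-integrable setT (EFin \o (fun w => h (X w))) by exact/Lfun1_integrable.
have mE : measurable_fun setT (EFin \o h) by exact/measurable_EFinP.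
by rewrite unlock (integral_distribution mE iX).
Qed.

Lemma ge0_expectation_distribution h : measurable_fun setT h -> (forall x, 0 <= h x) ->
  ('E_P[fun w => h (X w)] = \int[distribution P X]_x (h x)%:E)%E.
Proof.
move=> mh h0; have mE : measurable_fun setT (EFin \o h) by exact/measurable_EFinP.
by rewrite unlock (ge0_integral_distribution X mE).
Qed.

Lemma fine_expectation_distribution h : measurable_fun setT h -> (forall x, 0 <= h x) ->
  fine 'E_P[fun w => h (X w)]%E = \int[distribution P X]_x h x.
Proof. by move=> mh h0; rewrite ge0_expectation_distribution. Qed.

End law.

Section random_vector_law.
Context dO (Omega : measurableType dO) {R : realType} (P : probability Omega R) {d : nat}.
Variable F : {RV P >-> 'rV[R]_d}.
Local Notation mu := (distribution P F).

Lemma square_integrable_distribution : square_integrable F ->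
  square_Rintegrable_rV mu (@id 'rV[R]_d).
Proof.
move=> F2 i; split; first exact: measurable_coord.
apply/(@Rintegrable_distribution _ _ _ _ _ P F (fun x => x 0 i ^+ 2)).
  by apply: measurable_funX; exact: measurable_coord.
by apply/Lfun1_integrable; exact: (Lfun2_integrable_sqr (F2 i)).
Qed.

Let coord1 i : square_integrable F -> (fun w => F w 0 i) \in Lfun P 1.
Proof. by move=> F2; apply: Lfun_subset12 => //; rewrite fin_num_measure. Qed.

Lemma centered_distribution i : square_integrable F -> centered F ->
  \int[mu]_x x 0 i = 0.
Proof.
move=> F2 F0; have := expectation_distribution (@measurable_coord R d i) (coord1 i F2).
by rewrite (F0 i) => -[].
Qed.

Lemma covariance_distribution C i j : square_integrable F -> centered F ->
  covariance_matrix F C -> \int[mu]_x (x 0 i * x 0 j) = C i j.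
Proof.
move=> F2 F0 FC; apply: EFin_inj; rewrite -(FC i j).
have F11 := Lfun2_mul_Lfun1 (F2 i) (F2 j).
rewrite covarianceE ?coord1// (F0 i) (F0 j) mule0 sube0.
rewrite (expectation_distribution (X := F) (h := fun x => x 0 i * x 0 j))//.
by apply: measurable_funM; exact: measurable_coord.
Qed.

Lemma tv_distance_distribution (G : 'rV[R]_d -> 'rV[R]_d) e A :
  measurable_fun setT G -> measurable A ->
  (tv_distance P (fun w => G (F w)) F <= e%:E)%E ->
  `|fine (mu (G @^-1` A)) - fine (mu A)| <= e.
Proof.
move=> mG mA h; rewrite -lee_fin; apply: le_trans h; apply: ereal_sup_ubound.
have mGA : measurable (G @^-1` A) by rewrite -[X in measurable X]setTI; exact: mG.
exists A => //; transitivity (`|mu (G @^-1` A) - mu A|)%E => //.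
rewrite -[mu (G @^-1` A)]fineK ?fin_num_measure//.
by rewrite -[X in (_ - X)%E]fineK ?fin_num_measure.
Qed.

Lemma stein_matrix_distribution tau : stein_matrix F tau ->
  (forall i j, Rintegrable mu (fun x => tau x i j)) /\
  forall (i : 'I_d) (g : 'rV[R]_d -> R),
    (forall x, differentiable g x) ->
    Rintegrable mu (fun x => x 0 i * g x) ->
    (forall j, Rintegrable mu (fun x => tau x i j * 'D_(delta_mx 0 j) g x)) ->
    \int[mu]_x (x 0 i * g x) =
      \sum_j \int[mu]_x (tau x i j * 'D_(delta_mx 0 j) g x).
Proof.
move=> [mtau tau1 st]; split.
  move=> i j; apply/Rintegrable_distribution; last exact: tau1.
  exact: (measurableT_comp (@measurable_mx_coord R d d i j) mtau).
move=> i g dg i1 i2.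
have m1 := Rintegrable_measurable i1.
have m2 j := Rintegrable_measurable (i2 j).
have l1 := (Rintegrable_distribution F m1).1 i1.
have l2 j := (Rintegrable_distribution F (m2 j)).1 (i2 j).
have := st i g dg l1 l2; rewrite (expectation_distribution m1 l1).
under eq_bigr do rewrite (expectation_distribution (m2 _) (l2 _)).
by rewrite sumEFin => -[].
Qed.

(** Each of the finitely many nonnegative terms is below a finite total, so every entry of [C - tau]
    is square integrable and the discrepancy is a real number. *)
Lemma stein_discrepancy_distribution C tau : measurable_fun setT tau ->
  (stein_discrepancy F C tau < +oo)%E ->
  (forall i j, square_Rintegrable mu (fun x => C i j - tau x i j)) /\
  stein_discrepancy F C tau = (\sum_j \sum_k \int[mu]_x (C j k - tau x j k) ^+ 2)%:E.
Proof.
move=> mtau fin; have m j k : measurable_fun setT (fun x => C j k - tau x j k).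
  apply: measurable_funB => //.
  exact: (measurableT_comp (@measurable_mx_coord R d d j k) mtau).
have m2 j k : measurable_fun setT (fun x => (C j k - tau x j k) ^+ 2).
  exact: measurable_funX.
have e j k : ('E_P[fun w => ((C j k - tau (F w) j k) ^+ 2)%R] =
    \int[mu]_x ((C j k - tau x j k) ^+ 2)%:E)%E.
  by rewrite (ge0_expectation_distribution F (m2 j k))// => x; exact: sqr_ge0.
have p0 j k : (0 <= \int[mu]_x ((C j k - tau x j k) ^+ 2)%:E)%E.
  by apply: integral_ge0 => x _; rewrite lee_fin sqr_ge0.
move: fin; rewrite stein_discrepancyE//.
under eq_bigr do under eq_bigr do rewrite e.
move=> fin.
have sq j k : square_Rintegrable mu (fun x => C j k - tau x j k).
  split=> //; apply: ge0_Rintegrable => //; first by move=> x; exact: sqr_ge0.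
  apply: le_lt_trans fin; rewrite (bigD1 j)//= (bigD1 k)//= -addeA leeDl//.
  by rewrite adde_ge0// sume_ge0// => i _; rewrite sume_ge0.
split=> //; rewrite -sumEFin; apply: eq_bigr => j _; rewrite -sumEFin.
by apply: eq_bigr => k _; rewrite EFin_Rintegral//; exact: (sq j k).2.
Qed.

End random_vector_law.

Theorem theorem2p11 (R : realType) (dO : measure_display)
    (Omega : measurableType dO) (P : probability Omega R)
    (d : nat) (d_gt0 : (0 < d)%N)
    (F : {RV P >-> 'rV[R]_d}) (f : 'rV[R]_d -> R) (C : 'M[R]_d)
    (tau : 'rV[R]_d -> 'M[R]_d) (Z : {RV P >-> 'rV[R]_d})
    (F_centered : centered F)
    (F_square_integrable : square_integrable F)
    (F_density : has_density F f)
    (F_covariance : covariance_matrix F C)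
    (C_posdef : posdefmx C)
    (F_stein : stein_matrix F tau)
    (Z_gaussian : gaussian_rV Z C)
    (FZ_independent : independent_rV F Z)
    (kappa eta alpha : R)
    (kappa_gt0 : 0 < kappa) (eta_gt0 : 0 < eta)
    (alpha_gt0 : 0 < alpha) (alpha_le : alpha <= 1 / 2)
    (tau_moment : forall j k : 'I_d,
      ('E_P[fun w => (`|tau (F w) j k| `^ (eta + 2))%R] < +oo)%E)
    (F_TV : forall (x : 'rV[R]_d) (t : R), 1 / 2 <= t <= 1 ->
      (tv_distance P
         (fun w => (Num.sqrt t *: F w + Num.sqrt (1 - t) *: x)%R) F
       <= (kappa * (1 + l1_norm x) * (1 - t) `^ alpha)%:E)%E)
    (Delta_le : (stein_discrepancy F C tau
       <= (2 `^ (- ((eta + 1) / (alpha * eta))))%:E)%E) :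
  let Delta := fine (stein_discrepancy F C tau) in
  (relative_entropy f (gaussian_pdf C) <=
   (d%:R * (eta + 1) * lambda_max (invmx C) / (2 * alpha * eta)
      * (\big[Num.max/0]_(l < d) fine 'E_P[fun w => (Ztilde C Z l w ^+ 2)%R]%E)
      * (Delta * `|ln Delta|)
    + entropy_const eta kappa C F Z tau * (eta + 1) * lambda_max (invmx C)
        / (2 * alpha * eta) * Delta)%:E)%E.
Proof.
have [mf f0 muE] := F_density; have [_ _ gamE] := Z_gaussian.
have [mtau _ _] := F_stein.
have [tau1 stein] := stein_matrix_distribution F_stein.
have fin : (stein_discrepancy F C tau < +oo)%E by rewrite (le_lt_trans Delta_le)// ltry.
have [tau2 DE] := stein_discrepancy_distribution mtau fin.
move: Delta_le; rewrite DE lee_fin => D_le /=.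
pose mu := distribution P F; pose gam := distribution P Z.
(* The argument is carried out on the laws of [F] and [Z], so the supremum over events is used one
   measurable set at a time. *)
have tv (A : set 'rV[R]_d) (z : 'rV[R]_d) (t : R) : measurable A -> 1 / 2 <= t <= 1 ->
    `|fine (mu ((fun y => Num.sqrt t *: y + Num.sqrt (1 - t) *: z) @^-1` A)) - fine (mu A)|
      <= kappa * (1 + l1_norm z) * (1 - t) `^ alpha.
  move=> mA t12; apply: tv_distance_distribution mA (F_TV z t t12).
  exact: measurable_rV_affine.
have mZt l : measurable_fun setT (dual_noise (C := C) l) by exact: measurable_bform.
have ZtE (h : R -> R) l : (fun w => h (Ztilde C Z l w)) = (fun w => h (dual_noise (C := C) l (Z w))).
  by apply/funext => w; rewrite dual_noiseE.
have mZtp l : measurable_fun setT (fun z => `|dual_noise (C := C) l z| `^ (eta + 2)).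
  apply: (measurableT_comp (measurable_powR (eta + 2))); exact: measurableT_comp.
pose M := \big[Num.max/0]_(l < d)
  (fine 'E_P[fun w => (`|Ztilde C Z l w| `^ (eta + 2))%R]%E `^ (eta + 1)^-1).
pose M2 := \big[Num.max/0]_(l < d) fine 'E_P[fun w => (Ztilde C Z l w ^+ 2)%R]%E.
pose S := \sum_(j < d) \sum_(k < d) (`|C j k| `^ (eta + 2) +
  fine 'E_P[fun w => (`|tau (F w) j k| `^ (eta + 2))%R]%E) `^ (eta + 1)^-1.
pose s := Num.sqrt (\big[Num.max/0]_(j < d) C j j).
have MP k : (\int[gam]_z `|dual_noise (C := C) k z| `^ (eta + 2)) `^ (eta + 1)^-1 <= M.
  rewrite -(fine_expectation_distribution Z (mZtp k)); last by move=> x; exact: powR_ge0.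
  rewrite -(ZtE (fun x => `|x| `^ (eta + 2))).
  exact: (le_bigmax 0 (fun l => fine 'E_P[fun w => (`|Ztilde C Z l w| `^ (eta + 2))%R]%E `^ (eta + 1)^-1)).
have M2P k : \int[gam]_z dual_noise (C := C) k z ^+ 2 <= M2.
  rewrite -(fine_expectation_distribution Z (measurable_funX 2 (mZt k))); last first.
    by move=> x; exact: sqr_ge0.
  rewrite -(ZtE (fun x => x ^+ 2)).
  exact: (le_bigmax 0 (fun l => fine 'E_P[fun w => (Ztilde C Z l w ^+ 2)%R]%E)).
have sP j : Num.sqrt (C j j) <= s.
  by apply: ler_wsqrtr; exact: (le_bigmax 0 (fun j => C j j)).
have M0 : 0 <= M by exact: bigmax_ge_id.
have M20 : 0 <= M2 by exact: bigmax_ge_id.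
have SP : \sum_j \sum_k (`|C j k| `^ (eta + 2)) `^ (eta + 1)^-1 <= S.
  apply: ler_sum => j _; apply: ler_sum => k _.
  have t0 : 0 <= fine 'E_P[fun w => (`|tau (F w) j k| `^ (eta + 2))%R]%E.
    by rewrite fine_ge0// expectation_ge0// => w; exact: powR_ge0.
  rewrite ge0_ler_powR ?nnegrE ?addr_ge0 ?powR_ge0 ?lerDl// invr_ge0.
  by rewrite addr_ge0// ltW.
apply: le_trans (stein_relative_entropy_le C_posdef gamE
  (square_integrable_distribution F_square_integrable)
  (fun i => centered_distribution i F_square_integrable F_centered)
  (fun i j => covariance_distribution i j F_square_integrable F_centered F_covariance)
  mf f0 muE kappa_gt0 alpha_gt0 eta_gt0 tv tau1 stein tau2 (sqrtr_ge0 _) sP M0 MP M20 M2P SP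
  d_gt0 alpha_le D_le) _.
rewrite lee_fin /entropy_const -/M -/S -/s -/M2.
have -> : 2 * kappa * fine 'E_P[fun w => (l1_norm (Z w) * (1 + l1_norm (Z w)))%R]%E =
    noise_weight gam kappa.
  rewrite /noise_weight -(fine_expectation_distribution Z)//.
    by apply: measurable_funM; [|apply: measurable_funD => //]; exact: measurable_l1_norm.
  by move=> x; rewrite mulr_ge0 ?addr_ge0 ?l1_norm_ge0.
rewrite le_eqVlt; apply/orP; left; apply/eqP.
move: (noise_weight _ _) (lambda_max _) (\sum_(j < d) _) => nw lam D; move: (`|ln D|) => lD.
by field; rewrite !gt_eqF.
Qed.
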